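(* For every non-computable c.e. set $D$ there are c.e. sets $A,B\le_{\mathrm T}D$ such that $A\not\le_{\mathrm{ML}}B$ and $B\not\le_{\mathrm{ML}}A$.
   Context: $B\le_{\mathrm{ML}}A$ means: for every ML-random $Y$, $A\le_{\mathrm T}Y$ implies $B\le_{\mathrm T}Y$. *)

(* Defs.v *)
From Stdlib Require Import Arith List.
Import ListNotations.

Definition set_nat := nat -> bool.

Inductive rf : Type :=
| RZero
| RSucc
| RProj (i : nat)
| ROracle
| RComp (f : rf) (gs : list rf)
| RPrec (f g : rf)
| RMu (f : rf).

Definition b2n (b : bool) : nat := if b then 1 else 0.

Inductive eval (X : nat -> bool) : rf -> list nat -> nat -> Prop :=
| eZero xs : eval X RZero xs 0
| eSucc xs : eval X RSucc xs (S (hd 0 xs))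
| eProj i xs : eval X (RProj i) xs (nth i xs 0)
| eOracle xs : eval X ROracle xs (b2n (X (hd 0 xs)))
| eComp f gs xs ys y :
    evals X gs xs ys -> eval X f ys y -> eval X (RComp f gs) xs y
| ePrec0 f g xs y : eval X f xs y -> eval X (RPrec f g) (0 :: xs) y
| ePrecS f g n xs r y :
    eval X (RPrec f g) (n :: xs) r -> eval X g (n :: r :: xs) y ->
    eval X (RPrec f g) (S n :: xs) y
| eMu f xs y :
    eval X f (y :: xs) 0 ->
    (forall z, z < y -> exists v, v <> 0 /\ eval X f (z :: xs) v) ->
    eval X (RMu f) xs y
with evals (X : nat -> bool) : list rf -> list nat -> list nat -> Prop :=
| esNil xs : evals X [] xs []
| esCons g gs xs y ys :
    eval X g xs y -> evals X gs xs ys -> evals X (g :: gs) xs (y :: ys).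

Definition empty_oracle : nat -> bool := fun _ => false.

Definition turing_le (A X : nat -> bool) : Prop :=
  exists e : rf, forall n, eval X e [n] (b2n (A n)).

Definition computable (A : set_nat) : Prop := turing_le A empty_oracle.

Definition ce (A : set_nat) : Prop :=
  exists e : rf, forall n, A n = true <-> exists v, eval empty_oracle e [n] v.

(* Binary strings and their (bijective) coding by natural numbers. *)
Fixpoint code_str (s : list bool) : nat :=
  match s with
  | [] => 0
  | b :: s' => S (2 * code_str s' + b2n b)
  end.

Fixpoint prefixb (s t : list bool) : bool :=
  match s, t with
  | [], _ => true
  | b :: s', c :: t' => Bool.eqb b c && prefixb s' t'
  | _ :: _, [] => false
  end.

Fixpoint all_strings (m : nat) : list (list bool) :=
  match m with
  | 0 => [[]]
  | S m' => map (cons false) (all_strings m') ++ map (cons true) (all_strings m')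
  end.

Definition in_cyl (s : list bool) (X : nat -> bool) : Prop :=
  forall i, i < length s -> nth i s false = X i.

(* A Martin-Loef test: a uniformly c.e. sequence (U_n) of sets of strings
   such that the open set [U_n] has measure <= 2^-n.  The measure condition
   is stated for every finite subfamily L of U_n: the measure of the union of
   the cylinders of L, computed as (#strings of length m extending a member
   of L) / 2^m for any m bounding the lengths, is <= 2^-n. *)
Definition ML_test (U : nat -> list bool -> Prop) : Prop :=
  (exists e : rf, forall n s,
      U n s <-> exists v, eval empty_oracle e [n; code_str s] v) /\
  (forall n m (L : list (list bool)),
      (forall s, In s L -> U n s /\ length s <= m) ->
      2 ^ n * length (filter (fun t => existsb (fun s => prefixb s t) L)
                              (all_strings m)) <= 2 ^ m).

Definition ML_random (Y : nat -> bool) : Prop :=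
  forall U, ML_test U -> exists n, forall s, U n s -> ~ in_cyl s Y.

Definition ML_le (B A : set_nat) : Prop :=
  forall Y, ML_random Y -> turing_le A Y -> turing_le B Y.

(* Main.v *)
Require Import Defs.
From Stdlib Require Import Arith List Lia Cantor Bool ClassicalDescription.
Import ListNotations.

(** The real [Y_b] ([b = 0, 1]) is the union of the strings [rho] of the levels [i] of parity [b]. A level
    [i >= 1] of parity [b] makes [Y_b] fail to compute [A_(1-b)] through the functional with index
    [(i - 1) / 2]. It works inside a class of positive measure that lies above [rho_(i-2)] and avoids a
    universal Martin-Loef test. Given a follower [n], either a large part of the class avoids
    [Phi(X; n) = 0], and the level restricts the class to that part; or [Phi(X; n) = 0] holds on a large
    part, and then the follower is realised: if its index [k] later enters [D], the level puts [n] into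
    [A_(1-b)] and restricts the class to [Phi(X; n) = 0]. If the level ran through infinitely many realised
    followers without acting, then [D] would be computable. Hence each level acts finitely often.

    [Y_(1-b)] computes [A_(1-b)] with use [rho_(i-1)] on the followers of level [i]. When level [i] acts, the
    string [rho_(i-1)] becomes an error string and leaves the class of all later strings of [Y_(1-b)]. Since
    error strings have pairwise distinct lengths [>= 3], they cover measure at most [1/4]. If [rho_(i-1)] moves
    for any other reason, then level [i] takes new followers, so a follower is only ever associated with one
    string. *)

(** * Computability of functions between encoded types *)

Arguments to_nat : simpl never.
Arguments of_nat : simpl never.

(** Parities alternate so that the action of a level, which serves one real, damages only the string
    just below it, which belongs to the other real. To be covered by the test, to extend an error
    string and to output zero are all recognised at a finite stage and never withdrawn. Hence
    classes shrink as the stages go on, they can be measured by counting strings of one length, and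
    a realised follower stays realised while the lower levels do not change. The threshold is a
    half: if the class has measure at least [2^-w], then either the part that avoids output zero has
    measure at least [2^-(w+1)], or the other part has. The test and the error strings take at most
    [1/4] each, which leaves the initial [1/2]. A follower names the number [k] whose entry into [D]
    lets it in, so both sets are computable from [D]. Finally [Y_b] is random and computes [A_b] but
    not [A_(1-b)], so [Y_1] refutes one reduction and [Y_0] the other. *)

Class Enc (T : Type) := { enc : T -> nat; enc_inj : forall x y, enc x = enc y -> x = y }.

#[export] Instance Enc_nat : Enc nat := {| enc := fun n => n; enc_inj := fun x y h => h |}.

#[export] Instance Enc_bool : Enc bool.
Proof. exists b2n. now intros [] []. Defined.

Definition enc_prod {A B} (EA : Enc A) (EB : Enc B) (p : A * B) : nat :=
  to_nat (enc (fst p), enc (snd p)).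

#[export] Instance Enc_prod {A B} (EA : Enc A) (EB : Enc B) : Enc (A * B).
Proof.
  exists (enc_prod EA EB).
  intros [a b] [a' b'] H. unfold enc_prod in H. apply to_nat_inj in H. injection H as H1 H2.
  apply enc_inj in H1, H2. now subst.
Defined.

Fixpoint enc_list {A} (EA : Enc A) (l : list A) : nat :=
  match l with [] => 0 | a :: l' => S (to_nat (enc a, enc_list EA l')) end.

#[export] Instance Enc_list {A} (EA : Enc A) : Enc (list A).
Proof.
  exists (enc_list EA).
  induction x as [|a l IH]; intros [|b l']; cbn [enc_list]; try discriminate; auto.
  intros H. apply Nat.succ_inj, to_nat_inj in H. injection H as H1 H2.
  apply enc_inj in H1. apply IH in H2. now subst.
Defined.

Lemma enc_pair {A B} {EA : Enc A} {EB : Enc B} (a : A) (b : B) :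
  enc (a, b) = to_nat (enc a, enc b).
Proof. reflexivity. Qed.

Lemma enc_cons {A} {EA : Enc A} (a : A) l : enc (a :: l) = S (to_nat (enc a, enc l)).
Proof. reflexivity. Qed.

Lemma le_to_nat a b : a <= to_nat (a, b) /\ b <= to_nat (a, b).
Proof. pose proof (to_nat_non_decreasing a b). lia. Qed.

Lemma length_le_enc {A} {EA : Enc A} (l : list A) : length l <= enc l.
Proof.
  induction l as [|a l IH]; [apply le_0_n|]. rewrite enc_cons.
  pose proof (le_to_nat (enc a) (enc l)). cbn [length]. lia.
Qed.

Definition eqE {A} {EA : Enc A} (x y : A) : bool := enc x =? enc y.

Lemma eqE_spec {A} {EA : Enc A} (x y : A) : eqE x y = true <-> x = y.
Proof.
  unfold eqE. rewrite Nat.eqb_eq. split; [apply enc_inj | now intros ->].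
Qed.

Lemma eqE_refl {A} {EA : Enc A} (x : A) : eqE x x = true.
Proof. apply Nat.eqb_refl. Qed.

Lemma eqE_eq {A} {EA : Enc A} (x y : A) : eqE x y = true -> x = y.
Proof. apply eqE_spec. Qed.

Section Untyped.
Variable X : nat -> bool.

Definition cfl (n : nat) (F : list nat -> nat) : Prop :=
  exists e, forall xs, length xs = n -> eval X e xs (F xs).

Lemma cfl_ext n F G : (forall xs, length xs = n -> F xs = G xs) -> cfl n F -> cfl n G.
Proof. intros H [e He]. exists e. intros xs L. rewrite <- H by auto. auto. Qed.

Lemma cfl_proj n i : cfl n (fun xs => nth i xs 0).
Proof. exists (RProj i). constructor. Qed.

Lemma cfl_zero n : cfl n (fun _ => 0).
Proof. exists RZero. constructor. Qed.

Lemma cfl_comp1 n F G : cfl 1 F -> cfl n G -> cfl n (fun xs => F [G xs]).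
Proof.
  intros [e He] [g Hg]. exists (RComp e [g]). intros xs L.
  econstructor; [|apply He; reflexivity]. repeat constructor; auto.
Qed.

Lemma cfl_comp2 n F G H : cfl 2 F -> cfl n G -> cfl n H -> cfl n (fun xs => F [G xs; H xs]).
Proof.
  intros [e He] [g Hg] [h Hh]. exists (RComp e [g; h]). intros xs L.
  econstructor; [|apply He; reflexivity]. repeat constructor; auto.
Qed.

Lemma cfl_comp3 n F G H K : cfl 3 F -> cfl n G -> cfl n H -> cfl n K ->
  cfl n (fun xs => F [G xs; H xs; K xs]).
Proof.
  intros [e He] [g Hg] [h Hh] [k Hk]. exists (RComp e [g; h; k]). intros xs L.
  econstructor; [|apply He; reflexivity]. repeat constructor; auto.
Qed.

Lemma cfl_succ n G : cfl n G -> cfl n (fun xs => S (G xs)).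
Proof.
  intros H. apply (cfl_comp1 n (fun xs => S (hd 0 xs)) G); auto.
  exists RSucc. intros. constructor.
Qed.

Lemma cfl_const n c : cfl n (fun _ => c).
Proof. induction c; [apply cfl_zero|]. now apply cfl_succ. Qed.

Lemma cfl_rec n F H : cfl n F -> cfl (S (S n)) H ->
  cfl (S n) (fun xs => nat_rect (fun _ => nat) (F (tl xs)) (fun m r => H (m :: r :: tl xs)) (hd 0 xs)).
Proof.
  intros [f Hf] [h Hh]. exists (RPrec f h). intros [|m xs] L; [discriminate|]. cbn [hd tl].
  injection L as L. induction m as [|m IH]; cbn [nat_rect].
  - constructor; auto.
  - econstructor; [exact IH|]. apply Hh. cbn. lia.
Qed.

Lemma cfl_add : cfl 2 (fun xs => nth 0 xs 0 + nth 1 xs 0).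
Proof.
  eapply cfl_ext; [|apply (cfl_rec 1 (fun xs => nth 0 xs 0) (fun xs => S (nth 1 xs 0)));
    [apply cfl_proj | apply cfl_succ, cfl_proj]].
  intros [|m [|n [|]]] L; try discriminate. cbn. induction m; cbn; auto.
Qed.

Lemma cfl_plus n F G : cfl n F -> cfl n G -> cfl n (fun xs => F xs + G xs).
Proof. intros. apply (cfl_comp2 n _ F G cfl_add); auto. Qed.

Lemma cfl_pred : cfl 1 (fun xs => pred (nth 0 xs 0)).
Proof.
  eapply cfl_ext; [|apply (cfl_rec 0 (fun xs => 0) (fun xs => nth 0 xs 0));
    [apply cfl_zero | apply cfl_proj]].
  intros [|m [|]] L; try discriminate. cbn. now destruct m.
Qed.

Lemma cfl_predF n F : cfl n F -> cfl n (fun xs => pred (F xs)).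
Proof. apply (cfl_comp1 n _ F cfl_pred). Qed.

Lemma cfl_sub0 : cfl 2 (fun xs => nth 1 xs 0 - nth 0 xs 0).
Proof.
  eapply cfl_ext; [|apply (cfl_rec 1 (fun xs => nth 0 xs 0) (fun xs => pred (nth 1 xs 0)));
    [apply cfl_proj | apply (cfl_comp1 _ _ _ cfl_pred), cfl_proj]].
  intros [|m [|n [|]]] L; try discriminate. cbn [nth tl hd]. clear L.
  induction m; cbn [nat_rect]; [lia|]. rewrite IHm. lia.
Qed.

Lemma cfl_sub n F G : cfl n F -> cfl n G -> cfl n (fun xs => F xs - G xs).
Proof. intros. apply (cfl_comp2 n _ G F cfl_sub0); auto. Qed.

Lemma cfl_mul0 : cfl 2 (fun xs => nth 0 xs 0 * nth 1 xs 0).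
Proof.
  eapply cfl_ext; [|apply (cfl_rec 1 (fun xs => 0) (fun xs => nth 2 xs 0 + nth 1 xs 0));
    [apply cfl_zero | apply cfl_plus; apply cfl_proj]].
  intros [|m [|n [|]]] L; try discriminate. cbn [nth tl hd]. clear L.
  induction m; cbn [nat_rect]; [lia|]. rewrite IHm. lia.
Qed.

Lemma cfl_mul n F G : cfl n F -> cfl n G -> cfl n (fun xs => F xs * G xs).
Proof. intros. apply (cfl_comp2 n _ F G cfl_mul0); auto. Qed.

Lemma cfl_if0 : cfl 3 (fun xs => if nth 0 xs 0 =? 0 then nth 1 xs 0 else nth 2 xs 0).
Proof.
  eapply cfl_ext; [|apply (cfl_rec 2 (fun xs => nth 0 xs 0) (fun xs => nth 3 xs 0));
    apply cfl_proj].
  intros [|m [|n [|k [|]]]] L; try discriminate. cbn. now destruct m.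
Qed.

Lemma cfl_if n C F G : cfl n C -> cfl n F -> cfl n G ->
  cfl n (fun xs => if C xs =? 0 then F xs else G xs).
Proof. intros. apply (cfl_comp3 n _ C F G cfl_if0); auto. Qed.

(** The recursion inside the Cantor pairing, in the same form, so that [to_nat (a, b)] is
    convertible with [b + tri (b + a)]. *)
Definition tri (n : nat) : nat := nat_rec _ 0 (fun i m => S i + m) n.

Lemma cfl_tri n F : cfl n F -> cfl n (fun xs => tri (F xs)).
Proof.
  intros HF. apply (cfl_comp1 n (fun xs => tri (nth 0 xs 0)) F); auto.
  eapply cfl_ext; [|apply (cfl_rec 0 (fun xs => 0) (fun xs => S (nth 0 xs 0) + nth 1 xs 0));
    [apply cfl_zero | apply cfl_plus; [apply cfl_succ|]; apply cfl_proj]].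
  intros [|m [|]] L; try discriminate. reflexivity.
Qed.

(** The diagonal of the Cantor pairing on which [n] lies, that is, the largest [w] with
    [tri w <= n]. It grows by at most one from [n] to [n + 1], so primitive recursion finds it; both
    projections are differences built from it. *)
Definition cdiag (n : nat) : nat :=
  nat_rect (fun _ => nat) 0 (fun m r => if tri (S r) - S m =? 0 then S r else r) n.

Lemma tri_mono a b : a <= b -> tri a <= tri b.
Proof. induction 1; auto. change (tri (S m)) with (S m + tri m). lia. Qed.

Lemma cdiag_spec n : tri (cdiag n) <= n < tri (S (cdiag n)).
Proof.
  induction n; [cbn; lia|]. cbn [cdiag nat_rect]. fold (cdiag n).
  destruct (Nat.eqb_spec (tri (S (cdiag n)) - S n) 0); [|lia].
  split; [lia|].
  change (tri (S (S (cdiag n)))) with (S (S (cdiag n)) + tri (S (cdiag n))). lia.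
Qed.

Lemma cfl_cdiag n F : cfl n F -> cfl n (fun xs => cdiag (F xs)).
Proof.
  intros HF. apply (cfl_comp1 n (fun xs => cdiag (nth 0 xs 0)) F); auto.
  eapply cfl_ext; [|apply (cfl_rec 0 (fun xs => 0)
     (fun xs => if tri (S (nth 1 xs 0)) - S (nth 0 xs 0) =? 0 then S (nth 1 xs 0) else nth 1 xs 0));
    [apply cfl_zero |]].
  - intros [|m [|]] L; try discriminate. reflexivity.
  - apply cfl_if; [apply cfl_sub; [apply cfl_tri|]| |]; try apply cfl_succ; apply cfl_proj.
Qed.

Lemma cdiag_to_nat a b : cdiag (to_nat (a, b)) = b + a.
Proof.
  pose proof (cdiag_spec (to_nat (a, b))) as H.
  change (to_nat (a, b)) with (b + tri (b + a)) in *.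
  set (w := cdiag _) in *.
  destruct (lt_eq_lt_dec w (b + a)) as [[L|L]|L]; auto; exfalso.
  - assert (tri (S w) <= tri (b + a)) by (apply tri_mono; lia). lia.
  - assert (tri (S (b + a)) <= tri w) by (apply tri_mono; lia).
    change (tri (S (b + a))) with (S (b + a) + tri (b + a)) in *. lia.
Qed.

Lemma cfl_to_nat n F G : cfl n F -> cfl n G -> cfl n (fun xs => to_nat (F xs, G xs)).
Proof.
  intros. change (cfl n (fun xs => G xs + tri (G xs + F xs))).
  apply cfl_plus; auto. apply cfl_tri, cfl_plus; auto.
Qed.

Lemma cfl_snd n F : cfl n F -> cfl n (fun xs => snd (of_nat (F xs))).
Proof.
  intros. eapply cfl_ext; [|apply (cfl_sub n F (fun xs => tri (cdiag (F xs)))); auto;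
    apply cfl_tri, cfl_cdiag; auto].
  intros xs _. cbn beta. rewrite <- (cancel_to_of (F xs)) at 1 2. destruct (of_nat (F xs)) as [a b].
  rewrite cdiag_to_nat. change (to_nat (a, b)) with (b + tri (b + a)). cbn [snd]. lia.
Qed.

Lemma cfl_fst n F : cfl n F -> cfl n (fun xs => fst (of_nat (F xs))).
Proof.
  intros. eapply cfl_ext; [|apply (cfl_sub n (fun xs => cdiag (F xs)) (fun xs => snd (of_nat (F xs))));
    [apply cfl_cdiag | apply cfl_snd]; auto].
  intros xs _. cbn beta. rewrite <- (cancel_to_of (F xs)) at 1. destruct (of_nat (F xs)) as [a b].
  rewrite cdiag_to_nat. cbn [fst snd]. lia.
Qed.

End Untyped.

(** Everything is passed as one encoded argument. For [T = nat] and [U = bool] the statement is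
    convertible with [turing_le f X], which is how it is used in the end. *)
Definition CF (X : nat -> bool) {T U} {ET : Enc T} {EU : Enc U} (f : T -> U) : Prop :=
  exists e, forall x, eval X e [enc x] (enc (f x)).

Section Typed.
Variable X : nat -> bool.
Notation CF := (CF X).

Lemma CF_of_cfl {T U} {ET : Enc T} {EU : Enc U} (f : T -> U) F :
  cfl X 1 F -> (forall x, F [enc x] = enc (f x)) -> CF f.
Proof. intros [e He] H. exists e. intros x. rewrite <- H. now apply He. Qed.

Lemma CF_comp {T U V} {ET : Enc T} {EU : Enc U} {EV : Enc V} (f : U -> V) (g : T -> U) :
  CF f -> CF g -> CF (fun x => f (g x)).
Proof.
  intros [e He] [d Hd]. exists (RComp e [d]). intros x.
  econstructor; [|apply He]. repeat constructor; auto.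
Qed.

Lemma CF_id {T} {ET : Enc T} : CF (fun x : T => x).
Proof. exists (RProj 0). intros. constructor. Qed.

Lemma CF_const {T U} {ET : Enc T} {EU : Enc U} (c : U) : CF (fun _ : T => c).
Proof. apply (CF_of_cfl _ (fun _ => enc c)); auto. apply cfl_const. Qed.

Lemma CF_pair {T A B} {ET : Enc T} {EA : Enc A} {EB : Enc B} (f : T -> A) (g : T -> B) :
  CF f -> CF g -> CF (fun x => (f x, g x)).
Proof.
  intros [a Ha] [b Hb].
  destruct (cfl_to_nat X 2 _ _ (cfl_proj X 2 0) (cfl_proj X 2 1)) as [e He].
  exists (RComp e [a; b]). intros x. econstructor; [repeat constructor; auto|].
  exact (He [enc (f x); enc (g x)] eq_refl).
Qed.

Lemma CF_fst {T A B} {ET : Enc T} {EA : Enc A} {EB : Enc B} (f : T -> A * B) :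
  CF f -> CF (fun x => fst (f x)).
Proof.
  apply (CF_comp fst). eapply CF_of_cfl; [apply cfl_fst, (cfl_proj X 1 0)|].
  intros [a b]. cbn [nth]. now rewrite enc_pair, cancel_of_to.
Qed.

Lemma CF_snd {T A B} {ET : Enc T} {EA : Enc A} {EB : Enc B} (f : T -> A * B) :
  CF f -> CF (fun x => snd (f x)).
Proof.
  apply (CF_comp snd). eapply CF_of_cfl; [apply cfl_snd, (cfl_proj X 1 0)|].
  intros [a b]. cbn [nth]. now rewrite enc_pair, cancel_of_to.
Qed.

Lemma CF_op2 (op : nat -> nat -> nat) :
  cfl X 2 (fun xs => op (nth 0 xs 0) (nth 1 xs 0)) ->
  forall {T} {ET : Enc T} (f g : T -> nat), CF f -> CF g -> CF (fun x => op (f x) (g x)).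
Proof.
  intros [e He] T ET f g [a Ha] [b Hb].
  exists (RComp e [a; b]). intros x. econstructor; [repeat constructor; auto|].
  exact (He [enc (f x); enc (g x)] eq_refl).
Qed.

Section Ctx.
Context {T : Type} {ET : Enc T}.

Lemma CF_S (f : T -> nat) : CF f -> CF (fun x => S (f x)).
Proof.
  apply (CF_comp S). eapply CF_of_cfl; [apply cfl_succ, (cfl_proj X 1 0)|]. reflexivity.
Qed.

Lemma CF_pred (f : T -> nat) : CF f -> CF (fun x => pred (f x)).
Proof. apply (CF_comp pred). eapply CF_of_cfl; [apply cfl_pred|]. reflexivity. Qed.

Lemma CF_add (f g : T -> nat) : CF f -> CF g -> CF (fun x => f x + g x).
Proof. apply CF_op2, cfl_plus; apply cfl_proj. Qed.

Lemma CF_sub (f g : T -> nat) : CF f -> CF g -> CF (fun x => f x - g x).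
Proof. apply (CF_op2 Nat.sub), cfl_sub; apply cfl_proj. Qed.

Lemma CF_mul (f g : T -> nat) : CF f -> CF g -> CF (fun x => f x * g x).
Proof. apply (CF_op2 Nat.mul), cfl_mul; apply cfl_proj. Qed.

Lemma CF_to_nat (f g : T -> nat) : CF f -> CF g -> CF (fun x => to_nat (f x, g x)).
Proof. apply (CF_op2 (fun a b => to_nat (a, b))), cfl_to_nat; apply cfl_proj. Qed.

Lemma CF_of_nat (f : T -> nat) : CF f -> CF (fun x => of_nat (f x)).
Proof.
  apply (CF_comp of_nat). exists (RProj 0). intros x.
  replace (enc (of_nat x)) with x; [constructor|].
  rewrite <- (cancel_to_of x) at 1. now destruct (of_nat x).
Qed.

Lemma CF_enc {U} {EU : Enc U} (f : T -> U) : CF f -> CF (fun x => enc (f x)).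
Proof. intros H. exact H. Qed.

Lemma CF_if {U} {EU : Enc U} (b : T -> bool) (f g : T -> U) :
  CF b -> CF f -> CF g -> CF (fun x => if b x then f x else g x).
Proof.
  intros [c Hc] [a Ha] [d Hd]. destruct (cfl_if0 X) as [e He].
  exists (RComp e [c; d; a]). intros x. econstructor; [repeat constructor; auto|].
  pose proof (He [enc (b x); enc (g x); enc (f x)] eq_refl) as H. cbn [nth] in H.
  now destruct (b x).
Qed.

Lemma CF_eqn (f g : T -> nat) : CF f -> CF g -> CF (fun x => f x =? g x).
Proof.
  intros Hf Hg.
  assert (H : CF (fun x => if (f x - g x) + (g x - f x) =? 0 then 1 else 0)).
  { destruct (CF_add _ _ (CF_sub _ _ Hf Hg) (CF_sub _ _ Hg Hf)) as [e He].
    destruct (cfl_if X 1 _ _ _ (cfl_proj X 1 0) (cfl_const X 1 1) (cfl_const X 1 0)) as [d Hd].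
    exists (RComp d [e]). intros x. econstructor; [repeat constructor; auto|].
    exact (Hd [_] eq_refl). }
  destruct H as [e He]. exists e. intros x. specialize (He x).
  replace (enc (f x =? g x)) with (enc (if (f x - g x) + (g x - f x) =? 0 then 1 else 0)); auto.
  destruct (Nat.eqb_spec (f x) (g x)), (Nat.eqb_spec ((f x - g x) + (g x - f x)) 0); cbn; lia.
Qed.

Lemma CF_eqE {U} {EU : Enc U} (f g : T -> U) : CF f -> CF g -> CF (fun x => eqE (f x) (g x)).
Proof. intros. unfold eqE. apply CF_eqn; now apply CF_enc. Qed.

Lemma CF_ext {U} {EU : Enc U} (f g : T -> U) : (forall x, f x = g x) -> CF f -> CF g.
Proof. intros H [e He]. exists e. intros x. now rewrite <- H. Qed.

Lemma CF_leb (f g : T -> nat) : CF f -> CF g -> CF (fun x => f x <=? g x).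
Proof.
  intros. apply (CF_ext (fun x => (f x - g x) =? 0)).
  - intros x. destruct (Nat.eqb_spec (f x - g x) 0), (Nat.leb_spec (f x) (g x)); lia.
  - apply CF_eqn; [now apply CF_sub | apply CF_const].
Qed.

Lemma CF_ltb (f g : T -> nat) : CF f -> CF g -> CF (fun x => f x <? g x).
Proof. intros. apply (CF_leb (fun x => S (f x))); auto. now apply CF_S. Qed.

Lemma CF_negb (f : T -> bool) : CF f -> CF (fun x => negb (f x)).
Proof. intros. apply CF_if; auto using CF_const. Qed.

Lemma CF_andb (f g : T -> bool) : CF f -> CF g -> CF (fun x => f x && g x)%bool.
Proof. intros. apply CF_if; auto using CF_const. Qed.

Lemma CF_orb (f g : T -> bool) : CF f -> CF g -> CF (fun x => f x || g x)%bool.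
Proof. intros. apply CF_if; auto using CF_const. Qed.

Lemma CF_b2n (f : T -> bool) : CF f -> CF (fun x => b2n (f x)).
Proof. intros H. exact H. Qed.

End Ctx.

Lemma CF_rec {T U} {ET : Enc T} {EU : Enc U} (n : T -> nat) (g : T -> U) (h : T -> nat -> U -> U) :
  CF n -> CF g -> CF (fun p : T * (nat * U) => h (fst p) (fst (snd p)) (snd (snd p))) ->
  CF (fun x => nat_rect (fun _ => U) (g x) (h x) (n x)).
Proof.
  intros [en Hn] [eg Hg] [eh Hh].
  destruct (cfl_to_nat X 3 _ _ (cfl_proj X 3 2) (cfl_to_nat X 3 _ _ (cfl_proj X 3 0) (cfl_proj X 3 1)))
    as [ep Hp].
  exists (RComp (RPrec eg (RComp eh [ep])) [en; RProj 0]). intros x.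
  econstructor; [constructor; [apply Hn|constructor; [constructor|constructor]]|].
  cbn [nth]. change (enc (n x)) with (n x).
  induction (n x) as [|m IH]; cbn [nat_rect].
  - constructor. apply Hg.
  - econstructor; [exact IH|]. set (r := nat_rect _ _ _ _).
    econstructor; [constructor; [|constructor]; apply Hp; reflexivity|].
    exact (Hh (x, (m, r))).
Qed.

End Typed.

Section Lists.
Variable X : nat -> bool.
Notation CF := (CF X).

Lemma CF_tl {T A} {ET : Enc T} {EA : Enc A} (l : T -> list A) : CF l -> CF (fun x => tl (l x)).
Proof.
  apply (CF_comp X (@tl A)).
  eapply CF_of_cfl; [apply cfl_snd, (cfl_predF X 1 _ (cfl_proj X 1 0))|].
  intros [|a m]; cbn [nth]; [reflexivity|]. rewrite enc_cons. cbn [pred].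
  now rewrite cancel_of_to.
Qed.

Lemma CF_hd {T A} {ET : Enc T} {EA : Enc A} (d : A) (l : T -> list A) :
  CF l -> CF (fun x => hd d (l x)).
Proof.
  apply (CF_comp X (hd d)).
  eapply CF_of_cfl; [apply cfl_if; [apply (cfl_proj X 1 0) | apply (cfl_const X 1 (enc d)) |
     apply cfl_fst, cfl_predF, (cfl_proj X 1 0)]|].
  intros [|a m]; cbn [nth]; [reflexivity|]. rewrite enc_cons. cbn [pred Nat.eqb hd].
  now rewrite cancel_of_to.
Qed.

Lemma CF_cons {T A} {ET : Enc T} {EA : Enc A} (a : T -> A) (l : T -> list A) :
  CF a -> CF l -> CF (fun x => a x :: l x).
Proof.
  intros Ha Hl. exact (CF_S X _ (CF_to_nat X _ _ (CF_enc X _ Ha) (CF_enc X _ Hl))).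
Qed.

(** Primitive recursion on the pair of remaining list and accumulator, for [enc l] rounds: the code
    bounds the length, and rounds on an empty list change nothing. [hd] needs a default element,
    whence the separate case of an empty type [A]. *)
Lemma CF_foldl {T A U} {ET : Enc T} {EA : Enc A} {EU : Enc U}
  (l : T -> list A) (g : T -> U) (h : T -> U -> A -> U) :
  CF l -> CF g -> CF (fun p : T * (U * A) => h (fst p) (fst (snd p)) (snd (snd p))) ->
  CF (fun x => fold_left (h x) (l x) (g x)).
Proof.
  intros Hl Hg Hh. destruct (classic (inhabited A)) as [[d]|N].
  - apply (CF_ext X (fun x => snd (nat_rect (fun _ => (list A * U)%type) (l x, g x)
      (fun _ s => (tl (fst s), if eqE (fst s) [] then snd s else h x (snd s) (hd d (fst s))))
      (enc (l x))))).
    + intros x. set (step := fun (_ : nat) (s : list A * U) => _).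
      assert (E : forall n m (r : U), length m <= n ->
        snd (nat_rect (fun _ => (list A * U)%type) (m, r) step n) = fold_left (h x) m r).
      (* [nat_rect] applies its last step outermost, whereas the list is consumed from the innermost
         one. A step can be moved across because [step] ignores its counter. *)
      { assert (C : forall n s, nat_rect (fun _ => (list A * U)%type) (step 0 s) step n
                     = step 0 (nat_rect (fun _ => (list A * U)%type) s step n)).
        { induction n; intros s; cbn [nat_rect]; [reflexivity|]. rewrite IHn. reflexivity. }
        induction n; intros m r L.
        - destruct m; [reflexivity|cbn in L; lia].
        - cbn [nat_rect]. change (step n) with (step 0). rewrite <- C.
          unfold step at 1. cbn [fst snd]. destruct m as [|a m].
          + cbn [tl eqE enc Nat.eqb]. rewrite IHn by apply le_0_n. reflexivity.
          + cbn [tl hd fold_left].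
            destruct (eqE (a :: m) []) eqn:Q; [apply eqE_eq in Q; discriminate|].
            apply IHn. cbn in L. lia. }
      apply E, length_le_enc.
    + refine (CF_snd X _ _). apply CF_rec; [now apply CF_enc | now apply CF_pair |].
      apply CF_pair; [refine (CF_tl _ (CF_fst X _ (CF_snd X _ (CF_snd X _ (CF_id X)))))|].
      apply CF_if.
      * refine (CF_eqE X _ _ _ _); [|apply CF_const].
        refine (CF_fst X _ (CF_snd X _ (CF_snd X _ (CF_id X)))).
      * refine (CF_snd X _ (CF_snd X _ (CF_snd X _ (CF_id X)))).
      * apply (CF_comp X (fun p : T * (U * A) => h (fst p) (fst (snd p)) (snd (snd p)))
           (fun p : T * (nat * (list A * U)) => (fst p, (snd (snd (snd p)), hd d (fst (snd (snd p))))))).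
        { exact Hh. }
        apply CF_pair; [refine (CF_fst X _ (CF_id X))|].
        apply CF_pair; [refine (CF_snd X _ (CF_snd X _ (CF_snd X _ (CF_id X))))|].
        apply CF_hd. refine (CF_fst X _ (CF_snd X _ (CF_snd X _ (CF_id X)))).
  - apply (CF_ext X g); auto. intros x. destruct (l x) as [|a m]; auto. destruct N. now exists.
Qed.

Lemma CF_rev {T A} {ET : Enc T} {EA : Enc A} (l : T -> list A) : CF l -> CF (fun x => rev (l x)).
Proof.
  intros H. apply (CF_ext X (fun x => fold_left (fun r a => a :: r) (l x) [])).
  - intros x. rewrite <- fold_left_rev_right. induction (rev (l x)); cbn; [|f_equal]; auto.
  - apply (CF_foldl l (fun _ => []) (fun _ r a => a :: r)); auto using CF_const.
    apply CF_cons; [refine (CF_snd X _ (CF_snd X _ (CF_id X))) | refine (CF_fst X _ (CF_snd X _ (CF_id X)))].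
Qed.

Lemma CF_foldr {T A U} {ET : Enc T} {EA : Enc A} {EU : Enc U}
  (l : T -> list A) (g : T -> U) (h : T -> A -> U -> U) :
  CF l -> CF g -> CF (fun p : T * (A * U) => h (fst p) (fst (snd p)) (snd (snd p))) ->
  CF (fun x => fold_right (h x) (g x) (l x)).
Proof.
  intros Hl Hg Hh.
  apply (CF_ext X (fun x => fold_left (fun r a => h x a r) (rev (l x)) (g x))).
  - intros x. now rewrite <- fold_left_rev_right, rev_involutive.
  - apply (CF_foldl (fun x => rev (l x)) g (fun x r a => h x a r)); auto using CF_rev.
    apply (CF_comp X (fun p : T * (A * U) => h (fst p) (fst (snd p)) (snd (snd p)))
             (fun p : T * (U * A) => (fst p, (snd (snd p), fst (snd p))))); auto.
    apply CF_pair; [refine (CF_fst X _ (CF_id X))|apply CF_pair].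
    + refine (CF_snd X _ (CF_snd X _ (CF_id X))).
    + refine (CF_fst X _ (CF_snd X _ (CF_id X))).
Qed.
End Lists.

(** A hook for [cf_step], rebound below whenever further functions are known to be computable. *)
Ltac cf_user := fail.
Ltac cf_step :=
  cbv beta;
  lazymatch goal with
  | |- CF _ (fun x => x) => apply CF_id
  | |- CF _ (fun _ => ?c) => apply CF_const
  | |- CF _ fst => refine (CF_fst _ _ (CF_id _))
  | |- CF _ snd => refine (CF_snd _ _ (CF_id _))
  | |- CF _ (fun x => fst _) => refine (CF_fst _ _ _)
  | |- CF _ (fun x => snd _) => refine (CF_snd _ _ _)
  | |- CF _ (fun x => (_, _)) => refine (CF_pair _ _ _ _ _)
  | |- CF _ (fun x => S _) => refine (CF_S _ _ _)
  | |- CF _ (fun x => pred _) => refine (CF_pred _ _ _)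
  | |- CF _ (fun x => _ + _) => refine (CF_add _ _ _ _ _)
  | |- CF _ (fun x => _ - _) => refine (CF_sub _ _ _ _ _)
  | |- CF _ (fun x => _ * _) => refine (CF_mul _ _ _ _ _)
  | |- CF _ (fun x => to_nat (_, _)) => refine (CF_to_nat _ _ _ _ _)
  | |- CF _ (fun x => of_nat _) => refine (CF_of_nat _ _ _)
  | |- CF _ (fun x => if _ then _ else _) => refine (CF_if _ _ _ _ _ _ _)
  | |- CF _ (fun x => _ =? _) => refine (CF_eqn _ _ _ _ _)
  | |- CF _ (fun x => _ <=? _) => refine (CF_leb _ _ _ _ _)
  | |- CF _ (fun x => _ <? _) => refine (CF_ltb _ _ _ _ _)
  | |- CF _ (fun x => eqE _ _) => refine (CF_eqE _ _ _ _ _)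
  | |- CF _ (fun x => negb _) => refine (CF_negb _ _ _)
  | |- CF _ (fun x => andb _ _) => refine (CF_andb _ _ _ _ _)
  | |- CF _ (fun x => orb _ _) => refine (CF_orb _ _ _ _ _)
  | |- CF _ (fun x => b2n _) => refine (CF_b2n _ _ _)
  | |- CF _ (fun x => nat_rect _ _ _ _) => refine (CF_rec _ _ _ _ _ _ _)
  | |- CF _ (fun x => tl _) => refine (CF_tl _ _ _)
  | |- CF _ (fun x => hd _ _) => refine (CF_hd _ _ _ _)
  | |- CF _ (fun x => _ :: _) => refine (CF_cons _ _ _ _ _)
  | |- CF _ (fun x => rev _) => refine (CF_rev _ _ _)
  | |- CF _ (fun x => fold_right _ _ _) => refine (CF_foldr _ _ _ _ _ _ _)
  | |- _ => cf_user
  end.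
Ltac cf := repeat first [assumption | cf_step].

Section Lists2.
Variable X : nat -> bool.
Notation CF := (CF X).
Context {T : Type} {ET : Enc T}.

Lemma CF_app {A} {EA : Enc A} (l m : T -> list A) : CF l -> CF m -> CF (fun x => l x ++ m x).
Proof.
  intros. apply (CF_ext X (fun x => fold_right (fun a r => a :: r) (m x) (l x))).
  - intros x. now induction (l x); cbn; f_equal.
  - cf.
Qed.

Lemma CF_length {A} {EA : Enc A} (l : T -> list A) : CF l -> CF (fun x => length (l x)).
Proof.
  intros. apply (CF_ext X (fun x => fold_right (fun _ r => S r) 0 (l x))).
  - intros x. now induction (l x); cbn; f_equal.
  - cf.
Qed.

Lemma CF_map {A B} {EA : Enc A} {EB : Enc B} (l : T -> list A) (f : T -> A -> B) :
  CF l -> CF (fun p : T * A => f (fst p) (snd p)) -> CF (fun x => map (f x) (l x)).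
Proof.
  intros Hl Hf. apply (CF_ext X (fun x => fold_right (fun a r => f x a :: r) [] (l x))).
  - intros x. now induction (l x); cbn; f_equal.
  - cf. apply (CF_comp X (fun p : T * A => f (fst p) (snd p))
       (fun p : T * (A * list B) => (fst p, fst (snd p)))); auto. cf.
Qed.

Lemma CF_filter {A} {EA : Enc A} (l : T -> list A) (f : T -> A -> bool) :
  CF l -> CF (fun p : T * A => f (fst p) (snd p)) -> CF (fun x => filter (f x) (l x)).
Proof.
  intros Hl Hf. apply (CF_ext X (fun x => fold_right (fun a r => if f x a then a :: r else r) [] (l x))).
  - intros x. induction (l x) as [|a m IH]; cbn; [|rewrite IH]; reflexivity.
  - cf. apply (CF_comp X (fun p : T * A => f (fst p) (snd p))
       (fun p : T * (A * list A) => (fst p, fst (snd p)))); auto. cf.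
Qed.

Lemma CF_existsb {A} {EA : Enc A} (l : T -> list A) (f : T -> A -> bool) :
  CF l -> CF (fun p : T * A => f (fst p) (snd p)) -> CF (fun x => existsb (f x) (l x)).
Proof.
  intros Hl Hf. apply (CF_ext X (fun x => fold_right (fun a r => orb (f x a) r) false (l x))).
  - intros x. induction (l x) as [|a m IH]; cbn; [|rewrite IH]; reflexivity.
  - cf. apply (CF_comp X (fun p : T * A => f (fst p) (snd p))
       (fun p : T * (A * bool) => (fst p, fst (snd p)))); auto. cf.
Qed.

Lemma CF_forallb {A} {EA : Enc A} (l : T -> list A) (f : T -> A -> bool) :
  CF l -> CF (fun p : T * A => f (fst p) (snd p)) -> CF (fun x => forallb (f x) (l x)).
Proof.
  intros Hl Hf. apply (CF_ext X (fun x => fold_right (fun a r => andb (f x a) r) true (l x))).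
  - intros x. induction (l x) as [|a m IH]; cbn; [|rewrite IH]; reflexivity.
  - cf. apply (CF_comp X (fun p : T * A => f (fst p) (snd p))
       (fun p : T * (A * bool) => (fst p, fst (snd p)))); auto. cf.
Qed.

Lemma CF_skipn {A} {EA : Enc A} (n : T -> nat) (l : T -> list A) :
  CF n -> CF l -> CF (fun x => skipn (n x) (l x)).
Proof.
  intros. apply (CF_ext X (fun x => nat_rect (fun _ => list A) (l x) (fun _ r => tl r) (n x))).
  - intros x. generalize (l x). induction (n x) as [|m IH]; intros k; [reflexivity|].
    cbn [nat_rect]. rewrite IH. clear. revert k. induction m; intros [|a k]; auto.
    exact (IHm k).
  - cf.
Qed.

Lemma CF_firstn {A} {EA : Enc A} (n : T -> nat) (l : T -> list A) :
  CF n -> CF l -> CF (fun x => firstn (n x) (l x)).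
Proof.
  intros. apply (CF_ext X (fun x => rev (skipn (length (l x) - n x) (rev (l x))))).
  - intros x. pose proof (firstn_rev (n x) (rev (l x))) as E.
    now rewrite rev_involutive, length_rev in E.
  - refine (CF_rev _ _ _). apply CF_skipn; cf. now apply CF_length.
Qed.

Lemma CF_nth {A} {EA : Enc A} (n : T -> nat) (l : T -> list A) (d : A) :
  CF n -> CF l -> CF (fun x => nth (n x) (l x) d).
Proof.
  intros. apply (CF_ext X (fun x => hd d (skipn (n x) (l x)))).
  - intros x. revert n H. generalize (l x). intros k n _. revert k.
    induction (n x); intros [|a k]; cbn; auto.
  - cf. now apply CF_skipn.
Qed.

Lemma CF_pow (n : T -> nat) : CF n -> CF (fun x => 2 ^ n x).
Proof.
  intros. apply (CF_ext X (fun x => nat_rect (fun _ => nat) 1 (fun m r => 2 * r) (n x))); [|cf].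
  intros x. induction (n x); [reflexivity|]. cbn [nat_rect Nat.pow]. now rewrite IHn0.
Qed.

Lemma CF_even (n : T -> nat) : CF n -> CF (fun x => Nat.even (n x)).
Proof.
  intros. apply (CF_ext X (fun x => nat_rect (fun _ => bool) true (fun m r => negb r) (n x))); [|cf].
  intros x. induction (n x); [reflexivity|]. cbn [nat_rect]. now rewrite IHn0, Nat.even_succ, <- Nat.negb_even.
Qed.

Lemma CF_repeat {A} {EA : Enc A} (a : A) (n : T -> nat) : CF n -> CF (fun x => repeat a (n x)).
Proof.
  intros. apply (CF_ext X (fun x => nat_rect (fun _ => list A) [] (fun m r => a :: r) (n x))); [|cf].
  intros x. now induction (n x); cbn; f_equal.
Qed.

Lemma CF_code_str (l : T -> list bool) : CF l -> CF (fun x => code_str (l x)).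
Proof.
  intros. apply (CF_ext X (fun x => fold_right (fun b r => S (2 * r + b2n b)) 0 (l x))); [|cf].
  intros x. induction (l x); cbn [fold_right code_str]; auto.
Qed.

End Lists2.

Section Lists3.
Variable X : nat -> bool.
Notation CF := (CF X).
Context {T : Type} {ET : Enc T}.

Lemma CF_div2 (n : T -> nat) : CF n -> CF (fun x => Nat.div2 (n x)).
Proof.
  intros. apply (CF_ext X (fun x => nat_rect (fun _ => nat) 0 (fun m r => if Nat.even m then r else S r) (n x))).
  - intros x. induction (n x) as [|m IH]; [reflexivity|]. cbn [nat_rect]. rewrite IH. clear.
    rewrite <- (Nat.negb_odd m).
    pose proof (Nat.div2_odd m) as E. pose proof (Nat.div2_odd (S m)) as E'.
    rewrite Nat.odd_succ, <- Nat.negb_odd in E'.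
    destruct (Nat.odd m); cbn [negb Nat.b2n] in *; lia.
  - cf. apply CF_even. cf.
Qed.

Lemma CF_seq (a n : T -> nat) : CF a -> CF n -> CF (fun x => seq (a x) (n x)).
Proof.
  intros. apply (CF_ext X (fun x => nat_rect (fun _ => list nat) [] (fun m r => r ++ [a x + m]) (n x))).
  - intros x. induction (n x); [reflexivity|]. rewrite seq_S. cbn [nat_rect]. now rewrite IHn0.
  - cf. apply CF_app; cf.
    apply (CF_comp X a (fun p : T * (nat * list nat) => fst p)); auto. cf.
Qed.

Lemma CF_all_strings (n : T -> nat) : CF n -> CF (fun x => all_strings (n x)).
Proof.
  intros. apply (CF_ext X (fun x => nat_rect (fun _ => list (list bool)) [[]]
     (fun m r => map (cons false) r ++ map (cons true) r) (n x))).
  - intros x. induction (n x) as [|m IH]; [reflexivity|]. cbn [nat_rect]. now rewrite IH.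
  - cf. apply CF_app; apply (CF_map _ _ (fun _ => cons _)); cf.
Qed.

Lemma prefixb_spec s t : prefixb s t = true <-> exists r, t = s ++ r.
Proof.
  revert t. induction s as [|b s IH]; intros t; cbn.
  - split; eauto.
  - destruct t as [|c t]; [split; [discriminate|intros [r H]; discriminate]|].
    rewrite Bool.andb_true_iff, Bool.eqb_true_iff, IH. split.
    + intros [-> [r ->]]. eauto.
    + intros [r H]. injection H as -> ->. eauto.
Qed.

Lemma prefixb_firstn s t : prefixb s t = true <-> s = firstn (length s) t /\ length s <= length t.
Proof.
  rewrite prefixb_spec. split.
  - intros [r ->]. rewrite firstn_app, firstn_all, Nat.sub_diag, length_app. cbn. rewrite app_nil_r.
    split; [auto|lia].
  - intros [E L]. exists (skipn (length s) t). rewrite E at 1. now rewrite firstn_skipn.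
Qed.

Lemma CF_prefixb (s t : T -> list bool) : CF s -> CF t -> CF (fun x => prefixb (s x) (t x)).
Proof.
  intros. apply (CF_ext X (fun x => eqE (s x) (firstn (length (s x)) (t x)) &&
     (length (s x) <=? length (t x)))%bool).
  - intros x. apply Bool.eq_iff_eq_true.
    now rewrite Bool.andb_true_iff, eqE_spec, Nat.leb_le, prefixb_firstn.
  - cf; try refine (CF_firstn _ _ _ _ _); auto; now refine (CF_length _ _ _).
Qed.
End Lists3.

Ltac cf_user0 :=
  lazymatch goal with
  | |- CF _ (fun x => _ ++ _) => refine (CF_app _ _ _ _ _)
  | |- CF _ (@length _) => refine (CF_length _ _ (CF_id _))
  | |- CF _ (fun x => length _) => refine (CF_length _ _ _)
  | |- CF _ (fun x => map _ _) => refine (CF_map _ _ _ _ _)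
  | |- CF _ (fun x => filter _ _) => refine (CF_filter _ _ _ _ _)
  | |- CF _ (fun x => existsb _ _) => refine (CF_existsb _ _ _ _ _)
  | |- CF _ (fun x => forallb _ _) => refine (CF_forallb _ _ _ _ _)
  | |- CF _ (fun x => firstn _ _) => refine (CF_firstn _ _ _ _ _)
  | |- CF _ (fun x => nth _ _ _) => refine (CF_nth _ _ _ _ _ _)
  | |- CF _ (fun x => seq _ _) => refine (CF_seq _ _ _ _ _)
  | |- CF _ (fun x => 2 ^ _) => refine (CF_pow _ _ _)
  | |- CF _ (fun x => Nat.even _) => refine (CF_even _ _ _)
  | |- CF _ (fun x => Nat.div2 _) => refine (CF_div2 _ _ _)
  | |- CF _ (fun x => repeat _ _) => refine (CF_repeat _ _ _ _)
  | |- CF _ (fun x => code_str _) => refine (CF_code_str _ _ _)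
  | |- CF _ (fun x => all_strings _) => refine (CF_all_strings _ _ _)
  | |- CF _ (fun x => prefixb _ _) => refine (CF_prefixb _ _ _ _ _)
  end.
Ltac cf_user ::= cf_user0.

(** * A step-bounded universal evaluator *)

Section EvalInd.
Variable X : nat -> bool.
Variable P : rf -> list nat -> nat -> Prop.
Variable Q : list rf -> list nat -> list nat -> Prop.
Hypothesis hZero : forall xs, P RZero xs 0.
Hypothesis hSucc : forall xs, P RSucc xs (S (hd 0 xs)).
Hypothesis hProj : forall i xs, P (RProj i) xs (nth i xs 0).
Hypothesis hOracle : forall xs, P ROracle xs (b2n (X (hd 0 xs))).
Hypothesis hComp : forall f gs xs ys y, Q gs xs ys -> P f ys y -> P (RComp f gs) xs y.
Hypothesis hPrec0 : forall f g xs y, P f xs y -> P (RPrec f g) (0 :: xs) y.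
Hypothesis hPrecS : forall f g n xs r y,
  P (RPrec f g) (n :: xs) r -> P g (n :: r :: xs) y -> P (RPrec f g) (S n :: xs) y.
Hypothesis hMu : forall f xs y, P f (y :: xs) 0 ->
  (forall z, z < y -> exists v, v <> 0 /\ P f (z :: xs) v) -> P (RMu f) xs y.
Hypothesis hNil : forall xs, Q [] xs [].
Hypothesis hCons : forall g gs xs y ys, P g xs y -> Q gs xs ys -> Q (g :: gs) xs (y :: ys).

(** Written by hand because the induction must run over both mutual predicates at once and must
    reach the evaluations under the [exists] of [eMu]. *)
Fixpoint eval_ind' e xs y (H : eval X e xs y) {struct H} : P e xs y :=
  match H in eval _ e xs y return P e xs y with
  | eZero _ xs => hZero xs
  | eSucc _ xs => hSucc xs
  | eProj _ i xs => hProj i xs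
  | eOracle _ xs => hOracle xs
  | eComp _ f gs xs ys y Hg Hf => hComp f gs xs ys y (evals_ind' gs xs ys Hg) (eval_ind' f ys y Hf)
  | ePrec0 _ f g xs y Hf => hPrec0 f g xs y (eval_ind' f xs y Hf)
  | ePrecS _ f g n xs r y H1 H2 =>
      hPrecS f g n xs r y (eval_ind' _ _ _ H1) (eval_ind' _ _ _ H2)
  | eMu _ f xs y H0 H1 => hMu f xs y (eval_ind' _ _ _ H0)
      (fun z L => match H1 z L with
                  | ex_intro _ v (conj n h) => ex_intro _ v (conj n (eval_ind' _ _ _ h))
                  end)
  end
with evals_ind' gs xs ys (H : evals X gs xs ys) {struct H} : Q gs xs ys :=
  match H in evals _ gs xs ys return Q gs xs ys with
  | esNil _ xs => hNil xs
  | esCons _ g gs xs y ys H1 H2 =>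
      hCons g gs xs y ys (eval_ind' _ _ _ H1) (evals_ind' _ _ _ H2)
  end.
End EvalInd.

Lemma eval_det X e xs y y' : eval X e xs y -> eval X e xs y' -> y = y'.
Proof.
  intros H. revert y'. revert e xs y H.
  apply (eval_ind' X (fun e xs y => forall y', eval X e xs y' -> y = y')
                     (fun gs xs ys => forall ys', evals X gs xs ys' -> ys = ys')).
  - now inversion 1.
  - now inversion 1.
  - now inversion 1.
  - now inversion 1.
  - intros f gs xs ys y H1 H2 y' H. inversion H; subst.
    match goal with h : evals X gs xs _ |- _ => apply H1 in h end. subst. now apply H2.
  - intros f g xs y H1 y' H. inversion H; subst. auto.
  - intros f g n xs r y H1 H2 y' H. inversion H; subst.
    match goal with h : eval X (RPrec f g) _ _ |- _ => apply H1 in h end. subst. auto.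
  - intros f xs y H1 H2 y' H. inversion H; subst.
    destruct (lt_eq_lt_dec y y') as [[L|L]|L]; auto; exfalso.
    + match goal with h : forall z, z < y' -> _ |- _ => destruct (h y L) as [v [N Hv]] end.
      apply H1 in Hv. lia.
    + destruct (H2 y' L) as [v [N Hv]].
      match goal with h : eval X f (y' :: xs) 0 |- _ => apply Hv in h end. lia.
  - now inversion 1.
  - intros g gs xs y ys H1 H2 ys' H. inversion H; subst. f_equal; auto.
Qed.

Fixpoint code (e : rf) : nat :=
  match e with
  | RZero => to_nat (0, 0)
  | RSucc => to_nat (1, 0)
  | RProj i => to_nat (2, i)
  | ROracle => to_nat (3, 0)
  | RComp f gs => to_nat (4, to_nat (code f, enc (map code gs)))
  | RPrec f g => to_nat (5, to_nat (code f, code g))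
  | RMu f => to_nat (6, code f)
  end.

Fixpoint declist_aux (fuel n : nat) : list nat :=
  match fuel, n with
  | S k, S p => fst (of_nat p) :: declist_aux k (snd (of_nat p))
  | _, _ => []
  end.
Definition declist (n : nat) : list nat := declist_aux n n.

Lemma enc_declist n : enc (declist n) = n.
Proof.
  unfold declist. enough (H : forall k n, n <= k -> enc (declist_aux k n) = n) by auto.
  induction k; intros [|p] L; cbn [declist_aux]; try lia; auto.
  rewrite enc_cons, IHk; pose proof (cancel_to_of p) as E; destruct (of_nat p) as [a b]; cbn [fst snd] in *.
  - change (enc a) with a. lia.
  - pose proof (le_to_nat a b). lia.
Qed.

Lemma declist_enc l : declist (enc l) = l.
Proof. apply enc_inj, enc_declist. Qed.

Notation fact := (nat * (list nat * nat))%type.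

(** A fact [(c, (xs, y))] claims that the program with code [c] sends [xs] to [y]. Every number
    decodes to a fact, so running through the numbers meets all candidates. *)
Definition dfact (m : nat) : fact :=
  (fst (of_nat m), (declist (fst (of_nat (snd (of_nat m)))), snd (of_nat (snd (of_nat m))))).

Lemma enc_dfact m : enc (dfact m) = m.
Proof.
  unfold dfact. rewrite !enc_pair, enc_declist.
  pose proof (cancel_to_of m) as E. destruct (of_nat m) as [a b]; cbn [fst snd].
  pose proof (cancel_to_of b) as E'. destruct (of_nat b) as [c d]; cbn [fst snd].
  change (enc a) with a. change (enc d) with d. congruence.
Qed.

Lemma dfact_enc f : dfact (enc f) = f.
Proof. apply enc_inj, enc_dfact. Qed.

Definition memb {A} {EA : Enc A} (a : A) (l : list A) : bool := existsb (eqE a) l.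

Lemma memb_spec {A} {EA : Enc A} (a : A) l : memb a l = true <-> In a l.
Proof.
  unfold memb. rewrite existsb_exists. split.
  - intros [b [H E]]. apply eqE_eq in E. now subst.
  - intros H. exists a. split; auto. apply eqE_refl.
Qed.

Definition allev (F : list fact) (xs gs ys : list nat) : bool :=
  (length gs =? length ys) &&
  forallb (fun i => memb (nth i gs 0, (xs, nth i ys 0)) F) (seq 0 (length gs)).

(** The rules of [eval] read backwards: the tag selects the rule, and its premises must be in [F].
    Oracle queries are answered only below [length s], so what is derived holds for every oracle
    extending [s]. *)
Definition deriv (s : list bool) (F : list fact) (c : nat) (xs : list nat) (y : nat) : bool :=
  let tag := fst (of_nat c) in
  let p := snd (of_nat c) in
  if tag =? 0 then y =? 0
  else if tag =? 1 then y =? S (hd 0 xs)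
  else if tag =? 2 then y =? nth p xs 0
  else if tag =? 3 then (hd 0 xs <? length s) && (y =? b2n (nth (hd 0 xs) s false))
  else if tag =? 4 then
    existsb (fun g : fact => (fst g =? fst (of_nat p)) && (snd (snd g) =? y) &&
               allev F xs (declist (snd (of_nat p))) (fst (snd g))) F
  else if tag =? 5 then
    if length xs =? 0 then false
    else if hd 0 xs =? 0 then memb (fst (of_nat p), (tl xs, y)) F
    else existsb (fun g : fact => (fst g =? c) && eqE (fst (snd g)) (pred (hd 0 xs) :: tl xs) &&
           memb (snd (of_nat p), (pred (hd 0 xs) :: snd (snd g) :: tl xs, y)) F) F
  else if tag =? 6 then
    memb (p, (y :: xs, 0)) F &&
    forallb (fun z => existsb (fun g : fact => (fst g =? p) && eqE (fst (snd g)) (z :: xs) &&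
                                 negb (snd (snd g) =? 0)) F) (seq 0 y)
  else false.

(* One round derives, from the facts found so far, all further facts with code below the round number. *)
Definition facts_upto (s : list bool) (t : nat) : list fact :=
  nat_rect (fun _ => list fact) []
    (fun k F => filter (fun f => deriv s F (fst f) (fst (snd f)) (snd (snd f))) (map dfact (seq 0 k)) ++ F) t.

(** The length of the string bounds both the queries and the running time, so that one parameter
    serves for approximating computations with a real as oracle. *)
Definition facts (s : list bool) : list fact := facts_upto s (length s).

Lemma facts_upto_S s t f : In f (facts_upto s (S t)) <->
  (enc f < t /\ deriv s (facts_upto s t) (fst f) (fst (snd f)) (snd (snd f)) = true) \/
  In f (facts_upto s t).
Proof.
  cbn [facts_upto nat_rect]. rewrite in_app_iff, filter_In, in_map_iff.
  fold (facts_upto s t). split; intros [H|H]; auto; left.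
  - destruct H as [[m [<- Hm]] Hd]. apply in_seq in Hm. rewrite enc_dfact. split; auto; lia.
  - destruct H as [L Hd]. split; auto. exists (enc f). rewrite dfact_enc. split; auto.
    apply in_seq. lia.
Qed.

Lemma allev_spec F xs gs ys : allev F xs gs ys = true <->
  Forall2 (fun g y => In (g, (xs, y)) F) gs ys.
Proof.
  unfold allev. rewrite andb_true_iff, Nat.eqb_eq, forallb_forall.
  setoid_rewrite memb_spec. setoid_rewrite in_seq.
  split.
  - intros [L H]. revert ys L H. induction gs as [|g gs IH]; intros [|y ys] L H; try discriminate; constructor.
    + apply (H 0). cbn. lia.
    + apply IH; [now injection L|]. intros i Hi. apply (H (S i)). cbn. lia.
  - induction 1 as [|g y gs ys H0 H [L IH]]; [split; auto; cbn; lia|].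
    split; [cbn; lia|]. intros [|i] Hi; [exact H0|]. apply IH. cbn in Hi. lia.
Qed.

Lemma andb3 a b c : a && b && c = true <-> a = true /\ b = true /\ c = true.
Proof. rewrite !andb_true_iff. tauto. Qed.

Lemma facts_sound s X : in_cyl s X ->
  forall t e xs y, In (code e, (xs, y)) (facts_upto s t) -> eval X e xs y.
Proof.
  intros HX. induction t as [|t IH]; intros e xs y H; [destruct H|].
  apply facts_upto_S in H as [[_ H]|H]; [|auto].
  cbn [fst snd] in H. unfold deriv in H.
  destruct e as [ | |i| |f gs|f g|f]; cbn [code] in H; rewrite !cancel_of_to in H;
    cbn [fst snd Nat.eqb] in H; rewrite ?cancel_of_to in H; cbn [fst snd] in H.
  - apply Nat.eqb_eq in H as ->. constructor.
  - apply Nat.eqb_eq in H as ->. constructor.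
  - apply Nat.eqb_eq in H as ->. constructor.
  - apply andb_true_iff in H as [L H]. apply Nat.ltb_lt in L. apply Nat.eqb_eq in H as ->.
    rewrite HX by auto. constructor.
  - apply existsb_exists in H as [[c [ys v]] [Hin H]]. cbn [fst snd] in H.
    apply andb3 in H as [H1 [H2 H3]]. apply Nat.eqb_eq in H1, H2. subst c v.
    rewrite declist_enc in H3. apply allev_spec in H3.
    apply eComp with ys; [|auto].
    clear Hin. revert ys H3. induction gs as [|g gs IHg]; intros ys H3; inversion H3; subst; constructor; auto.
  - destruct xs as [|[|n] xs]; cbn [length Nat.eqb hd tl pred] in H; [discriminate| |].
    + apply memb_spec in H. constructor. auto.
    + apply existsb_exists in H as [[c [ys r]] [Hin H]]. cbn [fst snd] in H.
      apply andb3 in H as [H1 [H2 H3]]. apply Nat.eqb_eq in H1. apply eqE_eq in H2.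
      apply memb_spec in H3. subst. apply ePrecS with r; [|auto].
      apply (IH (RPrec f g)). exact Hin.
  - apply andb_true_iff in H as [H1 H2]. apply memb_spec in H1.
    constructor; [auto|]. intros z L. rewrite forallb_forall in H2.
    specialize (H2 z ltac:(apply in_seq; lia)).
    apply existsb_exists in H2 as [[c [ys r]] [Hin H]]. cbn [fst snd] in H.
    apply andb3 in H as [H2 [H3 H4]]. apply Nat.eqb_eq in H2. apply eqE_eq in H3.
    apply negb_true_iff, Nat.eqb_neq in H4. subst. eauto.
Qed.

Lemma facts_mono_t s t t' : t <= t' -> incl (facts_upto s t) (facts_upto s t').
Proof.
  induction 1; [apply incl_refl|]. intros f H'. apply facts_upto_S. right. auto.
Qed.

Lemma memb_mono {A} {EA : Enc A} (a : A) F F' : incl F F' -> memb a F = true -> memb a F' = true.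
Proof. rewrite !memb_spec. auto. Qed.

Lemma existsb_mono {A} (p p' : A -> bool) l l' : incl l l' -> (forall a, p a = true -> p' a = true) ->
  existsb p l = true -> existsb p' l' = true.
Proof. rewrite !existsb_exists. intros H1 H2 [a [Ha Hp]]. eauto. Qed.

(** All rules are positive in [F], and a longer string only answers more queries. *)
Lemma deriv_mono s r F F' c xs y : incl F F' ->
  deriv s F c xs y = true -> deriv (s ++ r) F' c xs y = true.
Proof.
  intros HF. unfold deriv.
  destruct (fst (of_nat c) =? 0); auto. destruct (fst (of_nat c) =? 1); auto.
  destruct (fst (of_nat c) =? 2); auto.
  destruct (fst (of_nat c) =? 3).
  { rewrite !andb_true_iff, !Nat.ltb_lt, length_app. intros [L H]. split; [lia|].
    now rewrite app_nth1. }
  destruct (fst (of_nat c) =? 4).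
  { apply existsb_mono; auto. intros g. rewrite !andb3, !allev_spec. intros [? [? H]].
    repeat split; auto. eapply Forall2_impl; [|exact H]. auto. }
  destruct (fst (of_nat c) =? 5).
  { destruct (length xs =? 0); auto. destruct (hd 0 xs =? 0); [now apply memb_mono|].
    apply existsb_mono; auto. intros g. rewrite !andb3. intros [? [? H]].
    repeat split; auto. now apply (memb_mono _ F). }
  destruct (fst (of_nat c) =? 6); auto.
  rewrite !andb_true_iff, !forallb_forall. intros [H1 H2]. split; [now apply (memb_mono _ F)|].
  intros z Hz. specialize (H2 z Hz). revert H2. now apply existsb_mono.
Qed.

Lemma facts_mono_s s r t : incl (facts_upto s t) (facts_upto (s ++ r) t).
Proof.
  induction t; intros f H; [destruct H|]. apply facts_upto_S in H. apply facts_upto_S.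
  destruct H as [[L H]|H]; [left|right; auto]. split; auto. now apply deriv_mono with (facts_upto s t).
Qed.

Lemma facts_mono s r : incl (facts s) (facts (s ++ r)).
Proof.
  unfold facts. intros f H. apply facts_mono_s. apply (facts_mono_t s (length s)); auto.
  rewrite length_app. lia.
Qed.

Definition restr (X : nat -> bool) (n : nat) : list bool := map X (seq 0 n).

Lemma restr_length X n : length (restr X n) = n.
Proof. unfold restr. now rewrite length_map, length_seq. Qed.

Lemma restr_nth X n i d : i < n -> nth i (restr X n) d = X i.
Proof.
  intros L. unfold restr. rewrite nth_indep with (d' := X 0) by (rewrite length_map, length_seq; auto).
  rewrite map_nth, seq_nth; auto.
Qed.

Lemma restr_cyl X n : in_cyl (restr X n) X.
Proof. intros i L. rewrite restr_length in L. now apply restr_nth. Qed.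

Lemma restr_app X m n : restr X (m + n) = restr X m ++ map X (seq m n).
Proof. unfold restr. now rewrite seq_app, map_app. Qed.

Lemma firstn_restr X m n : m <= n -> firstn m (restr X n) = restr X m.
Proof.
  intros L. replace n with (m + (n - m)) by lia. rewrite restr_app, firstn_app, restr_length, Nat.sub_diag.
  cbn. rewrite app_nil_r. rewrite <- (restr_length X m) at 1. apply firstn_all.
Qed.

Lemma cyl_restr s X : in_cyl s X <-> s = restr X (length s).
Proof.
  split; [|intros ->; apply restr_cyl]. intros H.
  apply nth_ext with false false; [now rewrite restr_length|].
  intros i L. rewrite H by auto. now rewrite restr_nth.
Qed.

(** One threshold serves all later [s] and [t], so the thresholds of several premises can simply be
    added. *)
Definition eventually_fact X e xs y : Prop :=
  exists t0, forall s t, in_cyl s X -> t0 <= t -> t0 <= length s -> In (code e, (xs, y)) (facts_upto s t).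

Lemma eventually_intro X e xs y t0 :
  (forall s t, in_cyl s X -> t0 <= t -> t0 <= length s -> deriv s (facts_upto s t) (code e) xs y = true) ->
  eventually_fact X e xs y.
Proof.
  (* The code of the fact enters the threshold because a round derives only facts with codes below
     its number. *)
  intros H. exists (S (t0 + S (enc (code e, (xs, y))))). intros s [|t] Hs L L'; [lia|].
  apply facts_upto_S. left. split; [lia|]. apply H; auto; lia.
Qed.

Lemma facts_complete X e xs y : eval X e xs y -> eventually_fact X e xs y.
Proof.
  revert e xs y.
  apply (eval_ind' X (eventually_fact X) (fun gs xs ys => exists t0, forall s t, in_cyl s X ->
    t0 <= t -> t0 <= length s -> Forall2 (fun g y => In (g, (xs, y)) (facts_upto s t)) (map code gs) ys)).
  - intros xs. apply (eventually_intro _ _ _ _ 0). intros.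
    unfold deriv. cbn [code]. rewrite cancel_of_to. reflexivity.
  - intros xs. apply (eventually_intro _ _ _ _ 0). intros.
    unfold deriv. cbn [code]. rewrite cancel_of_to. cbn [fst snd Nat.eqb]. apply Nat.eqb_refl.
  - intros i xs. apply (eventually_intro _ _ _ _ 0). intros.
    unfold deriv. cbn [code]. rewrite cancel_of_to. cbn [fst snd Nat.eqb]. apply Nat.eqb_refl.
  - intros xs. apply (eventually_intro _ _ _ _ (S (hd 0 xs))). intros s t Hs _ L.
    unfold deriv. cbn [code]. rewrite cancel_of_to. cbn [fst snd Nat.eqb].
    apply andb_true_iff. split; [now apply Nat.ltb_lt|]. rewrite Hs by auto. apply Nat.eqb_refl.
  - intros f gs xs ys y [t1 H1] [t2 H2]. apply (eventually_intro _ _ _ _ (t1 + t2)).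
    intros s t Hs L L'. unfold deriv. cbn [code]. rewrite !cancel_of_to. cbn [fst snd].
    rewrite ?cancel_of_to. cbn [fst snd Nat.eqb].
    apply existsb_exists. exists (code f, (ys, y)). split; [apply H2; auto; lia|].
    cbn [fst snd]. rewrite !Nat.eqb_refl, declist_enc.
    apply allev_spec. apply H1; auto; lia.
  - intros f g xs y [t1 H1]. apply (eventually_intro _ _ _ _ t1).
    intros s t Hs L L'. unfold deriv. cbn [code]. rewrite !cancel_of_to. cbn [fst snd].
    rewrite ?cancel_of_to. cbn [fst snd Nat.eqb length hd tl].
    apply memb_spec. auto.
  - intros f g n xs r y [t1 H1] [t2 H2]. apply (eventually_intro _ _ _ _ (t1 + t2)).
    intros s t Hs L L'. unfold deriv. cbn [code]. rewrite !cancel_of_to. cbn [fst snd].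
    rewrite ?cancel_of_to. cbn [fst snd Nat.eqb length hd tl pred].
    apply existsb_exists. exists (code (RPrec f g), (n :: xs, r)). split; [apply H1; auto; lia|].
    cbn [fst snd]. apply andb3. split; [apply Nat.eqb_refl|]. split; [apply eqE_refl|].
    apply memb_spec. apply H2; auto; lia.
  - intros f xs y [t1 H1] H2.
    assert (E : exists t2, forall z, z < y -> exists v, v <> 0 /\ forall s t, in_cyl s X ->
      t2 <= t -> t2 <= length s -> In (code f, (z :: xs, v)) (facts_upto s t)).
    { clear H1. induction y as [|y IH]; [exists 0; lia|].
      destruct IH as [t2 IH]; [intros z L; apply H2; lia|].
      destruct (H2 y) as [v [N [t3 H3]]]; [lia|].
      exists (t2 + t3). intros z L. destruct (Nat.eq_dec z y) as [->|D].
      - exists v. split; auto. intros. apply H3; auto; lia.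
      - destruct (IH z) as [w [N' H4]]; [lia|]. exists w. split; auto. intros. apply H4; auto; lia. }
    destruct E as [t2 E]. apply (eventually_intro _ _ _ _ (t1 + t2)).
    intros s t Hs L L'. unfold deriv. cbn [code]. rewrite !cancel_of_to. cbn [fst snd].
    rewrite ?cancel_of_to. cbn [fst snd Nat.eqb].
    apply andb_true_iff. split; [apply memb_spec, H1; auto; lia|].
    apply forallb_forall. intros z Hz. apply in_seq in Hz. destruct (E z) as [v [N Hv]]; [lia|].
    apply existsb_exists. exists (code f, (z :: xs, v)). split; [apply Hv; auto; lia|].
    cbn [fst snd]. apply andb3. split; [apply Nat.eqb_refl|]. split; [apply eqE_refl|].
    now apply negb_true_iff, Nat.eqb_neq.
  - intros xs. exists 0. intros. constructor.
  - intros g gs xs y ys [t1 H1] [t2 H2]. exists (t1 + t2). intros s t Hs L L'.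
    cbn [map]. constructor; [apply H1|apply H2]; auto; lia.
Qed.

Definition evalb (c : nat) (s : list bool) (xs : list nat) (y : nat) : bool := memb (c, (xs, y)) (facts s).

Definition haltb (c : nat) (s : list bool) (xs : list nat) : bool :=
  existsb (fun f : fact => (fst f =? c) && eqE (fst (snd f)) xs) (facts s).

Lemma evalb_sound X e s xs y : in_cyl s X -> evalb (code e) s xs y = true -> eval X e xs y.
Proof. unfold evalb. rewrite memb_spec. intros H. now apply facts_sound. Qed.

Lemma evalb_complete X e xs y : eval X e xs y ->
  exists t0, forall s, in_cyl s X -> t0 <= length s -> evalb (code e) s xs y = true.
Proof.
  intros H. apply facts_complete in H as [t0 H]. exists t0. intros s Hs L.
  apply memb_spec. now apply H.
Qed.

Lemma evalb_mono c s r xs y : evalb c s xs y = true -> evalb c (s ++ r) xs y = true.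
Proof. unfold evalb. rewrite !memb_spec. apply facts_mono. Qed.

Lemma haltb_spec c s xs : haltb c s xs = true <-> exists y, evalb c s xs y = true.
Proof.
  unfold haltb, evalb. setoid_rewrite memb_spec. rewrite existsb_exists. split.
  - intros [[d [zs y]] [H1 H2]]. cbn [fst snd] in H2.
    apply andb_true_iff in H2 as [H2 H3]. apply Nat.eqb_eq in H2. apply eqE_eq in H3. subst. eauto.
  - intros [y H]. exists (c, (xs, y)). split; auto. cbn [fst snd]. rewrite Nat.eqb_refl. apply eqE_refl.
Qed.

Lemma haltb_mono c s r xs : haltb c s xs = true -> haltb c (s ++ r) xs = true.
Proof. rewrite !haltb_spec. intros [y H]. exists y. now apply evalb_mono. Qed.

Section CFEval.
Variable X : nat -> bool.
Context {T : Type} {ET : Enc T}.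

(** Since [enc (declist m) = m], decoding leaves the code as it is, and a program for [n] already
    computes the decoded list. *)
Lemma CF_declist (n : T -> nat) : CF X n -> CF X (fun x => declist (n x)).
Proof.
  intros [e He]. exists e. intros x. rewrite enc_declist. apply He.
Qed.

Lemma CF_dfact (n : T -> nat) : CF X n -> CF X (fun x => dfact (n x)).
Proof.
  intros [e He]. exists e. intros x. rewrite enc_dfact. apply He.
Qed.
End CFEval.

Lemma CF_memb (X : nat -> bool) {T} {ET : Enc T} {A} {EA : Enc A} (a : T -> A) (l : T -> list A) :
  CF X a -> CF X l -> CF X (fun x => memb (a x) (l x)).
Proof.
  intros. unfold memb. cf. apply (CF_comp X a (fun p : T * A => fst p)); cf.
Qed.

Ltac cf_user1 :=
  lazymatch goal with
  | |- CF _ (fun x => declist _) => refine (CF_declist _ _ _)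
  | |- CF _ (fun x => dfact _) => refine (CF_dfact _ _ _)
  | |- CF _ (fun x => memb _ _) => refine (CF_memb _ _ _ _ _)
  | |- _ => cf_user0
  end.
Ltac cf_user ::= cf_user1.

Lemma CF_allev (X : nat -> bool) {T} {ET : Enc T} F xs gs ys :
  CF X F -> CF X xs -> CF X gs -> CF X ys ->
  CF X (fun x : T => allev (F x) (xs x) (gs x) (ys x)).
Proof.
  intros H1 H2 H3 H4.
  apply (CF_comp X (fun p : list fact * (list nat * (list nat * list nat)) =>
     allev (fst p) (fst (snd p)) (fst (snd (snd p))) (snd (snd (snd p))))
     (fun x => (F x, (xs x, (gs x, ys x))))); [unfold allev|]; cf.
Qed.

Lemma CF_deriv (X : nat -> bool) {T} {ET : Enc T} s F c xs y :
  CF X s -> CF X F -> CF X c -> CF X xs -> CF X y ->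
  CF X (fun x : T => deriv (s x) (F x) (c x) (xs x) (y x)).
Proof.
  intros H1 H2 H3 H4 H5.
  apply (CF_comp X (fun p : list bool * (list fact * (nat * (list nat * nat))) =>
     deriv (fst p) (fst (snd p)) (fst (snd (snd p))) (fst (snd (snd (snd p)))) (snd (snd (snd (snd p)))))
     (fun x => (s x, (F x, (c x, (xs x, y x)))))); [unfold deriv|cf].
  cbv zeta. cf; apply CF_allev; cf.
Qed.

Lemma CF_facts (X : nat -> bool) {T} {ET : Enc T} s : CF X s -> CF X (fun x : T => facts (s x)).
Proof.
  apply (CF_comp X facts). unfold facts, facts_upto. cf. apply CF_deriv; cf.
Qed.

Lemma CF_evalb (X : nat -> bool) {T} {ET : Enc T} c s xs y :
  CF X c -> CF X s -> CF X xs -> CF X y -> CF X (fun x : T => evalb (c x) (s x) (xs x) (y x)).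
Proof. intros. unfold evalb. cf. now apply CF_facts. Qed.

Lemma CF_haltb (X : nat -> bool) {T} {ET : Enc T} c s xs :
  CF X c -> CF X s -> CF X xs -> CF X (fun x : T => haltb (c x) (s x) (xs x)).
Proof.
  intros. apply (CF_comp X (fun p : nat * (list bool * list nat) => haltb (fst p) (fst (snd p)) (snd (snd p)))
     (fun x => (c x, (s x, xs x)))); [unfold haltb|]; cf. apply CF_facts; cf.
Qed.

Ltac cf_user2 :=
  lazymatch goal with
  | |- CF _ (fun x => evalb _ _ _ _) => refine (CF_evalb _ _ _ _ _ _ _ _ _)
  | |- CF _ (fun x => haltb _ _ _) => refine (CF_haltb _ _ _ _ _ _ _)
  | |- _ => cf_user1
  end.
Ltac cf_user ::= cf_user2.

(** * Measure of clopen sets and a universal test *)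

(** [cnt m P / 2 ^ m] is the measure of the clopen set given by [P]. Inequalities between measures
    are stated with the denominators multiplied out, as in [ML_test]. *)
Definition cnt (m : nat) (P : list bool -> bool) : nat := length (filter P (all_strings m)).

Lemma in_all_strings m s : In s (all_strings m) <-> length s = m.
Proof.
  revert s. induction m as [|m IH]; intros s; cbn [all_strings].
  - split; [intros [<-|[]]; reflexivity|]. destruct s; [left; auto|discriminate].
  - rewrite in_app_iff, !in_map_iff. split.
    + intros [[t [<- H]]|[t [<- H]]]; cbn; f_equal; now apply IH.
    + destruct s as [|[] s]; [discriminate| |]; intros H; injection H as H; apply IH in H; eauto.
Qed.

Lemma cnt_0 P : cnt 0 P = if P [] then 1 else 0.
Proof. unfold cnt. cbn. now destruct (P []). Qed.

Lemma cnt_S m P : cnt (S m) P = cnt m (fun s => P (false :: s)) + cnt m (fun s => P (true :: s)).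
Proof.
  unfold cnt. cbn [all_strings]. rewrite filter_app, length_app. f_equal.
  - induction (all_strings m) as [|s l IH]; cbn; auto. destruct (P (false :: s)); cbn; auto.
  - induction (all_strings m) as [|s l IH]; cbn; auto. destruct (P (true :: s)); cbn; auto.
Qed.

Lemma cnt_le m P Q : (forall s, length s = m -> P s = true -> Q s = true) -> cnt m P <= cnt m Q.
Proof.
  revert P Q. induction m as [|m IH]; intros P Q H.
  - rewrite !cnt_0. specialize (H [] eq_refl). destruct (P []); [rewrite H|]; auto. lia.
  - rewrite !cnt_S. apply Nat.add_le_mono; apply IH; intros s L; apply H; cbn; auto.
Qed.

Lemma cnt_ext m P Q : (forall s, length s = m -> P s = Q s) -> cnt m P = cnt m Q.
Proof. intros H. apply Nat.le_antisymm; apply cnt_le; intros s L; now rewrite H. Qed.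

Lemma cnt_const m b : cnt m (fun _ => b) = if b then 2 ^ m else 0.
Proof.
  induction m; [now rewrite cnt_0|]. rewrite cnt_S, IHm. destruct b; cbn; lia.
Qed.

Lemma cnt_or m P Q : cnt m (fun s => P s || Q s) <= cnt m P + cnt m Q.
Proof.
  revert P Q. induction m as [|m IH]; intros P Q.
  - rewrite !cnt_0. destruct (P []), (Q []); cbn; lia.
  - rewrite !cnt_S. pose proof (IH (fun s => P (false :: s)) (fun s => Q (false :: s))).
    pose proof (IH (fun s => P (true :: s)) (fun s => Q (true :: s))). lia.
Qed.

Lemma cnt_split m P Q : cnt m P = cnt m (fun s => P s && Q s) + cnt m (fun s => P s && negb (Q s)).
Proof.
  revert P Q. induction m as [|m IH]; intros P Q.
  - rewrite !cnt_0. destruct (P []), (Q []); reflexivity.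
  - rewrite !cnt_S, (IH (fun s => P (false :: s)) (fun s => Q (false :: s))),
      (IH (fun s => P (true :: s)) (fun s => Q (true :: s))). lia.
Qed.

Lemma cnt_firstn m d P : cnt (m + d) (fun s => P (firstn m s)) = 2 ^ d * cnt m P.
Proof.
  revert P. induction m as [|m IH]; intros P; cbn [plus].
  - cbn [firstn]. rewrite cnt_const, cnt_0. destruct (P []); lia.
  - rewrite !cnt_S. cbn [firstn].
    rewrite (IH (fun s => P (false :: s))), (IH (fun s => P (true :: s))). lia.
Qed.

(** A comparison of measures at two resolutions: [Q] lies inside the lift of [P] to length [n], and
    lifting does not change the measure. *)
Lemma cnt_shrink m n P Q : m <= n ->
  (forall s, length s = n -> Q s = true -> P (firstn m s) = true) ->
  2 ^ m * cnt n Q <= 2 ^ n * cnt m P.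
Proof.
  intros L H. replace n with (m + (n - m)) in * by lia.
  rewrite Nat.pow_add_r, <- Nat.mul_assoc, <- (cnt_firstn m (n - m) P).
  apply Nat.mul_le_mono_l, cnt_le. auto.
Qed.

Lemma cnt_pos m P : 0 < cnt m P -> exists s, length s = m /\ P s = true.
Proof.
  unfold cnt. intros H. destruct (filter P (all_strings m)) as [|s l] eqn:E; [cbn in H; lia|].
  exists s. assert (I : In s (filter P (all_strings m))) by (rewrite E; now left).
  apply filter_In in I as [I HP]. now apply in_all_strings in I.
Qed.

Lemma cnt_none m P : (forall s, length s = m -> P s = false) -> cnt m P = 0.
Proof. intros H. rewrite (cnt_ext m P (fun _ => false)), cnt_const; auto. Qed.

Lemma cnt_prefix m s : length s <= m -> cnt m (prefixb s) = 2 ^ (m - length s).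
Proof.
  revert m. induction s as [|b s IH]; intros m L.
  - cbn. rewrite Nat.sub_0_r. apply (cnt_const m true).
  - destruct m as [|m]; cbn in L; [lia|]. rewrite cnt_S. cbn [prefixb length Nat.sub].
    rewrite <- (IH m) by lia. destruct b; cbn [Bool.eqb andb].
    + rewrite (cnt_const m false). reflexivity.
    + rewrite (cnt_const m false). apply Nat.add_0_r.
Qed.

(** The cylinders of the [2 ^ l] strings of length [l] partition the space. Read contrapositively,
    it is the pigeonhole principle that finds a string on which a large class stays large. *)
Lemma cnt_bound_prefix l m B Q : l <= m ->
  (forall t, length t = l -> cnt m (fun s => prefixb t s && Q s) <= B) -> cnt m Q <= 2 ^ l * B.
Proof.
  revert m Q. induction l as [|l IH]; intros m Q L H.
  - specialize (H [] eq_refl). cbn [prefixb andb] in H. cbn. rewrite Nat.add_0_r.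
    now rewrite (cnt_ext m Q (fun s => Q s)).
  - destruct m as [|m]; [lia|]. rewrite cnt_S. cbn [Nat.pow].
    assert (E : forall b, cnt m (fun s => Q (b :: s)) <= 2 ^ l * B);
      [|pose proof (E true); pose proof (E false); lia].
    intros b. apply IH; [lia|]. intros t Ht. rewrite <- (H (b :: t)) by (cbn; auto).
    rewrite cnt_S. destruct b; cbn [prefixb Bool.eqb andb]; lia.
Qed.

Lemma cnt_existsb_sum {A} m (f : A -> list bool -> bool) l :
  cnt m (fun s => existsb (fun a => f a s) l) <= list_sum (map (fun a => cnt m (f a)) l).
Proof.
  induction l as [|a l IH]; cbn [existsb map list_sum fold_right].
  - rewrite cnt_const. auto.
  - pose proof (cnt_or m (f a) (fun s => existsb (fun a => f a s) l)).
    change (fold_right Nat.add 0 ?x) with (list_sum x). lia.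
Qed.

Lemma list_sum_incl (f : nat -> nat) l l' : NoDup l -> incl l l' ->
  list_sum (map f l) <= list_sum (map f l').
Proof.
  revert l'. induction l as [|a l IH]; intros l' N H; [apply le_0_n|].
  inversion N; subst.
  destruct (in_split a l' (H a (or_introl eq_refl))) as [l1 [l2 ->]].
  rewrite map_app, list_sum_app. cbn [map].
  change (list_sum (f a :: ?x)) with (f a + list_sum x).
  enough (list_sum (map f l) <= list_sum (map f (l1 ++ l2))) by (rewrite map_app, list_sum_app in *; lia).
  apply IH; auto. intros b Hb. assert (I := H b (or_intror Hb)).
  rewrite in_app_iff in *. destruct I as [I|[<-|I]]; auto. contradiction.
Qed.

Lemma geometric_sum m k c : c + k <= S m ->
  list_sum (map (fun x => 2 ^ (m - x)) (seq c k)) <= 2 ^ (S m - c).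
Proof.
  revert c. induction k as [|k IH]; intros c L; [apply le_0_n|]. cbn [seq map].
  change (list_sum (?a :: ?x)) with (a + list_sum x).
  specialize (IH (S c) ltac:(lia)). replace (S m - c) with (S (m - c)) by lia.
  replace (S m - S c) with (m - c) in IH by lia. cbn [Nat.pow]. lia.
Qed.

(** Distinct lengths above [c] contribute at most [2^-(c+1) + 2^-(c+2) + ...], which is at most
    [2^-c]. *)
Lemma cnt_distinct_lengths m c (L : list (list bool)) :
  NoDup (map (@length bool) L) -> (forall s, In s L -> S c <= length s <= m) ->
  2 ^ c * cnt m (fun t => existsb (fun s => prefixb s t) L) <= 2 ^ m.
Proof.
  (* The empty family is set apart because the truncated difference [m - c] below needs [c <= m],
     which only a member of [L] provides. *)
  intros N H. destruct L as [|s0 L0]; [cbn [existsb]; rewrite cnt_const; lia|].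
  assert (Hc : S c <= m) by (specialize (H s0 (or_introl eq_refl)); lia).
  set (L := s0 :: L0) in *. clearbody L. clear s0 L0.
  assert (E : cnt m (fun t => existsb (fun s => prefixb s t) L) <= 2 ^ (m - c)).
  { etransitivity; [apply (cnt_existsb_sum m prefixb)|].
    rewrite (map_ext_in _ (fun s => 2 ^ (m - length s))) by (intros s Hs; apply cnt_prefix, H, Hs).
    rewrite <- (map_map (@length bool) (fun x => 2 ^ (m - x))).
    etransitivity; [apply (list_sum_incl _ _ (seq (S c) (m - c)) N)|].
    - intros x Hx. apply in_map_iff in Hx as [s [<- Hs]]. apply H in Hs. apply in_seq. lia.
    - rewrite geometric_sum by lia. now replace (S m - S c) with (m - c) by lia. }
  replace m with (c + (m - c)) at 2 by lia. rewrite Nat.pow_add_r. now apply Nat.mul_le_mono_l.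
Qed.

Lemma CF_cnt (X : nat -> bool) {T} {ET : Enc T} (m : T -> nat) (P : T -> list bool -> bool) :
  CF X m -> CF X (fun p : T * list bool => P (fst p) (snd p)) -> CF X (fun x => cnt (m x) (P x)).
Proof. intros. unfold cnt. cf. Qed.

Definition zeros (t : nat) : list bool := repeat false t.

Lemma zeros_cyl t : in_cyl (zeros t) empty_oracle.
Proof. intros i L. unfold zeros in *. rewrite repeat_length in L. now apply nth_repeat_lt. Qed.

Lemma zeros_length t : length (zeros t) = t.
Proof. apply repeat_length. Qed.

(* [X] has a prefix that the [e]-th test has put into its component of index [e + 3] by stage [t]. *)
Definition covered (e t : nat) (X : list bool) : bool :=
  existsb (fun j => haltb e (zeros t) [e + 3; code_str (firstn j X)]) (seq 0 (S t)).

Definition within_bound (e t : nat) : bool := 2 ^ (e + 3) * cnt t (covered e t) <=? 2 ^ t.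

Definition covered_good (e m : nat) (X : list bool) : bool :=
  existsb (fun t => within_bound e t && covered e t (firstn t X)) (seq 0 (S m)).

(* Universal test: the union over [e] of the components of index [e + 3], each test being frozen once it is
   seen to violate the measure condition. *)
Definition univ_test (X : list bool) : bool := existsb (fun e => covered_good e (length X) X) (seq 0 (length X)).

Lemma haltb_zeros_mono e t t' xs : t <= t' -> haltb e (zeros t) xs = true -> haltb e (zeros t') xs = true.
Proof.
  intros L H. unfold zeros. replace t' with (t + (t' - t)) by lia. rewrite repeat_app. now apply haltb_mono.
Qed.

Lemma covered_mono e t t' X : t <= t' -> covered e t (firstn t X) = true -> covered e t' (firstn t' X) = true.
Proof.
  intros L. unfold covered. rewrite !existsb_exists. intros [j [Hj H]]. apply in_seq in Hj.
  exists j. split; [apply in_seq; lia|]. apply (haltb_zeros_mono e t); auto.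
  rewrite firstn_firstn in *. now replace (Nat.min j t') with (Nat.min j t) by lia.
Qed.

(** The sets covered by stage [t] increase with [t], so the union over the good stages is contained
    in that of the last good stage, where the bound has been checked. *)
Lemma covered_good_cnt e m : 2 ^ (e + 3) * cnt m (covered_good e m) <= 2 ^ m.
Proof.
  assert (C : forall T, T <= S m ->
    let B X := existsb (fun t => within_bound e t && covered e t (firstn t X)) (seq 0 T) in
    (forall X, B X = false) \/
    exists t, t < T /\ within_bound e t = true /\ forall X, B X = true -> covered e t (firstn t X) = true).
  { induction T as [|T IH]; intros L; [left; reflexivity|]. cbn zeta. rewrite seq_S. cbn [plus].
    setoid_rewrite existsb_app. cbn [existsb]. setoid_rewrite orb_false_r.
    destruct (within_bound e T) eqn:G; cbn [andb].
    - right. exists T. split; [lia|]. split; auto. intros X H. apply orb_true_iff in H as [H|H]; auto.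
      apply existsb_exists in H as [t [Ht H]]. apply in_seq in Ht. apply andb_true_iff in H as [_ H].
      apply (covered_mono e t); auto. lia.
    - setoid_rewrite orb_false_r. destruct IH as [IH|[t [Lt IH]]]; [lia|auto|]. right. exists t. split; auto. }
  destruct (C (S m) (le_n _)) as [H|[t [L [G H]]]].
  - unfold covered_good. rewrite cnt_none by auto. lia.
  - apply Nat.leb_le in G.
    assert (E : 2 ^ t * cnt m (covered_good e m) <= 2 ^ m * cnt t (covered e t))
      by (apply cnt_shrink; [lia|auto]).
    assert (P : 0 < 2 ^ t) by (apply Nat.neq_0_lt_0, Nat.pow_nonzero; lia). nia.
Qed.

Lemma univ_test_cnt m : 4 * cnt m univ_test <= 2 ^ m.
Proof.
  (* Cleared of denominators: the first [k] components have total measure at most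
     [1/8 + ... + 2^-(k+2) = 1/4 - 2^-(k+2)]. *)
  assert (H : forall k, 2 ^ (k + 2) * cnt m (fun X => existsb (fun e => covered_good e m X) (seq 0 k)) + 2 ^ m
               <= 2 ^ m * 2 ^ k).
  { induction k as [|k IH]; [cbn [seq existsb]; rewrite cnt_const; cbn; lia|].
    rewrite seq_S. cbn [plus].
    pose proof (cnt_or m (fun X => existsb (fun e => covered_good e m X) (seq 0 k)) (covered_good k m)) as O.
    rewrite (cnt_ext m _ (fun X => existsb (fun e => covered_good e m X) (seq 0 k) || covered_good k m X)).
    2:{ intros s _. rewrite existsb_app. cbn [existsb]. now rewrite orb_false_r. }
    pose proof (covered_good_cnt k m) as G. replace (k + 3) with (S (k + 2)) in G by lia.
    replace (S k + 2) with (S (k + 2)) by lia. cbn [Nat.pow] in *.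
    set (c := cnt m (fun s => _ || _)) in *. set (a := cnt m (fun X => existsb _ _)) in *.
    set (b := cnt m (covered_good k m)) in *. clearbody a b c. nia. }
  specialize (H m).
  rewrite (cnt_ext m univ_test (fun X => existsb (fun e => covered_good e m X) (seq 0 m))).
  2:{ intros s L. unfold univ_test. now rewrite L. }
  rewrite Nat.pow_add_r in H. assert (P : 0 < 2 ^ m) by (apply Nat.neq_0_lt_0, Nat.pow_nonzero; lia).
  change (2 ^ 2) with 4 in H. nia.
Qed.

Lemma univ_test_mono X r : univ_test X = true -> univ_test (X ++ r) = true.
Proof.
  unfold univ_test. rewrite !existsb_exists. intros [e [He H]]. apply in_seq in He. rewrite length_app.
  exists e. split; [apply in_seq; lia|]. unfold covered_good in *. apply existsb_exists in H as [t [Ht H]].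
  apply in_seq in Ht. apply existsb_exists. exists t. split; [apply in_seq; lia|].
  rewrite firstn_app. replace (t - length X) with 0 by lia. cbn [firstn]. now rewrite app_nil_r.
Qed.

(** If [Y] met the component of index [code e0 + 3] of a test, the universal test would cover [Y] at
    a late stage, because a genuine test is never frozen. *)
Lemma ML_random_of_univ_test Y : (forall m, univ_test (restr Y m) = false) -> ML_random Y.
Proof.
  intros HY U [[e0 He] Hm]. exists (code e0 + 3). intros s HU HC.
  set (n := code e0 + 3) in *.
  pose proof (proj1 (He n s) HU) as [v Hv]. apply evalb_complete in Hv as [t0 Ht].
  (* Late enough for the membership of [s] to be seen, for [s] to fit into the initial segment of
     length [t], and for [code e0] to be among the indices examined. *)
  set (t := t0 + length s + S (code e0)).
  specialize (HY t). apply not_true_iff_false in HY. apply HY.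
  unfold univ_test. rewrite restr_length. apply existsb_exists. exists (code e0).
  split; [apply in_seq; lia|]. unfold covered_good. apply existsb_exists. exists t. split; [apply in_seq; lia|].
  apply andb_true_iff. split.
  (* The strings of length at most [t] found by stage [t] form a finite subfamily, to which the
     measure condition of [ML_test] applies. *)
  - unfold within_bound. apply Nat.leb_le. fold n.
    rewrite (cnt_ext t _ (fun X => existsb (fun s => prefixb s X)
       (filter (fun s => haltb (code e0) (zeros t) [n; code_str s]) (flat_map all_strings (seq 0 (S t)))))).
    + apply Hm. intros s' Hs. apply filter_In in Hs as [H1 H2]. apply in_flat_map in H1 as [j [Hj H1]].
      apply in_seq in Hj. apply in_all_strings in H1. split; [|lia].
      apply He. apply haltb_spec in H2 as [y Hy]. exists y.
      apply (evalb_sound _ _ _ _ _ (zeros_cyl t) Hy).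
    + intros X LX. apply eq_true_iff_eq. unfold covered. rewrite !existsb_exists. fold n. split.
      * intros [j [Hj H]]. apply in_seq in Hj. exists (firstn j X). split.
        -- apply filter_In. split; auto. apply in_flat_map. exists j. split; [apply in_seq; lia|].
           apply in_all_strings. rewrite length_firstn. lia.
        -- apply prefixb_spec. exists (skipn j X). now rewrite firstn_skipn.
      * intros [s' [H1 H2]]. apply filter_In in H1 as [H1 H3]. apply prefixb_firstn in H2 as [H2 L2].
        exists (length s'). split; [apply in_seq; lia|]. now rewrite <- H2.
  - rewrite firstn_all2 by (rewrite restr_length; auto). unfold covered. apply existsb_exists.
    exists (length s). split; [apply in_seq; lia|]. rewrite firstn_restr by lia.
    apply cyl_restr in HC. rewrite <- HC. apply haltb_spec. exists v.
    apply Ht; [apply zeros_cyl|]. rewrite zeros_length. lia.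
Qed.

Lemma CF_zeros (X : nat -> bool) {T} {ET : Enc T} (t : T -> nat) : CF X t -> CF X (fun x => zeros (t x)).
Proof. intros. unfold zeros. cf. Qed.

Ltac cf_user3 :=
  lazymatch goal with
  | |- CF _ (fun x => zeros _) => refine (CF_zeros _ _ _)
  | |- CF _ (fun x => cnt _ _) => refine (CF_cnt _ _ _ _ _)
  | |- _ => cf_user2
  end.
Ltac cf_user ::= cf_user3.

Lemma CF_covered (X : nat -> bool) {T} {ET : Enc T} e t s :
  CF X e -> CF X t -> CF X s -> CF X (fun x : T => covered (e x) (t x) (s x)).
Proof.
  intros. apply (CF_comp X (fun p : nat * (nat * list bool) => covered (fst p) (fst (snd p)) (snd (snd p)))
    (fun x => (e x, (t x, s x)))); [unfold covered|]; cf.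
Qed.

Lemma CF_univ_test (X : nat -> bool) {T} {ET : Enc T} s : CF X s -> CF X (fun x : T => univ_test (s x)).
Proof.
  apply (CF_comp X univ_test). unfold univ_test, covered_good, within_bound. cf; apply CF_covered; cf.
Qed.

(** * The construction *)

(* [(q, (a, k))]: the level uses the follower [follower i q k] and last started afresh at stage [q]; [a] is
   [0] until the level acts, and [S t] if it acted at stage [t]. *)
Notation cond := (nat * (nat * nat))%type.
Notation level := (nat * (nat * nat) * list bool)%type.
Notation error := (nat * list bool)%type.

Definition dcond : cond := (0, (0, 0)).
Definition dlevel : level := (dcond, []).

(** The components can be read off again: the first gives the level, hence the set that the number
    may enter, and the last is the number whose entry into [D] permits it. *)
Definition follower (i q k : nat) : nat := to_nat (i, to_nat (q, k)).

(* Classes at stage [s] are given by strings of this length, which bounds the lengths of all the strings in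
   use at that stage. *)
Definition resolution (s : nat) : nat := 3 + to_nat (s, s).

(** [n <? length X] ensures that only finitely many followers can be realised at a given resolution.
    [0 <? i] leaves level [0] without a task. *)
Definition outputs_zero (i n : nat) (X : list bool) : bool :=
  (0 <? i) && (n <? length X) && evalb (Nat.div2 (i - 1)) X [n] 0.

(** Before an action the condition is to avoid output zero, which becomes stricter as [X] grows. An
    action at stage [t] is recorded as [S t]; from then on only the bits below [resolution t] are
    read, so that the condition is clopen and fixed. *)
Definition condok (i : nat) (c : cond) (X : list bool) : bool :=
  if fst (snd c) =? 0 then negb (outputs_zero i (follower i (fst c) (snd (snd c))) X)
  else outputs_zero i (follower i (fst c) (snd (snd c))) (firstn (resolution (fst (snd c) - 1)) X).

Definition in_class (E : list error) (cs : list cond) (p : nat) (X : list bool) : bool :=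
  negb (univ_test X) &&
  forallb (fun e => negb (Nat.even (fst e + p) && prefixb (snd e) X)) E &&
  forallb (fun j => negb (Nat.even (j + p)) || condok j (nth j cs dcond) X) (seq 0 (length cs)).

Definition parent_rho (acc : list level) : list bool :=
  if 2 <=? length acc then snd (nth (length acc - 2) acc dlevel) else [].

Definition lower (acc : list level) : list level := firstn (length acc - 1) acc.

(* The lower levels of the parity of level [length acc] are those of [lower acc], since the level just below
   has the other parity. *)
Definition in_parent_class (E : list error) (acc : list level) (X : list bool) : bool :=
  prefixb (parent_rho acc) X && in_class E (map fst (lower acc)) (length acc) X.

(** The exponent of the guaranteed measure. The initial [1] is the half left by the test and the
    errors; each level then costs a factor [2] for its condition and the length of its string. *)
Definition weight (acc : list level) : nat :=
  fold_right (fun l r => S (length (snd l)) + r) 1 acc.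

Definition parent_weight (acc : list level) : nat := weight (lower acc).

(** The part of the class that avoids output zero has measure below half the guaranteed [2^-w].
    Stated as an upper bound, it survives the shrinking of the class. *)
Definition realised (s : nat) (E : list error) (acc : list level) (q k : nat) : bool :=
  2 ^ S (parent_weight acc) *
    cnt (resolution s) (fun X => in_parent_class E acc X &&
      negb (outputs_zero (length acc) (follower (length acc) q k) X))
  <? 2 ^ resolution s.

Definition first_unrealised (s : nat) (E : list error) (acc : list level) (q : nat) : nat :=
  hd 0 (filter (fun k => negb (realised s E acc q k)) (seq 0 (S (resolution s)))).

(* Injective in [i] and the number of errors of index [<= i]; this makes the error strings pairwise distinct
   in length. *)
Definition rho_len (E : list error) (i : nat) : nat :=
  3 + to_nat (length (filter (fun e => fst e <=? i) E), i).

(** The string keeps its fair share: of a class of measure at least [2^-(w+1)], some string of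
    length [l] must keep [2^-(w+1+l)]. *)
Definition rho_ok (s : nat) (E : list error) (acc : list level) (c : cond) (t : list bool) : bool :=
  2 ^ resolution s <=? 2 ^ (parent_weight acc + 1 + length t) *
    cnt (resolution s) (fun X => prefixb t X && (in_parent_class E acc X && condok (length acc) c X)).

Definition new_rho (s : nat) (E : list error) (acc : list level) (c : cond) : list bool :=
  hd [] (filter (rho_ok s E acc c) (all_strings (rho_len E (length acc)))).

(* The string of the level just below is left out of the comparison, because it changes when this level acts. *)
Definition same_below (old acc : list level) : bool :=
  (length acc <? length old) &&
  eqE (map fst (firstn (length acc) old)) (map fst acc) &&
  eqE (firstn (length acc - 1) old) (lower acc).

Definition fresh_cond (s : nat) (E : list error) (acc : list level) (q : nat) : cond :=
  (q, (0, first_unrealised s E acc q)).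

(** A level that has acted keeps its condition while nothing relevant below changes. Otherwise the
    index is recomputed, and the stamp survives only if the string just below is unchanged too; thus
    a stamp ties the followers to one such string. *)
Definition new_cond (s : nat) (E : list error) (old acc : list level) : cond :=
  if same_below old acc then
    if fst (snd (fst (nth (length acc) old dlevel))) =? 0 then
      fresh_cond s E acc (if eqE (firstn (length acc) old) acc then fst (fst (nth (length acc) old dlevel)) else s)
    else fst (nth (length acc) old dlevel)
  else fresh_cond s E acc s.

(** All strings are recomputed from the bottom at each stage; [old] only carries the conditions over
    and serves to detect changes. *)
Definition build (s : nat) (E : list error) (old : list level) (n : nat) : list level :=
  nat_rect (fun _ => list level) []
    (fun _ acc => acc ++ [(new_cond s E old acc, new_rho s E acc (new_cond s E old acc))]) n.

Section Construction.
Variable d : nat.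

Definition inD (s k : nat) : bool := (k <? s) && haltb d (zeros s) [k].

Definition permitted (s K : nat) : list nat :=
  filter (fun k => inD (S s) k && negb (inD s k)) (seq 0 K).

(** The index is the first unrealised one, so every number below it that enters [D] belongs to a
    realised follower. *)
Definition can_act (s : nat) (lv : list level) (i : nat) : bool :=
  (fst (snd (fst (nth i lv dlevel))) =? 0) &&
  (0 <? length (permitted s (snd (snd (fst (nth i lv dlevel)))))).

(* [0] when no level acts; level [0] never does. *)
Definition actor (s : nat) (lv : list level) : nat :=
  hd 0 (filter (can_act s lv) (seq 1 (length lv - 1))).

Definition actor_index (s : nat) (lv : list level) : nat :=
  hd 0 (permitted s (snd (snd (fst (nth (actor s lv) lv dlevel))))).

Notation state := (list level * (list error * list nat))%type.

(* The levels above the acting one are dropped, so that they start afresh at the next stage. *)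
Definition old_of (s : nat) (lv : list level) : list level :=
  if actor s lv =? 0 then lv
  else firstn (actor s lv) lv ++
    [((fst (fst (nth (actor s lv) lv dlevel)), (S s, actor_index s lv)), [])].

Definition errs_of (s : nat) (lv : list level) (E : list error) : list error :=
  if actor s lv =? 0 then E
  else (actor s lv - 1, snd (nth (actor s lv - 1) lv dlevel)) :: E.

Definition log_of (s : nat) (lv : list level) (l : list nat) : list nat :=
  if actor s lv =? 0 then l
  else follower (actor s lv) (fst (fst (nth (actor s lv) lv dlevel))) (actor_index s lv) :: l.

Definition step (s : nat) (st : state) : state :=
  (build (S s) (errs_of s (fst st) (fst (snd st))) (old_of s (fst st)) (S s),
   (errs_of s (fst st) (fst (snd st)), log_of s (fst st) (snd (snd st)))).

Definition state_at (s : nat) : state := nat_rect (fun _ => state) ([], ([], [])) step s.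

End Construction.

(** * Computability of the construction *)

Section CFC.
Variable X : nat -> bool.

Lemma CF_follower {T} {ET : Enc T} i q k : CF X i -> CF X q -> CF X k ->
  CF X (fun x : T => follower (i x) (q x) (k x)).
Proof. intros. unfold follower. cf. Qed.

Lemma CF_resolution {T} {ET : Enc T} s : CF X s -> CF X (fun x : T => resolution (s x)).
Proof. intros. unfold resolution. cf. Qed.

Lemma CF_outputs_zero {T} {ET : Enc T} i n s : CF X i -> CF X n -> CF X s ->
  CF X (fun x : T => outputs_zero (i x) (n x) (s x)).
Proof. intros. unfold outputs_zero. cf. Qed.
End CFC.

Ltac cf_user4 :=
  lazymatch goal with
  | |- CF _ (fun x => follower _ _ _) => refine (CF_follower _ _ _ _ _ _ _)
  | |- CF _ (fun x => resolution _) => refine (CF_resolution _ _ _)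
  | |- CF _ (fun x => outputs_zero _ _ _) => refine (CF_outputs_zero _ _ _ _ _ _ _)
  | |- CF _ (fun x => univ_test _) => refine (CF_univ_test _ _ _)
  | |- _ => cf_user3
  end.
Ltac cf_user ::= cf_user4.

Section CFC2.
Variable X : nat -> bool.

Lemma CF_condok {T} {ET : Enc T} i c s : CF X i -> CF X c -> CF X s ->
  CF X (fun x : T => condok (i x) (c x) (s x)).
Proof. intros. unfold condok. cf. Qed.

Lemma CF_parent_rho {T} {ET : Enc T} a : CF X a -> CF X (fun x : T => parent_rho (a x)).
Proof. intros. unfold parent_rho. cf. Qed.

Lemma CF_lower {T} {ET : Enc T} a : CF X a -> CF X (fun x : T => lower (a x)).
Proof. intros. unfold lower. cf. Qed.

Lemma CF_weight {T} {ET : Enc T} a : CF X a -> CF X (fun x : T => weight (a x)).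
Proof. intros. unfold weight. cf. Qed.

Lemma CF_rho_len {T} {ET : Enc T} E i : CF X E -> CF X i -> CF X (fun x : T => rho_len (E x) (i x)).
Proof.
  intros. apply (CF_comp X (fun p : list error * nat => rho_len (fst p) (snd p)) (fun x => (E x, i x)));
    [unfold rho_len|]; cf.
Qed.

End CFC2.

Ltac cf_user5 :=
  lazymatch goal with
  | |- CF _ (fun x => condok _ _ _) => refine (CF_condok _ _ _ _ _ _ _)
  | |- CF _ (fun x => parent_rho _) => refine (CF_parent_rho _ _ _)
  | |- CF _ (fun x => lower _) => refine (CF_lower _ _ _)
  | |- CF _ (fun x => weight _) => refine (CF_weight _ _ _)
  | |- CF _ (fun x => rho_len _ _) => refine (CF_rho_len _ _ _ _ _)
  | |- _ => cf_user4
  end.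
Ltac cf_user ::= cf_user5.

Section CFC3.
Variable X : nat -> bool.

Lemma CF_in_class {T} {ET : Enc T} E cs p s : CF X E -> CF X cs -> CF X p -> CF X s ->
  CF X (fun x : T => in_class (E x) (cs x) (p x) (s x)).
Proof.
  intros. apply (CF_comp X (fun p : list error * (list cond * (nat * list bool)) =>
     in_class (fst p) (fst (snd p)) (fst (snd (snd p))) (snd (snd (snd p))))
     (fun x => (E x, (cs x, (p x, s x))))); [unfold in_class|]; cf.
Qed.

Lemma CF_in_parent_class {T} {ET : Enc T} E a s : CF X E -> CF X a -> CF X s ->
  CF X (fun x : T => in_parent_class (E x) (a x) (s x)).
Proof.
  intros. unfold in_parent_class. cf. apply CF_in_class; cf.
Qed.

Lemma CF_realised {T} {ET : Enc T} s E a q k :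
  CF X s -> CF X E -> CF X a -> CF X q -> CF X k ->
  CF X (fun x : T => realised (s x) (E x) (a x) (q x) (k x)).
Proof.
  intros. apply (CF_comp X (fun p : nat * (list error * (list level * (nat * nat))) =>
     realised (fst p) (fst (snd p)) (fst (snd (snd p))) (fst (snd (snd (snd p)))) (snd (snd (snd (snd p)))))
     (fun x => (s x, (E x, (a x, (q x, k x)))))); [unfold realised, parent_weight|]; cf.
  apply CF_in_parent_class; cf.
Qed.

Lemma CF_first_unrealised {T} {ET : Enc T} s E a q :
  CF X s -> CF X E -> CF X a -> CF X q ->
  CF X (fun x : T => first_unrealised (s x) (E x) (a x) (q x)).
Proof.
  intros. apply (CF_comp X (fun p : nat * (list error * (list level * nat)) =>
     first_unrealised (fst p) (fst (snd p)) (fst (snd (snd p))) (snd (snd (snd p))))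
     (fun x => (s x, (E x, (a x, q x))))); [unfold first_unrealised|]; cf.
  apply CF_realised; cf.
Qed.

Lemma CF_rho_ok {T} {ET : Enc T} s E a c t :
  CF X s -> CF X E -> CF X a -> CF X c -> CF X t ->
  CF X (fun x : T => rho_ok (s x) (E x) (a x) (c x) (t x)).
Proof.
  intros. apply (CF_comp X (fun p : nat * (list error * (list level * (cond * list bool))) =>
     rho_ok (fst p) (fst (snd p)) (fst (snd (snd p))) (fst (snd (snd (snd p)))) (snd (snd (snd (snd p)))))
     (fun x => (s x, (E x, (a x, (c x, t x)))))); [unfold rho_ok, parent_weight|]; cf.
  apply CF_in_parent_class; cf.
Qed.

Lemma CF_new_rho {T} {ET : Enc T} s E a c :
  CF X s -> CF X E -> CF X a -> CF X c ->
  CF X (fun x : T => new_rho (s x) (E x) (a x) (c x)).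
Proof.
  intros. apply (CF_comp X (fun p : nat * (list error * (list level * cond)) =>
     new_rho (fst p) (fst (snd p)) (fst (snd (snd p))) (snd (snd (snd p))))
     (fun x => (s x, (E x, (a x, c x))))); [unfold new_rho|]; cf.
  apply CF_rho_ok; cf.
Qed.

Lemma CF_new_cond {T} {ET : Enc T} s E o a :
  CF X s -> CF X E -> CF X o -> CF X a ->
  CF X (fun x : T => new_cond (s x) (E x) (o x) (a x)).
Proof.
  intros. unfold new_cond, fresh_cond, same_below. cf; apply CF_first_unrealised; cf.
Qed.

Lemma CF_build {T} {ET : Enc T} s E o n :
  CF X s -> CF X E -> CF X o -> CF X n ->
  CF X (fun x : T => build (s x) (E x) (o x) (n x)).
Proof.
  intros. apply (CF_comp X (fun p : nat * (list error * (list level * nat)) =>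
     build (fst p) (fst (snd p)) (fst (snd (snd p))) (snd (snd (snd p))))
     (fun x => (s x, (E x, (o x, n x))))); [unfold build|]; cf.
  all: try apply CF_new_rho; cf; apply CF_new_cond; cf.
Qed.

Variable d : nat.

Lemma CF_inD {T} {ET : Enc T} s k : CF X s -> CF X k -> CF X (fun x : T => inD d (s x) (k x)).
Proof. intros. unfold inD. cf. Qed.

Lemma CF_permitted {T} {ET : Enc T} s k : CF X s -> CF X k -> CF X (fun x : T => permitted d (s x) (k x)).
Proof.
  intros. apply (CF_comp X (fun p : nat * nat => permitted d (fst p) (snd p)) (fun x => (s x, k x)));
    [unfold permitted|]; cf; apply CF_inD; cf.
Qed.

Lemma CF_actor {T} {ET : Enc T} s l : CF X s -> CF X l -> CF X (fun x : T => actor d (s x) (l x)).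
Proof.
  intros. apply (CF_comp X (fun p : nat * list level => actor d (fst p) (snd p)) (fun x => (s x, l x)));
    [unfold actor, can_act|]; cf; apply CF_permitted; cf.
Qed.

End CFC3.

Ltac cf_user6 :=
  lazymatch goal with
  | |- CF _ (fun x => inD _ _ _) => refine (CF_inD _ _ _ _ _ _)
  | |- CF _ (fun x => permitted _ _ _) => refine (CF_permitted _ _ _ _ _ _)
  | |- CF _ (fun x => actor _ _ _) => refine (CF_actor _ _ _ _ _ _)
  | |- CF _ (fun x => build _ _ _ _) => refine (CF_build _ _ _ _ _ _ _ _ _)
  | |- _ => cf_user5
  end.
Ltac cf_user ::= cf_user6.

Lemma CF_state_at (X : nat -> bool) (d : nat) {T} {ET : Enc T} s :
  CF X s -> CF X (fun x : T => state_at d (s x)).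
Proof.
  apply (CF_comp X (state_at d)). unfold state_at, step, errs_of, old_of, log_of, actor_index. cf.
Qed.

(** * Measure bounds at one stage *)

Lemma pow2_pos n : 0 < 2 ^ n.
Proof. apply Nat.neq_0_lt_0, Nat.pow_nonzero. lia. Qed.

Lemma cnt_shrink_lt W m n P Q : m <= n ->
  (forall X, length X = n -> Q X = true -> P (firstn m X) = true) ->
  W * cnt m P < 2 ^ m -> W * cnt n Q < 2 ^ n.
Proof.
  intros L H. pose proof (cnt_shrink m n P Q L H) as C.
  pose proof (pow2_pos m). pose proof (pow2_pos n).
  set (x := cnt m P) in *. set (y := cnt n Q) in *. clearbody x y. clear H.
  set (M := 2 ^ m) in *. set (N := 2 ^ n) in *. clearbody M N. intros H.
  assert (M * (W * y) <= N * (W * x)) by nia. assert (N * (W * x) < N * M) by nia. nia.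
Qed.

Lemma to_nat_mono a b a' b' : a <= a' -> b <= b' -> to_nat (a, b) <= to_nat (a', b').
Proof.
  intros. change (b + tri (b + a) <= b' + tri (b' + a')).
  pose proof (tri_mono (b + a) (b' + a')). lia.
Qed.

Lemma resolution_mono s t : s <= t -> resolution s <= resolution t.
Proof. intros. unfold resolution. pose proof (to_nat_mono s s t t). lia. Qed.

Lemma follower_inj i q k i' q' k' : follower i q k = follower i' q' k' -> i = i' /\ q = q' /\ k = k'.
Proof.
  unfold follower. intros H. apply to_nat_inj in H. injection H as -> H.
  apply to_nat_inj in H. injection H as -> ->. auto.
Qed.

Lemma follower_bounds i q k : i <= follower i q k /\ q <= follower i q k /\ k <= follower i q k.
Proof.
  unfold follower. pose proof (le_to_nat i (to_nat (q, k))). pose proof (le_to_nat q k). lia.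
Qed.

Lemma hd_filter_in {A} (p : A -> bool) d l : (exists x, In x l /\ p x = true) ->
  In (hd d (filter p l)) l /\ p (hd d (filter p l)) = true.
Proof.
  intros [x Hx]. apply filter_In in Hx. apply filter_In.
  destruct (filter p l); [destruct Hx|now left].
Qed.

Lemma hd_filter_seq p a n : (exists k, a <= k < a + n /\ p k = true) ->
  let m := hd 0 (filter p (seq a n)) in
  a <= m < a + n /\ p m = true /\ forall k, a <= k < m -> p k = false.
Proof.
  revert a. induction n as [|n IH]; intros a [k [Hk Hp]]; [lia|]. cbn [seq filter].
  destruct (p a) eqn:E; cbn [hd].
  - split; [lia|]. split; auto. lia.
  - destruct (IH (S a)) as [H1 [H2 H3]].
    { exists k. split; auto. assert (k <> a) by congruence. lia. }
    cbn zeta. split; [lia|]. split; auto. intros j Hj.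
    destruct (Nat.eq_dec j a) as [->|N]; auto. apply H3. lia.
Qed.

Lemma outputs_zero_firstn i n m X : outputs_zero i n (firstn m X) = true -> outputs_zero i n X = true.
Proof.
  unfold outputs_zero. rewrite !andb_true_iff, !Nat.ltb_lt, length_firstn. intros [[H1 H2] H3].
  repeat split; auto; [lia|]. rewrite <- (firstn_skipn m X). now apply evalb_mono.
Qed.

Lemma prefixb_trans a b c : prefixb a b = true -> prefixb b c = true -> prefixb a c = true.
Proof. rewrite !prefixb_spec. intros [r ->] [t ->]. exists (r ++ t). now rewrite app_assoc. Qed.

Lemma prefixb_firstn_l a m X : prefixb a (firstn m X) = true -> prefixb a X = true.
Proof.
  intros H. apply (prefixb_trans _ _ _ H). apply prefixb_spec. exists (skipn m X). now rewrite firstn_skipn.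
Qed.

Lemma prefixb_linear a b c : prefixb a c = true -> prefixb b c = true -> length a <= length b ->
  prefixb a b = true.
Proof.
  rewrite !prefixb_firstn. intros [Ha La] [Hb Lb] L. split; auto.
  rewrite Hb, firstn_firstn, Nat.min_l by lia. exact Ha.
Qed.

Lemma univ_test_firstn m X : univ_test (firstn m X) = true -> univ_test X = true.
Proof. intros H. rewrite <- (firstn_skipn m X). now apply univ_test_mono. Qed.

(** Truncation cannot create an output, and an acted condition does not look beyond the bits that
    are kept. *)
Lemma condok_shrink i c m X : fst (snd c) = 0 \/ resolution (fst (snd c) - 1) <= m ->
  condok i c X = true -> condok i c (firstn m X) = true.
Proof.
  unfold condok. intros L. destruct (Nat.eqb_spec (fst (snd c)) 0) as [E|E].
  - rewrite !negb_true_iff, <- !not_true_iff_false. intros H H'. apply H. now apply (outputs_zero_firstn _ _ m).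
  - rewrite firstn_firstn. rewrite Nat.min_l by lia. auto.
Qed.

Lemma in_class_spec E cs p X : in_class E cs p X = true <->
  univ_test X = false /\ (forall e, In e E -> Nat.even (fst e + p) = true -> prefixb (snd e) X = false) /\
  (forall j, j < length cs -> Nat.even (j + p) = true -> condok j (nth j cs dcond) X = true).
Proof.
  unfold in_class. rewrite andb3, negb_true_iff, !forallb_forall. setoid_rewrite in_seq.
  setoid_rewrite orb_true_iff. setoid_rewrite negb_true_iff. setoid_rewrite andb_false_iff.
  repeat apply and_iff_compat_l.
  split; intros [H1 H2]; split.
  - intros e He P. destruct (H1 e He); congruence.
  - intros j Hj P. destruct (H2 j ltac:(lia)); congruence.
  - intros e He. destruct (Nat.even (fst e + p)) eqn:P; auto.
  - intros j Hj. destruct (Nat.even (j + p)) eqn:P; auto. right. apply H2; auto; lia.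
Qed.

Lemma in_parent_class_spec E acc X : in_parent_class E acc X = true <->
  prefixb (parent_rho acc) X = true /\ in_class E (map fst (lower acc)) (length acc) X = true.
Proof. unfold in_parent_class. apply andb_true_iff. Qed.

(** [l] is the count that [rho_len] used for the string before it became an error; the present count
    is larger because the error itself is included. Later strings of the same index therefore have
    other lengths. *)
Definition errs_ok (s : nat) (E : list error) : Prop :=
  length E <= s /\
  (forall e, In e E -> fst e < s /\ exists l, length (snd e) = 3 + to_nat (l, fst e) /\
     l < length (filter (fun e' => fst e' <=? fst e) E)) /\
  NoDup (map (fun e : error => length (snd e)) E).

Lemma filter_length_le {A} (p : A -> bool) l : length (filter p l) <= length l.
Proof. induction l; cbn; auto. destruct (p a); cbn; lia. Qed.

Lemma errs_ok_length s E e : errs_ok s E -> In e E -> 3 <= length (snd e) <= resolution s.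
Proof.
  intros [H1 [H2 _]] He. destruct (H2 e He) as [L [l [Hl Hc]]].
  pose proof (filter_length_le (fun e' : error => fst e' <=? fst e) E). rewrite Hl. unfold resolution.
  pose proof (to_nat_mono l (fst e) s s). lia.
Qed.

Lemma rho_len_le_resolution s E i : errs_ok s E -> i <= s -> rho_len E i <= resolution s.
Proof.
  intros [H1 _] Hi. unfold rho_len, resolution.
  pose proof (filter_length_le (fun e' : error => fst e' <=? i) E).
  pose proof (to_nat_mono (length (filter (fun e : error => fst e <=? i) E)) i s s). lia.
Qed.

Lemma errs_cnt s E : errs_ok s E ->
  4 * cnt (resolution s) (fun X => existsb (fun e => prefixb (snd e) X) E) <= 2 ^ resolution s.
Proof.
  intros H. rewrite (cnt_ext (resolution s) _ (fun X => existsb (fun t => prefixb t X) (map snd E))).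
  2:{ intros X _. induction E as [|e E' IH] in |- *; cbn; auto. now rewrite IH. }
  apply (cnt_distinct_lengths (resolution s) 2).
  - rewrite map_map. apply H.
  - intros t Ht. apply in_map_iff in Ht as [e [<- He]]. now apply (errs_ok_length s E).
Qed.

Lemma weight_app a b : weight (a ++ [b]) = weight a + S (length (snd b)).
Proof. unfold weight. induction a; cbn [app fold_right]; lia. Qed.

Lemma firstn_S_nth {A} i (l : list A) d : i < length l -> firstn (S i) l = firstn i l ++ [nth i l d].
Proof.
  revert l. induction i as [|i IH]; intros [|a l] L; cbn in L; try lia; cbn; auto.
  f_equal. apply IH. lia.
Qed.

Lemma weight_firstn_mono a i j : i <= j -> weight (firstn i a) <= weight (firstn j a).
Proof.
  intros L. revert i j L. induction a as [|b a IH]; intros i j L; [now rewrite !firstn_nil|].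
  destruct i as [|i], j as [|j]; cbn [firstn]; try lia; unfold weight in *; cbn [fold_right].
  - specialize (IH 0 j ltac:(lia)). cbn [firstn fold_right] in IH. lia.
  - specialize (IH i j ltac:(lia)). lia.
Qed.

Lemma nth_map_fst (l : list level) j : nth j (map fst l) dcond = fst (nth j l dlevel).
Proof. apply (map_nth fst l dlevel). Qed.

Lemma nth_firstn_lt {A} i j (l : list A) d : i < j -> nth i (firstn j l) d = nth i l d.
Proof. revert i l. induction j; intros [|i] [|a l] L; cbn; try lia; auto. apply IHj. lia. Qed.

Lemma even_add_S2 j p : Nat.even (j + S (S p)) = Nat.even (j + p).
Proof. now rewrite !Nat.add_succ_r. Qed.

Section Stage.
Variables (s : nat) (E : list error).
Hypothesis HE : errs_ok s E.

Definition rho_good (lv : list level) (j : nat) : Prop :=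
  rho_ok s E (firstn j lv) (fst (nth j lv dlevel)) (snd (nth j lv dlevel)) = true.

(** Levels [0] and [1] have the whole space minus test and errors. From level [2] on, the bound is
    inherited from [rho_ok] two levels down, where the string and the condition have been paid for
    by the weight. *)
Lemma parent_measure lv i : i <= length lv ->
  (forall j, j < i -> rho_good lv j) ->
  2 ^ resolution s <= 2 ^ parent_weight (firstn i lv) * cnt (resolution s) (in_parent_class E (firstn i lv)).
Proof.
  intros L H. assert (Li : length (firstn i lv) = i) by (rewrite length_firstn; lia).
  destruct i as [|[|j]].
  1, 2: assert (B : lower (firstn 0 lv) = [] /\ lower (firstn 1 lv) = [])
      by (unfold lower; now destruct lv);
    unfold parent_weight; rewrite ?(proj1 B), ?(proj2 B); change (weight []) with 1;
    set (acc := firstn _ lv) in *;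
    assert (E0 : parent_rho acc = []) by (unfold parent_rho; now rewrite Li);
    assert (C : 2 ^ resolution s <= cnt (resolution s) (in_parent_class E acc) +
       cnt (resolution s) (fun X => univ_test X || existsb (fun e => prefixb (snd e) X) E));
    [ rewrite <- (cnt_const (resolution s) true), (cnt_split _ (fun _ => true) (in_parent_class E acc));
      cbn [andb];
      apply Nat.add_le_mono_l, cnt_le; intros X _ HX;
      apply negb_true_iff in HX; apply not_true_iff_false in HX;
      destruct (univ_test X) eqn:Hr; auto; cbn [orb]; apply not_false_iff_true; intros He; apply HX;
      apply in_parent_class_spec; rewrite E0; split; auto; apply in_class_spec; split; auto;
      rewrite ?(proj1 B), ?(proj2 B); split; [|intros j Hj; cbn in Hj; lia];
      intros e Hin _; apply not_true_iff_false; intros Hp;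
      apply not_true_iff_false in He; apply He, existsb_exists; eauto
    | pose proof (cnt_or (resolution s) univ_test (fun X => existsb (fun e => prefixb (snd e) X) E));
      pose proof (univ_test_cnt (resolution s)); pose proof (errs_cnt s E HE); cbn [Nat.pow]; lia ].
  assert (Hj := H j ltac:(lia)). unfold rho_good, rho_ok in Hj. apply Nat.leb_le in Hj.
  set (acc := firstn (S (S j)) lv) in *.
  assert (Lj : length (firstn j lv) = j) by (rewrite length_firstn; lia).
  assert (Elow : lower acc = firstn (S j) lv).
  { unfold lower. rewrite Li. unfold acc. rewrite firstn_firstn. f_equal. lia. }
  assert (Elowj : lower (firstn j lv) = firstn (j - 1) lv).
  { unfold lower. rewrite Lj, firstn_firstn. f_equal. lia. }
  etransitivity; [apply Hj|]. apply Nat.mul_le_mono.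
  - apply Nat.pow_le_mono_r; [lia|]. unfold parent_weight. rewrite Elow, Elowj.
    rewrite (firstn_S_nth j lv dlevel), weight_app by lia.
    pose proof (weight_firstn_mono lv (j - 1) j). lia.
  - apply cnt_le. intros X _ HX. apply andb_true_iff in HX as [H1 HX].
    apply andb_true_iff in HX as [H2 H3]. apply in_parent_class_spec in H2 as [_ H2].
    rewrite Lj, Elowj in *. apply in_class_spec in H2 as [H4 [H5 H6]].
    apply in_parent_class_spec. split.
    { unfold parent_rho. rewrite Li. cbn [Nat.leb Nat.sub]. rewrite Nat.sub_0_r. unfold acc.
      rewrite nth_firstn_lt; auto. }
    rewrite Li, Elow. apply in_class_spec. split; auto. split.
    { intros e He P. apply H5; auto. now rewrite even_add_S2 in P. }
    intros k Hk P. rewrite length_map, length_firstn in Hk. rewrite even_add_S2 in P.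
    rewrite nth_map_fst, nth_firstn_lt by lia.
    (* Level [j] contributes its own condition and level [j - 1] has the other parity; the levels
       below are covered by the parent class of level [j]. *)
    assert (k = j \/ k = j - 1 \/ k < j - 1) as [->|[->|Hl]] by lia; auto.
    + destruct j as [|j]; [exact H3|]. exfalso. replace (S j - 1 + S j) with (S (2 * j)) in P by lia.
      rewrite Nat.even_succ, Nat.odd_mul in P. discriminate.
    + specialize (H6 k). rewrite length_map, length_firstn, nth_map_fst, nth_firstn_lt in H6 by lia.
      apply H6; auto. lia.
Qed.

(** The realisation that justified an action, in terms of the recorded condition. Unlike
    [cond_large] it passes to later stages, being an upper bound on a shrinking set. *)
Definition acted_small (acc : list level) (c : cond) : Prop :=
  2 ^ S (parent_weight acc) *
    cnt (resolution s) (fun X => in_parent_class E acc X && negb (condok (length acc) c X)) < 2 ^ resolution s.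

Definition cond_large (acc : list level) (c : cond) : Prop :=
  2 ^ resolution s <= 2 ^ S (parent_weight acc) *
    cnt (resolution s) (fun X => in_parent_class E acc X && condok (length acc) c X).

(** [2^-w - 2^-(w+1) = 2^-(w+1)]: losing less than half of the guaranteed measure leaves at least
    half. *)
Lemma cond_large_of_small acc c :
  2 ^ resolution s <= 2 ^ parent_weight acc * cnt (resolution s) (in_parent_class E acc) ->
  acted_small acc c -> cond_large acc c.
Proof.
  unfold acted_small, cond_large. rewrite (cnt_split _ (in_parent_class E acc) (condok (length acc) c)).
  cbn [Nat.pow]. nia.
Qed.

(** For a condition that has not acted, to be unrealised is the bound [cond_large] itself; what
    needs proof is that the search for an unrealised index succeeds. *)
Lemma cond_large_fresh acc q :
  2 ^ resolution s <= 2 ^ parent_weight acc * cnt (resolution s) (in_parent_class E acc) ->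
  realised s E acc q (first_unrealised s E acc q) = false /\
  (forall k, k < first_unrealised s E acc q -> realised s E acc q k = true) /\
  cond_large acc (fresh_cond s E acc q).
Proof.
  intros H. unfold first_unrealised.
  destruct (hd_filter_seq (fun k => negb (realised s E acc q k)) 0 (S (resolution s))) as [_ [H2 H3]].
  (* A follower is at least as large as its index, so for index [resolution s] it is not below
     [length X]. No output is then recorded, and the whole class remains. *)
  { exists (resolution s). split; [lia|]. apply negb_true_iff. unfold realised. apply Nat.ltb_ge.
    etransitivity; [apply H|]. apply Nat.mul_le_mono; [apply Nat.pow_le_mono_r; lia|].
    apply cnt_le. intros X LX HX. rewrite HX. cbn [andb]. unfold outputs_zero.
    pose proof (follower_bounds (length acc) q (resolution s)).
    replace (follower (length acc) q (resolution s) <? length X) with false; [now rewrite andb_false_r|].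
    symmetry. apply Nat.ltb_ge. lia. }
  set (k := hd 0 _) in *. apply negb_true_iff in H2.
  split; auto. split.
  - intros k' Hk. apply negb_false_iff, H3. lia.
  - unfold realised in H2. apply Nat.ltb_ge in H2. exact H2.
Qed.

Lemma new_rho_spec acc c : length acc <= s -> cond_large acc c ->
  length (new_rho s E acc c) = rho_len E (length acc) /\ rho_ok s E acc c (new_rho s E acc c) = true.
Proof.
  intros L H. unfold new_rho. set (l := rho_len E (length acc)).
  assert (Ll : l <= resolution s) by (apply rho_len_le_resolution; auto).
  enough (X : exists t, In t (all_strings l) /\ rho_ok s E acc c t = true).
  { apply (hd_filter_in _ []) in X as [X1 X2]. apply in_all_strings in X1. auto. }
  unfold cond_large in H. set (Q := fun X => in_parent_class E acc X && condok (length acc) c X) in *.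
  destruct (existsb (rho_ok s E acc c) (all_strings l)) eqn:Ex; [apply existsb_exists in Ex; auto|].
  exfalso. set (P := 2 ^ (parent_weight acc + 1 + l)).
  assert (HP : 0 < P) by apply pow2_pos.
  (* If every string of length [l] failed, each cylinder would satisfy [P * cnt < 2 ^ resolution s],
     so its count would be at most this quotient; summing over the strings contradicts
     [cond_large]. *)
  pose proof (cnt_bound_prefix l (resolution s) ((2 ^ resolution s - 1) / P) Q Ll) as B.
  assert (B' : cnt (resolution s) Q <= 2 ^ l * ((2 ^ resolution s - 1) / P)).
  { apply B. intros t Ht. apply Nat.div_le_lower_bound; [lia|].
    apply not_true_iff_false in Ex. assert (N : rho_ok s E acc c t <> true).
    { intros N. apply Ex. apply existsb_exists. exists t. split; auto. now apply in_all_strings. }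
    apply not_true_iff_false in N. unfold rho_ok in N. apply Nat.leb_gt in N. rewrite Ht in N.
    fold P in N. unfold Q. lia. }
  assert (D : P * ((2 ^ resolution s - 1) / P) <= 2 ^ resolution s - 1) by (apply Nat.Div0.mul_div_le).
  assert (EP : P = 2 ^ S (parent_weight acc) * 2 ^ l).
  { unfold P. rewrite <- Nat.pow_add_r. f_equal. lia. }
  pose proof (pow2_pos (resolution s)).
  assert (2 ^ S (parent_weight acc) * cnt (resolution s) Q <= P * ((2 ^ resolution s - 1) / P)).
  { rewrite EP at 1. rewrite <- Nat.mul_assoc. now apply Nat.mul_le_mono_l. }
  lia.
Qed.

End Stage.

(** * Unbounded search and stabilisation *)

Lemma least_true (p : nat -> bool) : (exists n, p n = true) ->
  exists n, p n = true /\ forall z, z < n -> p z = false.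
Proof.
  intros [n H]. revert H. induction n as [n IH] using lt_wf_ind. intros H.
  destruct (existsb p (seq 0 n)) eqn:E.
  - apply existsb_exists in E as [m [Hm Hp]]. apply in_seq in Hm. apply (IH m); auto. lia.
  - exists n. split; auto. intros z L. apply not_true_iff_false. intros Hz.
    apply not_true_iff_false in E. apply E, existsb_exists. exists z. split; auto. apply in_seq. lia.
Qed.

Section Search.
Variable X : nat -> bool.
Context {T U : Type} {ET : Enc T} {EU : Enc U}.

Lemma CF_mu_code (p : T * nat -> bool) : CF X p ->
  exists e, forall x,
    (forall n, p (x, n) = true -> (forall z, z < n -> p (x, z) = false) -> eval X e [enc x] n) /\
    (forall v, eval X e [enc x] v -> p (x, v) = true).
Proof.
  intros Hp. assert (H : CF X (fun q => negb (p q))) by cf. destruct H as [ep He].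
  destruct (cfl_to_nat X 2 _ _ (cfl_proj X 2 1) (cfl_proj X 2 0)) as [e2 H2].
  set (f := RComp ep [e2]).
  assert (Hf : forall x n, eval X f [n; enc x] (b2n (negb (p (x, n))))).
  { intros x n. econstructor; [repeat constructor; apply H2; reflexivity|]. exact (He (x, n)). }
  exists (RMu f). intros x. split.
  - intros n Hn Hz. constructor.
    + pose proof (Hf x n) as F. now rewrite Hn in F.
    + intros z L. exists 1. split; [lia|]. pose proof (Hf x z) as F. now rewrite (Hz z L) in F.
  - intros v Hv. inversion Hv; subst.
    match goal with h : eval X f (v :: _) 0 |- _ => pose proof (eval_det _ _ _ _ _ h (Hf x v)) as E end.
    now destruct (p (x, v)).
Qed.

(** Every hit gives the right value, so nothing needs to be known about which hit the search
    finds. *)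
Lemma CF_search (p : T * nat -> bool) (f : T * nat -> U) (g : T -> U) :
  CF X p -> CF X f -> (forall x, exists n, p (x, n) = true) ->
  (forall x n, p (x, n) = true -> f (x, n) = g x) -> CF X g.
Proof.
  intros Hp [ef Hf] Ex Hg. destruct (CF_mu_code p Hp) as [em Hm].
  destruct (cfl_to_nat X 2 _ _ (cfl_proj X 2 0) (cfl_proj X 2 1)) as [e2 H2].
  exists (RComp ef [RComp e2 [RProj 0; em]]). intros x.
  destruct (least_true (fun n => p (x, n)) (Ex x)) as [n [Hn Hz]].
  rewrite <- (Hg x n Hn). econstructor; [|exact (Hf (x, n))].
  constructor; [|constructor]. econstructor; [|exact (H2 [enc x; n] eq_refl)].
  constructor; [constructor|]. constructor; [|constructor]. now apply Hm.
Qed.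
End Search.

Lemma ce_of_CF (p : nat * nat -> bool) (A : set_nat) : CF empty_oracle p ->
  (forall n, A n = true <-> exists s, p (n, s) = true) -> ce A.
Proof.
  intros Hp HA. destruct (CF_mu_code empty_oracle p Hp) as [e He]. exists e. intros n. rewrite HA. split.
  - intros Ex. destruct (least_true (fun s => p (n, s)) Ex) as [s [Hs Hz]]. exists s. now apply He.
  - intros [v Hv]. exists v. now apply He.
Qed.

Lemma CF_oracle (X : nat -> bool) {T} {ET : Enc T} (f : T -> nat) : CF X f -> CF X (fun x => X (f x)).
Proof. apply (CF_comp X X). exists ROracle. intros n. constructor. Qed.

(** Candidates only drop out. Either the first one stays for ever and is the limit, or it is gone
    from some stage on and the rest of the list decides. *)
Lemma hd_filter_stabilises {A} (dflt : A) (p : nat -> A -> bool) l s0 :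
  (forall s x, In x l -> s0 <= s -> p (S s) x = true -> p s x = true) ->
  exists s1, s0 <= s1 /\ forall s, s1 <= s -> hd dflt (filter (p s) l) = hd dflt (filter (p s1) l).
Proof.
  revert s0. induction l as [|x l IH]; intros s0 H; [exists s0; split; auto|].
  destruct (classic (exists s1, s0 <= s1 /\ p s1 x = false)) as [[s1 [L1 F1]]|N].
  - assert (F : forall s, s1 <= s -> p s x = false).
    { induction 1 as [|s L IHs]; auto. apply not_true_iff_false. intros T.
      rewrite H in IHs; [discriminate|now left|lia|auto]. }
    destruct (IH s1) as [s2 [L2 H2]]; [intros; apply H; [now right|lia|auto]|].
    exists s2. split; [lia|]. intros s L. cbn [filter]. rewrite !F by lia. auto.
  - exists s0. split; auto. intros s L. cbn [filter].
    assert (F : forall s, s0 <= s -> p s x = true).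
    { intros s' L'. apply not_false_iff_true. intros F. apply N. eauto. }
    rewrite !F by lia. reflexivity.
Qed.

Lemma mono_bounded_stabilises (f : nat -> nat) s0 B :
  (forall s, s0 <= s -> f s <= f (S s)) -> (forall s, s0 <= s -> f s <= B) ->
  exists s1, s0 <= s1 /\ forall s, s1 <= s -> f s = f s1.
Proof.
  intros M. assert (MM : forall s t, s0 <= s -> s <= t -> f s <= f t).
  { intros s t L. induction 1; auto. etransitivity; [eassumption|]. apply M. lia. }
  revert s0 M MM. induction B as [|B IH]; intros s0 M MM H.
  - exists s0. split; auto. intros s L. specialize (H s L). pose proof (MM s0 s (le_n _) L). lia.
  - destruct (classic (exists s, s0 <= s /\ f s = S B)) as [[s [L E]]|N].
    + exists s. split; auto. intros t Lt. pose proof (MM s t L Lt). pose proof (H t ltac:(lia)). lia.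
    + apply IH; auto. intros s L. specialize (H s L). assert (f s <> S B) by eauto. lia.
Qed.

Lemma cond_eq (c c' : cond) : fst c = fst c' -> fst (snd c) = fst (snd c') ->
  snd (snd c) = snd (snd c') -> c = c'.
Proof. destruct c as [? [? ?]], c' as [? [? ?]]. cbn. now intros -> -> ->. Qed.

Lemma prefixb_nth a b i : prefixb a b = true -> i < length a -> nth i a false = nth i b false.
Proof. rewrite prefixb_spec. intros [r ->] L. now rewrite app_nth1. Qed.

Lemma fst_follower i q k : fst (of_nat (follower i q k)) = i.
Proof. unfold follower. now rewrite cancel_of_to. Qed.

Lemma snd_follower i q k : snd (of_nat (snd (of_nat (follower i q k)))) = k.
Proof. unfold follower. rewrite cancel_of_to. cbn [snd]. now rewrite cancel_of_to. Qed.

Lemma even_add_double j m b : Nat.even (j + (2 * m + b)) = Nat.even (j + b).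
Proof. replace (j + (2 * m + b)) with (j + b + 2 * m) by lia. apply Nat.even_add_mul_2. Qed.

Lemma even_split i b : b <= 1 -> Nat.even (i + b) = true -> exists j, i = 2 * j + b.
Proof.
  intros L H. apply Nat.even_spec in H as [k H]. exists (k - b). lia.
Qed.

(** * The construction through the stages *)

Section Dynamics.
Variable d : nat.

Definition levels (s : nat) : list level := fst (state_at d s).
Definition errs (s : nat) : list error := fst (snd (state_at d s)).
Definition log (s : nat) : list nat := snd (snd (state_at d s)).
Definition act (s : nat) : nat := actor d s (levels s).
Definition act_idx (s : nat) : nat := actor_index d s (levels s).
Definition old (s : nat) : list level := old_of d s (levels s).
Definition lev (s i : nat) : level := nth i (levels s) dlevel.
Definition cnd (s i : nat) : cond := fst (lev s i).
Definition rho (s i : nat) : list bool := snd (lev s i).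
Definition acc (s i : nat) : list level := firstn i (levels s).

Lemma levels_S s : levels (S s) = build (S s) (errs (S s)) (old s) (S s).
Proof. reflexivity. Qed.

Lemma errs_S s : errs (S s) = if act s =? 0 then errs s else (act s - 1, rho s (act s - 1)) :: errs s.
Proof. reflexivity. Qed.

Lemma log_S s : log (S s) = if act s =? 0 then log s
  else follower (act s) (fst (cnd s (act s))) (act_idx s) :: log s.
Proof. reflexivity. Qed.

Lemma build_length s E o n : length (build s E o n) = n.
Proof. unfold build. induction n; cbn [nat_rect]; auto. rewrite length_app, IHn. cbn. lia. Qed.

Lemma build_S s E o n : build s E o (S n) = build s E o n ++
  [(new_cond s E o (build s E o n), new_rho s E (build s E o n) (new_cond s E o (build s E o n)))].
Proof. reflexivity. Qed.

Lemma build_firstn s E o i n : i <= n -> firstn i (build s E o n) = build s E o i.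
Proof.
  induction 1 as [|n L IH].
  - rewrite <- (build_length s E o i) at 1. apply firstn_all.
  - rewrite build_S, firstn_app, build_length. replace (i - n) with 0 by lia.
    cbn [firstn]. now rewrite app_nil_r.
Qed.

Lemma build_nth s E o i n : i < n -> nth i (build s E o n) dlevel =
  (new_cond s E o (build s E o i), new_rho s E (build s E o i) (new_cond s E o (build s E o i))).
Proof.
  intros L. rewrite <- (nth_firstn_lt i (S i)) by lia. rewrite build_firstn by lia.
  rewrite build_S, app_nth2; rewrite build_length; auto. now rewrite Nat.sub_diag.
Qed.

Lemma levels_length s : length (levels s) = s.
Proof. destruct s; [reflexivity|]. rewrite levels_S. apply build_length. Qed.

Lemma acc_length s i : i <= s -> length (acc s i) = i.
Proof. intros. unfold acc. rewrite length_firstn, levels_length. lia. Qed.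

Lemma lev_S s i : i <= s -> lev (S s) i =
  (new_cond (S s) (errs (S s)) (old s) (acc (S s) i),
   new_rho (S s) (errs (S s)) (acc (S s) i) (new_cond (S s) (errs (S s)) (old s) (acc (S s) i))).
Proof.
  intros L. unfold lev, acc. rewrite levels_S, build_nth, build_firstn by lia. reflexivity.
Qed.

Lemma cnd_S s i : i <= s -> cnd (S s) i = new_cond (S s) (errs (S s)) (old s) (acc (S s) i).
Proof. intros L. unfold cnd. now rewrite lev_S. Qed.

Lemma rho_S s i : i <= s -> rho (S s) i = new_rho (S s) (errs (S s)) (acc (S s) i) (cnd (S s) i).
Proof. intros L. unfold rho. rewrite cnd_S by auto. now rewrite lev_S. Qed.

Lemma act_spec s : act s <> 0 -> 1 <= act s < s /\ can_act d s (levels s) (act s) = true.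
Proof.
  unfold act, actor. intros H.
  destruct (filter (can_act d s (levels s)) (seq 1 (length (levels s) - 1))) as [|i l] eqn:Ef; [now cbn in H|].
  cbn [hd]. assert (I : In i (filter (can_act d s (levels s)) (seq 1 (length (levels s) - 1))))
    by (rewrite Ef; now left).
  apply filter_In in I as [I1 I2]. apply in_seq in I1. rewrite levels_length in I1. split; auto. lia.
Qed.

Lemma act_least s i : 1 <= i < s -> can_act d s (levels s) i = true -> act s <> 0 /\ act s <= i.
Proof.
  intros L H. unfold act, actor. rewrite levels_length.
  destruct (hd_filter_seq (can_act d s (levels s)) 1 (s - 1)) as [H1 [H2 H3]].
  { exists i. split; auto. lia. }
  set (j := hd 0 _) in *. split; [lia|]. destruct (le_lt_dec j i) as [|N]; auto.
  rewrite H3 in H; [discriminate|lia].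
Qed.

Lemma act_idx_spec s : act s <> 0 -> fst (snd (cnd s (act s))) = 0 /\
  act_idx s < snd (snd (cnd s (act s))) /\ inD d (S s) (act_idx s) = true /\ inD d s (act_idx s) = false.
Proof.
  intros H. apply act_spec in H as [_ H]. unfold can_act in H. fold (lev s (act s)) in H.
  fold (cnd s (act s)) in H. apply andb_true_iff in H as [H1 H2]. apply Nat.eqb_eq in H1.
  apply Nat.ltb_lt in H2. split; auto.
  unfold act_idx, actor_index. fold (act s). fold (lev s (act s)). fold (cnd s (act s)).
  unfold permitted in *.
  destruct (filter _ (seq 0 (snd (snd (cnd s (act s)))))) as [|k l] eqn:Ef; [cbn in H2; lia|].
  cbn [hd]. assert (I : In k (filter (fun k => inD d (S s) k &&
    negb (inD d s k)) (seq 0 (snd (snd (cnd s (act s)))))))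
    by (rewrite Ef; now left).
  apply filter_In in I as [I1 I2]. apply in_seq in I1. apply andb_true_iff in I2 as [I2 I3].
  apply negb_true_iff in I3. split; auto. lia.
Qed.

Lemma old_length s : length (old s) = if act s =? 0 then s else S (act s).
Proof.
  unfold old, old_of. fold (act s). destruct (Nat.eqb_spec (act s) 0) as [H|H]; [apply levels_length|].
  apply act_spec in H as [H _]. rewrite length_app, length_firstn, levels_length. cbn. lia.
Qed.

Lemma old_length_le s : length (old s) <= s.
Proof.
  rewrite old_length. destruct (Nat.eqb_spec (act s) 0) as [H|H]; [lia|]. apply act_spec in H. lia.
Qed.

Lemma old_firstn s i : i < length (old s) -> firstn i (old s) = acc s i.
Proof.
  rewrite old_length. unfold old, old_of. fold (act s). intros L.
  destruct (Nat.eqb_spec (act s) 0) as [H|H]; [reflexivity|].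
  apply act_spec in H as [H _]. rewrite firstn_app, length_firstn, levels_length.
  replace (i - _) with 0 by lia. cbn [firstn]. rewrite app_nil_r, firstn_firstn.
  unfold acc. f_equal. lia.
Qed.

Lemma old_cond s i : i < length (old s) -> fst (nth i (old s) dlevel) =
  if negb (act s =? 0) && (i =? act s) then (fst (cnd s i), (S s, act_idx s)) else cnd s i.
Proof.
  rewrite old_length. unfold old, old_of. fold (act s). fold (act_idx s). intros L.
  destruct (Nat.eqb_spec (act s) 0) as [H|H]; [reflexivity|]. cbn [negb andb].
  apply act_spec in H as [H _]. destruct (Nat.eqb_spec i (act s)) as [->|N].
  - rewrite app_nth2; rewrite length_firstn, levels_length; [|lia].
    replace (act s - _) with 0 by lia. reflexivity.
  - rewrite app_nth1, nth_firstn_lt; auto; try rewrite length_firstn, levels_length; lia.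
Qed.

Lemma same_below_spec s i : i <= s -> same_below (old s) (acc (S s) i) = true <->
  i < length (old s) /\ map fst (acc s i) = map fst (acc (S s) i) /\ lower (acc s i) = lower (acc (S s) i).
Proof.
  intros L. unfold same_below. rewrite andb3, Nat.ltb_lt, !eqE_spec, acc_length by lia.
  assert (E : forall j, j <= s -> lower (acc s j) = firstn (j - 1) (levels s)).
  { intros j Lj. unfold lower. rewrite acc_length by lia. unfold acc. rewrite firstn_firstn. f_equal. lia. }
  split; intros [H1 [H2 H3]]; (split; [auto|]).
  - rewrite old_firstn in H2, H3 by lia. split; auto. rewrite <- H3. apply E. lia.
  - rewrite !old_firstn by lia. split; auto. rewrite <- H3. symmetry. apply E. lia.
Qed.

(* The level starts afresh, or has acted before, or acts now, or goes on without having acted. *)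
Lemma cnd_step s i : i < s ->
  cnd (S s) i = fresh_cond (S s) (errs (S s)) (acc (S s) i) (S s) \/
  (map fst (acc s i) = map fst (acc (S s) i) /\ lower (acc s i) = lower (acc (S s) i) /\
    ((fst (snd (cnd s i)) <> 0 /\ cnd (S s) i = cnd s i /\ (act s <> 0 -> i < act s)) \/
     (fst (snd (cnd s i)) = 0 /\ act s = i /\ i <> 0 /\ cnd (S s) i = (fst (cnd s i), (S s, act_idx s))) \/
     (fst (snd (cnd s i)) = 0 /\ (act s <> 0 -> i < act s) /\ acc s i = acc (S s) i /\
       cnd (S s) i = fresh_cond (S s) (errs (S s)) (acc (S s) i) (fst (cnd s i))))).
Proof.
  intros L. rewrite cnd_S by lia. unfold new_cond.
  destruct (same_below (old s) (acc (S s) i)) eqn:Sb; [|now left].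
  apply same_below_spec in Sb as [S1 [S2 S3]]; [|lia].
  rewrite acc_length by lia. rewrite old_cond, old_firstn by auto.
  rewrite old_length in S1.
  destruct (Nat.eqb_spec (act s) 0) as [A|A]; cbn [negb andb].
  - destruct (Nat.eqb_spec (fst (snd (cnd s i))) 0) as [Z|Z].
    + destruct (eqE (acc s i) (acc (S s) i)) eqn:Q; [|now left]. apply eqE_eq in Q.
      right. split; auto. split; auto. right. right. repeat split; auto; intros; try lia.
    + right. split; auto. split; auto. left. repeat split; auto; intros; try lia.
  - destruct (Nat.eqb_spec i (act s)) as [->|N]; cbn [fst snd].
    + replace (S s =? 0) with false by (symmetry; now apply Nat.eqb_neq).
      right. split; auto. split; auto. right. left. destruct (act_idx_spec s A) as [A0 _]. auto.
    + destruct (Nat.eqb_spec (fst (snd (cnd s i))) 0) as [Z|Z].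
      * destruct (eqE (acc s i) (acc (S s) i)) eqn:Q; [|now left]. apply eqE_eq in Q.
        right. split; auto. split; auto. right. right. repeat split; auto; intros; try lia.
      * right. split; auto. split; auto. left. repeat split; auto; intros; try lia.
Qed.

Lemma cnd_new s : cnd (S s) s = fresh_cond (S s) (errs (S s)) (acc (S s) s) (S s).
Proof.
  rewrite cnd_S by lia. unfold new_cond.
  replace (same_below (old s) (acc (S s) s)) with false; auto. symmetry. apply not_true_iff_false.
  intros H. apply same_below_spec in H as [H _]; [|lia]. pose proof (old_length_le s). lia.
Qed.

Definition level_ok (s i : nat) : Prop :=
  length (rho s i) = rho_len (errs s) i /\
  rho_good s (errs s) (levels s) i /\
  fst (cnd s i) <= s /\ fst (snd (cnd s i)) <= s /\
  (fst (snd (cnd s i)) <> 0 -> acted_small s (errs s) (acc s i) (cnd s i)) /\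
  (fst (snd (cnd s i)) = 0 -> cnd s i = fresh_cond s (errs s) (acc s i) (fst (cnd s i))).

Definition Inv (s : nat) : Prop := errs_ok s (errs s) /\ forall i, i < s -> level_ok s i.

Lemma Inv_parent_measure s i : Inv s -> i <= s ->
  2 ^ resolution s <= 2 ^ parent_weight (acc s i) * cnt (resolution s) (in_parent_class (errs s) (acc s i)).
Proof.
  intros [H1 H2] L. apply parent_measure; auto; [now rewrite levels_length|].
  intros j Lj. apply H2. lia.
Qed.

(** A new error of index [j] has the current count in its length, an older one of the same index a
    smaller count, and the pairing separates different indices. *)
Lemma errs_ok_S s : Inv s -> errs_ok (S s) (errs (S s)).
Proof.
  intros [[H1 [H2 H3]] HL]. rewrite errs_S. destruct (Nat.eqb_spec (act s) 0) as [A|A].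
  { split; [lia|]. split; auto. intros e He. destruct (H2 e He). split; [lia|auto]. }
  apply act_spec in A as [A _]. set (j := act s - 1) in *.
  assert (Lj : length (rho s j) = rho_len (errs s) j) by (apply HL; lia).
  split; [cbn; lia|]. split.
  - intros e [<-|He]; cbn [fst snd filter].
    + split; [lia|]. exists (length (filter (fun e => fst e <=? j) (errs s))).
      rewrite Nat.leb_refl. cbn [length]. split; auto.
    + destruct (H2 e He) as [K [l [Hl Hc]]]. split; [lia|]. exists l. split; auto.
      destruct (j <=? fst e); cbn [length]; lia.
  - cbn [map snd]. constructor; auto. intros I. apply in_map_iff in I as [e [Ee He]].
    destruct (H2 e He) as [K [l [Hl Hc]]]. rewrite Lj in Ee. unfold rho_len in Ee.
    assert (T : to_nat (l, fst e) = to_nat (length (filter (fun e : error => fst e <=? j) (errs s)), j)) by lia.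
    apply to_nat_inj in T. injection T as T1 T2. rewrite T2 in Hc. lia.
Qed.

Lemma errs_incl s : incl (errs s) (errs (S s)).
Proof. rewrite errs_S. destruct (act s =? 0); [apply incl_refl|]. now apply incl_tl, incl_refl. Qed.

Lemma lower_length s i : i <= s -> length (lower (acc s i)) = i - 1.
Proof. intros. unfold lower. rewrite length_firstn, acc_length; lia. Qed.

Lemma parent_rho_lower s t i : i <= s -> i <= t -> lower (acc s i) = lower (acc t i) ->
  parent_rho (acc s i) = parent_rho (acc t i).
Proof.
  intros L L' H. unfold parent_rho. rewrite !acc_length by lia.
  destruct (Nat.leb_spec 2 i); auto. f_equal.
  assert (G : forall u, i <= u -> nth (i - 2) (acc u i) dlevel = nth (i - 2) (lower (acc u i)) dlevel).
  { intros u Lu. unfold lower. rewrite acc_length by lia. rewrite nth_firstn_lt; auto. lia. }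
  rewrite !G by auto. now rewrite H.
Qed.

Lemma nth_lower s i j : i <= s -> j < i - 1 -> nth j (map fst (lower (acc s i))) dcond = cnd s j.
Proof.
  intros L Lj. rewrite nth_map_fst. unfold lower. rewrite acc_length by lia.
  rewrite nth_firstn_lt by lia. unfold acc. rewrite nth_firstn_lt by lia. reflexivity.
Qed.

Lemma parent_rho_eq s j : S (S j) <= s -> parent_rho (acc s (S (S j))) = rho s j.
Proof.
  intros L. unfold parent_rho. rewrite acc_length by lia. cbn [Nat.leb Nat.sub]. rewrite Nat.sub_0_r.
  unfold acc. rewrite nth_firstn_lt by lia. reflexivity.
Qed.

(** Each way of leaving the class (test, error prefix, violated condition) that shows on the
    truncation at stage [s] still counts at stage [s + 1]. All monotonicity between stages comes
    from here. *)
Lemma in_parent_class_shrink s i X : Inv s -> i <= s -> lower (acc s i) = lower (acc (S s) i) ->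
  in_parent_class (errs (S s)) (acc (S s) i) X = true ->
  in_parent_class (errs s) (acc s i) (firstn (resolution s) X) = true.
Proof.
  intros HI L Hl. rewrite !in_parent_class_spec, !acc_length by lia.
  rewrite <- (parent_rho_lower s (S s)), <- Hl by (auto; lia). rewrite !in_class_spec.
  intros [H1 [H2 [H3 H4]]]. split; [|split; [|split]].
  - assert (P : length (parent_rho (acc s i)) <= resolution s).
    { destruct i as [|[|j]]; [| |rewrite parent_rho_eq by auto].
      1, 2: unfold parent_rho; rewrite acc_length by lia; apply le_0_n.
      destruct HI as [HE HL]. destruct (HL j ltac:(lia)) as [-> _]. apply rho_len_le_resolution; auto. lia. }
    rewrite prefixb_firstn in *. destruct H1 as [H1 H5]. rewrite firstn_firstn, Nat.min_l by auto.
    split; auto. rewrite length_firstn. lia.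
  - apply not_true_iff_false. intros H. apply univ_test_firstn in H. congruence.
  - intros e He P. apply not_true_iff_false. intros H. apply prefixb_firstn_l in H.
    rewrite (H3 e) in H; auto; [discriminate|]. now apply errs_incl.
  - intros j Lj P. apply condok_shrink; [|now apply H4].
    rewrite length_map, lower_length in Lj by lia. rewrite nth_lower by lia. right.
    apply resolution_mono. destruct HI as [HE HL]. destruct (HL j ltac:(lia)) as [_ [_ [_ [H5 _]]]]. lia.
Qed.

Lemma acted_small_step s i c : Inv s -> i <= s -> lower (acc s i) = lower (acc (S s) i) ->
  fst (snd c) <> 0 -> fst (snd c) <= S s ->
  acted_small s (errs s) (acc s i) c -> acted_small (S s) (errs (S s)) (acc (S s) i) c.
Proof.
  intros HI L Hl Z La. unfold acted_small, parent_weight. rewrite <- Hl, !acc_length by lia.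
  apply cnt_shrink_lt; [apply resolution_mono; lia|]. intros X LX HX. apply andb_true_iff in HX as [H1 H2].
  rewrite (in_parent_class_shrink s i X) by auto. cbn [andb]. rewrite <- H2. f_equal.
  unfold condok. apply Nat.eqb_neq in Z. rewrite Z, firstn_firstn, Nat.min_l; auto.
  apply resolution_mono. lia.
Qed.

(** By induction on the level: the levels below give the measure of the parent class, that makes the
    condition large, and a large condition yields a string. *)
Lemma Inv_S s : Inv s -> Inv (S s).
Proof.
  intros HI. assert (HE := errs_ok_S s HI). split; auto.
  induction i as [i IH] using lt_wf_ind. intros Li.
  assert (PM : 2 ^ resolution (S s) <= 2 ^ parent_weight (acc (S s) i) *
    cnt (resolution (S s)) (in_parent_class (errs (S s)) (acc (S s) i))).
  { apply parent_measure; auto; [rewrite levels_length; lia|]. intros j Lj. apply IH; lia. }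
  assert (HC : fst (cnd (S s) i) <= S s /\ fst (snd (cnd (S s) i)) <= S s /\
    (fst (snd (cnd (S s) i)) <> 0 -> acted_small (S s) (errs (S s)) (acc (S s) i) (cnd (S s) i)) /\
      (fst (snd (cnd (S s) i)) = 0 ->
       cnd (S s) i = fresh_cond (S s) (errs (S s)) (acc (S s) i) (fst (cnd (S s) i)))).
  { assert (F : forall q, q <= S s -> cnd (S s) i = fresh_cond (S s) (errs (S s)) (acc (S s) i) q ->
      fst (cnd (S s) i) <= S s /\ fst (snd (cnd (S s) i)) <= S s /\
        (fst (snd (cnd (S s) i)) <> 0 -> acted_small (S s) (errs (S s)) (acc (S s) i) (cnd (S s) i)) /\
          (fst (snd (cnd (S s) i)) = 0 ->
       cnd (S s) i = fresh_cond (S s) (errs (S s)) (acc (S s) i) (fst (cnd (S s) i)))).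
    { intros q Lq ->. cbn [fresh_cond fst snd]. repeat split; auto; lia. }
    destruct (Nat.eq_dec i s) as [->|N]; [apply (F (S s)); auto; apply cnd_new|].
    assert (Lis : i < s) by lia.
    destruct HI as [HE0 HL0]. destruct (HL0 i Lis) as [_ [_ [Q1 [Q2 [Q3 Q4]]]]].
    destruct (cnd_step s i Lis) as [Hc|[S1 [S2 [[Z [Hc A]]|[[Z [A [NZ Hc]]]|[Z [A [Ea Hc]]]]]]]].
    - apply (F (S s)); auto.
    - rewrite Hc. split; [lia|]. split; [lia|]. split; [|intros; contradiction].
      intros _. apply acted_small_step; auto; [split; auto|lia].
    - rewrite Hc. cbn [fst snd]. split; [lia|]. split; [lia|]. split; [|discriminate].
      intros _. apply acted_small_step; auto; cbn [fst snd]; try (split; auto; fail); try lia.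
      (* The level acts: the chosen index lies below the first unrealised one, so its follower is
         realised at stage [s]. *)
      destruct (act_idx_spec s ltac:(lia)) as [_ [Lk _]]. rewrite A in Lk.
      assert (PM0 := Inv_parent_measure s i (conj HE0 HL0) ltac:(lia)).
      destruct (cond_large_fresh s (errs s) (acc s i) (fst (cnd s i)) PM0) as [_ [R _]].
      rewrite (Q4 Z) in Lk. cbn [fresh_cond fst snd] in Lk. specialize (R _ Lk).
      unfold realised in R. apply Nat.ltb_lt in R. unfold acted_small.
      rewrite (cnt_ext (resolution s) _ (fun X => in_parent_class (errs s) (acc s i) X &&
        negb (outputs_zero (length (acc s i)) (follower (length (acc s i)) (fst (cnd s i)) (act_idx s)) X)));
          auto.
      (* At the stage of the action the truncation is void, since [S s] stands for stage [s] and [X]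
         has length exactly [resolution s]. *)
      intros X LX. do 2 f_equal. unfold condok. cbn [fst snd Nat.eqb].
      f_equal. replace (S s - 1) with s by lia. rewrite <- LX. apply firstn_all.
    - apply (F (fst (cnd s i))); [lia|auto]. }
  destruct HC as [C1 [C2 [C3 C4]]].
  assert (CL : cond_large (S s) (errs (S s)) (acc (S s) i) (cnd (S s) i)).
  { destruct (Nat.eq_dec (fst (snd (cnd (S s) i))) 0) as [Z|Z].
    - rewrite C4 by auto. now apply cond_large_fresh.
    - apply cond_large_of_small; auto. }
  destruct (new_rho_spec (S s) (errs (S s)) HE (acc (S s) i) (cnd (S s) i)) as [R1 R2];
    [rewrite acc_length; lia|auto|].
  rewrite <- rho_S in R1, R2 by lia. rewrite acc_length in R1 by lia.
  exact (conj R1 (conj R2 (conj C1 (conj C2 (conj C3 C4))))).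
Qed.

Lemma Inv_all s : Inv s.
Proof.
  induction s; [|now apply Inv_S]. split; [|lia].
  split; [apply le_n|]. split; [intros e []|constructor].
Qed.

(** * Entry into [D] and the log of numbers put into the sets *)

Lemma inD_mono s t k : s <= t -> inD d s k = true -> inD d t k = true.
Proof.
  intros L. unfold inD. rewrite !andb_true_iff, !Nat.ltb_lt. intros [H1 H2]. split; [lia|].
  now apply (haltb_zeros_mono d s).
Qed.

Lemma inD_enters s t k : s <= t -> inD d s k = false -> inD d t k = true ->
  exists u, s <= u < t /\ inD d u k = false /\ inD d (S u) k = true.
Proof.
  intros L H0. induction L as [|t L IH]; intros H1; [congruence|].
  destruct (inD d t k) eqn:E; [destruct (IH eq_refl) as [u [Lu Hu]]; exists u; split; auto; lia|].
  exists t. auto.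
Qed.

(** Any change below, even of the string of level [i - 1], would have renewed the stamp. *)
Lemma stamp_acc t i s : i < t -> fst (snd (cnd t i)) = 0 -> fst (cnd t i) <= s <= t -> acc s i = acc t i.
Proof.
  revert s. induction t as [|t IH]; intros s L Z Hs; [lia|].
  destruct (Nat.eq_dec s (S t)) as [->|N]; auto.
  destruct (Nat.eq_dec i t) as [->|Ni].
  { rewrite cnd_new in Hs. cbn [fresh_cond fst] in Hs. lia. }
  destruct (cnd_step t i ltac:(lia)) as [Hc|[S1 [S2 [[Z' [Hc A]]|[[Z' [A [NZ Hc]]]|[Z' [A [Ea Hc]]]]]]]].
  - rewrite Hc in Hs. cbn [fresh_cond fst] in Hs. lia.
  - rewrite Hc in Z. contradiction.
  - rewrite Hc in Z. discriminate.
  - rewrite <- Ea. rewrite Hc in Hs. cbn [fresh_cond fst] in Hs. apply IH; auto; lia.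
Qed.

Lemma cnd_stamp_le t i : i < t -> fst (cnd t i) <= t.
Proof. intros L. now apply Inv_all. Qed.

Lemma log_in t n : In n (log t) -> exists i q k, n = follower i q k /\ 1 <= i < t /\ inD d t k = true /\
  (q < fst (cnd t i) \/ (q = fst (cnd t i) /\ fst (snd (cnd t i)) <> 0)).
Proof.
  induction t as [|t IH]; [intros []|].
  assert (St : forall i q k, 1 <= i < t -> inD d (S t) k = true ->
     q < fst (cnd t i) \/ q = fst (cnd t i) /\ (fst (snd (cnd t i)) <> 0 \/ act t = i) ->
     exists i' q' k', follower i q k = follower i' q' k' /\ 1 <= i' < S t /\ inD d (S t) k' = true /\
       (q' < fst (cnd (S t) i') \/ (q' = fst (cnd (S t) i') /\ fst (snd (cnd (S t) i')) <> 0))).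
  { intros i q k Li Hk Hq. exists i, q, k. split; auto. split; [lia|]. split; auto.
    pose proof (cnd_stamp_le t i ltac:(lia)).
    destruct (cnd_step t i ltac:(lia)) as [Hc|[S1 [S2 [[Z' [Hc A]]|[[Z' [A [NZ Hc]]]|[Z' [A [Ea Hc]]]]]]]];
      rewrite Hc; cbn [fresh_cond fst snd].
    - left. lia.
    - lia.
    - lia.
    - left. destruct Hq as [Hq|[_ [Hq|Hq]]]; auto; [contradiction|]. rewrite <- Hq in *. lia. }
  rewrite log_S. destruct (Nat.eqb_spec (act t) 0) as [A|A].
  - intros Hn. destruct (IH Hn) as [i [q [k [-> [Li [Hk Hq]]]]]]. apply St; auto.
    + apply (inD_mono t); auto.
    + tauto.
  - intros [<-|Hn].
    + destruct (act_spec t A) as [La _]. destruct (act_idx_spec t A) as [_ [_ [Hk _]]].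
      apply St; auto.
    + destruct (IH Hn) as [i [q [k [-> [Li [Hk Hq]]]]]]. apply St; auto.
      * apply (inD_mono t); auto.
      * tauto.
Qed.

Lemma log_incl s t : s <= t -> incl (log s) (log t).
Proof.
  induction 1; [apply incl_refl|]. eapply incl_tran; [eassumption|]. rewrite log_S.
  destruct (act m =? 0); [apply incl_refl|]. now apply incl_tl, incl_refl.
Qed.

Lemma errs_incl_le s t : s <= t -> incl (errs s) (errs t).
Proof. induction 1; [apply incl_refl|]. eapply incl_tran; [eassumption|]. apply errs_incl. Qed.

Lemma log_enters s t n : s <= t -> ~ In n (log s) -> In n (log t) ->
  exists u, s <= u < t /\ act u <> 0 /\ n = follower (act u) (fst (cnd u (act u))) (act_idx u).
Proof.
  induction 1 as [|t L IH]; intros H0 H1; [contradiction|].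
  destruct (in_dec Nat.eq_dec n (log t)) as [I|I].
  - destruct (IH H0 I) as [u [Lu Hu]]. exists u. split; auto. lia.
  - exists t. split; [lia|]. rewrite log_S in H1. destruct (Nat.eqb_spec (act t) 0) as [A|A]; [contradiction|].
    destruct H1 as [H1|H1]; [auto|contradiction].
Qed.

Lemma acted_in_log t i : i < t -> fst (snd (cnd t i)) <> 0 ->
  In (follower i (fst (cnd t i)) (snd (snd (cnd t i)))) (log t).
Proof.
  induction t as [|t IH]; intros L Z; [lia|].
  destruct (Nat.eq_dec i t) as [->|Ni]; [rewrite cnd_new in Z; now cbn in Z|].
  destruct (cnd_step t i ltac:(lia)) as [Hc|[S1 [S2 [[Z' [Hc A]]|[[Z' [A [NZ Hc]]]|[Z' [A [Ea Hc]]]]]]]];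
    rewrite Hc in *; cbn [fresh_cond fst snd] in *; try lia.
  - apply (log_incl t); [lia|]. apply IH; auto. lia.
  - rewrite log_S. destruct (Nat.eqb_spec (act t) 0); [lia|]. left. now rewrite A.
Qed.

(* From stage [s0] on, no level below [i] acts, and everything that the condition of level [i] depends on,
   except for the string of level [i - 1], is constant. *)
Definition stable (i s0 : nat) : Prop := i < s0 /\ forall s, s0 <= s ->
  map fst (acc s i) = map fst (acc s0 i) /\ lower (acc s i) = lower (acc s0 i) /\ (act s <> 0 -> i <= act s).

Lemma acc_S s i : i < s -> acc s (S i) = acc s i ++ [lev s i].
Proof.
  intros L. unfold acc. rewrite (firstn_S_nth i _ dlevel) by (rewrite levels_length; lia). reflexivity.
Qed.

Lemma lower_acc_S s i : i < s -> lower (acc s (S i)) = acc s i.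
Proof.
  intros L. unfold lower. rewrite acc_length by lia. unfold acc.
  rewrite firstn_firstn. f_equal. lia.
Qed.

(** The part of the class that avoids output zero only loses measure, so the strict upper bound
    persists. *)
Lemma realised_mono s i q k : i < s -> lower (acc s i) = lower (acc (S s) i) ->
  realised s (errs s) (acc s i) q k = true -> realised (S s) (errs (S s)) (acc (S s) i) q k = true.
Proof.
  intros L Hl. unfold realised, parent_weight. rewrite !Nat.ltb_lt, <- Hl, !acc_length by lia.
  apply cnt_shrink_lt; [apply resolution_mono; lia|]. intros X LX HX.
  apply andb_true_iff in HX as [H1 H2]. rewrite (in_parent_class_shrink s i X) by (auto using Inv_all; lia).
  cbn [andb]. rewrite negb_true_iff, <- not_true_iff_false in *. intros H. apply H2.
  now apply outputs_zero_firstn in H.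
Qed.

Lemma first_unrealised_mono s i q : i < s -> lower (acc s i) = lower (acc (S s) i) ->
  first_unrealised s (errs s) (acc s i) q <= first_unrealised (S s) (errs (S s)) (acc (S s) i) q.
Proof.
  intros L Hl.
  destruct (cond_large_fresh s (errs s) (acc s i) q) as [_ [H1 _]];
    [apply Inv_parent_measure; [apply Inv_all|lia]|].
  destruct (cond_large_fresh (S s) (errs (S s)) (acc (S s) i) q) as [H2 _];
    [apply Inv_parent_measure; [apply Inv_all|lia]|].
  set (k' := first_unrealised (S s) _ _ _) in *.
  destruct (le_lt_dec (first_unrealised s (errs s) (acc s i) q) k') as [|N]; auto.
  apply H1, realised_mono in N; auto. congruence.
Qed.

(** The same shrinking applied to a lower bound: a string that fails goes on failing. The bound on
    [length t] keeps [t] a prefix after truncation. *)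
Lemma rho_ok_anti s i c t : i < s -> acc s i = acc (S s) i -> length t <= resolution s ->
  fst (snd c) <= s ->
  rho_ok (S s) (errs (S s)) (acc (S s) i) c t = true -> rho_ok s (errs s) (acc s i) c t = true.
Proof.
  intros L Ha Lt Lc. unfold rho_ok, parent_weight. rewrite !Nat.leb_le, <- Ha, !acc_length by lia.
  intros H. apply Nat.nlt_ge. intros N. apply Nat.le_ngt in H. apply H. revert N.
  apply cnt_shrink_lt; [apply resolution_mono; lia|]. intros X LX HX.
  apply andb_true_iff in HX as [H1 HX]. apply andb_true_iff in HX as [H2 H3].
  apply andb_true_iff. split; [|apply andb_true_iff; split].
  - rewrite prefixb_firstn in *. destruct H1 as [H1 H4]. rewrite firstn_firstn, Nat.min_l by auto.
    split; auto. rewrite length_firstn. lia.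
  - apply (in_parent_class_shrink s i X); [apply Inv_all|lia|now rewrite Ha|]. now rewrite <- Ha.
  - apply condok_shrink; auto. right. apply resolution_mono. lia.
Qed.

(** The string is the first good one in a fixed finite list, from which good strings only drop
    out. *)
Lemma rho_stabilises j s1 : j < s1 ->
  (forall s, s1 <= s -> acc s j = acc s1 j /\ cnd s j = cnd s1 j /\ rho_len (errs s) j = rho_len (errs s1) j) ->
  exists s2, s1 <= s2 /\ forall s, s2 <= s -> rho s j = rho s2 j.
Proof.
  intros L H.
  destruct (hd_filter_stabilises [] (fun s => rho_ok s (errs s) (acc s j) (cnd s1 j))
     (all_strings (rho_len (errs s1) j)) s1) as [s2 [L2 H2]].
  { intros s t Ht Ls. apply in_all_strings in Ht. apply rho_ok_anti; [lia| | |].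
    - rewrite (proj1 (H s Ls)), (proj1 (H (S s) ltac:(lia))). reflexivity.
    - rewrite Ht, <- (proj2 (proj2 (H s Ls))). apply rho_len_le_resolution; [apply Inv_all|lia].
    - destruct (Inv_all s1) as [_ I]. destruct (I j L) as [_ [_ [_ [Q _]]]]. lia. }
  exists (S s2). split; [lia|].
  assert (E : forall s, S s2 <= s -> rho s j = hd [] (filter (rho_ok s (errs s) (acc s j) (cnd s1 j))
     (all_strings (rho_len (errs s1) j)))).
  { intros [|s] Ls; [lia|]. rewrite rho_S by lia. unfold new_rho.
    destruct (H (S s) ltac:(lia)) as [_ [Hc He]]. rewrite acc_length by lia. now rewrite Hc, He. }
  intros s Ls. rewrite !E by lia. rewrite (H2 s), (H2 (S s2)) by lia. reflexivity.
Qed.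

(** An action of level [a] adds an error of index [a - 1], and the length of string [j] counts only
    errors of index at most [j]. *)
Lemma rho_len_S s j : act s = 0 \/ j < act s - 1 -> rho_len (errs (S s)) j = rho_len (errs s) j.
Proof.
  intros H. rewrite errs_S. destruct (Nat.eqb_spec (act s) 0) as [A|A]; auto.
  unfold rho_len. cbn [filter fst]. replace (act s - 1 <=? j) with false; auto.
  symmetry. apply Nat.leb_gt. lia.
Qed.

(** [outputs_zero] is constantly false at level [0], so the part avoiding output zero is the whole
    class and index [0] is already unrealised. *)
Lemma cnd_level0 s : 0 < s -> fst (snd (cnd s 0)) = 0 -> snd (snd (cnd s 0)) = 0.
Proof.
  intros L Z. destruct (Inv_all s) as [HE I]. destruct (I 0 L) as [_ [_ [_ [_ [_ Q]]]]].
  rewrite (Q Z). cbn [fresh_cond fst snd].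
  destruct (cond_large_fresh s (errs s) (acc s 0) (fst (cnd s 0))) as [_ [H1 _]];
    [apply Inv_parent_measure; [apply Inv_all|lia]|].
  set (k := first_unrealised _ _ _ _) in *. destruct k as [|k]; auto. exfalso.
  specialize (H1 0 ltac:(lia)). unfold realised in H1. apply Nat.ltb_lt in H1.
  assert (PM := Inv_parent_measure s 0 (Inv_all s) ltac:(lia)).
  rewrite acc_length in H1 by lia.
  rewrite (cnt_ext _ _ (in_parent_class (errs s) (acc s 0))) in H1.
  2:{ intros X _. now rewrite andb_true_r. }
  cbn [Nat.pow] in H1. lia.
Qed.

(** * Every level comes to rest because [D] is not computable *)

Variable D : nat -> bool.
Hypothesis HD : forall k, D k = true <-> exists s, inD d s k = true.
Hypothesis NC : ~ computable D.

(* If the index of level [i] grows for ever although the level never acts, then whether [k] is in [D] is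
   decided at the first stage at which the index exceeds [k]. *)
Lemma index_bounded i s2 : i < s2 ->
  (forall s, s2 <= s -> fst (snd (cnd s i)) = 0 /\ snd (snd (cnd s i)) <= snd (snd (cnd (S s) i)) /\
     (act s <> 0 -> i < act s)) ->
  exists B, forall s, s2 <= s -> snd (snd (cnd s i)) <= B.
Proof.
  intros L H. apply NNPP. intros N. apply NC.
  assert (U : forall k, exists s, s2 <= s /\ k < snd (snd (cnd s i))).
  { intros k. apply NNPP. intros N'. apply N. exists k. intros s Ls.
    destruct (le_lt_dec (snd (snd (cnd s i))) k); auto. destruct N'. eauto. }
  assert (Mono : forall s t, s2 <= s -> s <= t -> snd (snd (cnd s i)) <= snd (snd (cnd t i))).
  { intros s t Ls. induction 1; auto. etransitivity; [eassumption|]. apply H. lia. }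
  (* [actor] only considers levels from [1] on; the index of level [0] is constantly [0], hence
     bounded. *)
  assert (i1 : 1 <= i).
  { destruct i; [|lia]. destruct (U 0) as [s [Ls Hs]]. rewrite cnd_level0 in Hs; [lia|lia|]. now apply H. }
  assert (C : CF empty_oracle D); [|exact C].
  apply (CF_search empty_oracle
    (fun p => (s2 <=? snd p) && (fst p <? snd (snd (cnd (snd p) i))))
    (fun p => inD d (snd p) (fst p)) D).
  - unfold cnd, lev, levels. cf. apply CF_state_at. cf.
  - cf.
  - intros k. destruct (U k) as [s [Ls Hs]]. exists s. cbn [fst snd].
    apply andb_true_iff. split; [now apply Nat.leb_le | now apply Nat.ltb_lt].
  - intros k s. cbn [fst snd]. rewrite andb_true_iff, Nat.leb_le, Nat.ltb_lt. intros [Ls Hs].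
    destruct (inD d s k) eqn:E; symmetry; [apply HD; eauto|].
    apply not_true_iff_false. intros HDk. apply HD in HDk as [t Ht].
    assert (Lst : s <= t).
    { destruct (le_lt_dec s t); auto. rewrite (inD_mono t s) in E; auto; [discriminate|lia]. }
    destruct (inD_enters s t k Lst E Ht) as [u [Lu [U1 U2]]].
    (* When [k] enters, it lies below the index of level [i], which could then act; so some level up
       to [i] would act, against the hypothesis. *)
    destruct (H u ltac:(lia)) as [Z [_ A]].
    destruct (act_least u i) as [A1 A2]; [lia| |specialize (A A1); lia].
    unfold can_act. fold (lev u i). fold (cnd u i). rewrite Z, Nat.eqb_refl. cbn [andb].
    apply Nat.ltb_lt. unfold permitted.
    assert (I : In k (filter (fun k => inD d (S u) k && negb (inD d u k)) (seq 0 (snd (snd (cnd u i)))))).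
    { apply filter_In. rewrite U1, U2. split; auto. apply in_seq. pose proof (Mono s u Ls ltac:(lia)). lia. }
    destruct (filter _ _); [destruct I|cbn; lia].
Qed.

(** The order matters: the string of level [i - 1] can settle only after level [i] has stopped
    acting, and the stamp of a level [i] that never acts only after that string has. *)
Lemma stable_S i s0 : stable i s0 -> exists s1, s0 <= s1 /\ stable (S i) s1.
Proof.
  intros [L0 H0].
  assert (St : forall s, s0 <= s -> map fst (acc s i) = map fst (acc (S s) i) /\
     lower (acc s i) = lower (acc (S s) i)).
  { intros s Ls. destruct (H0 s Ls) as [E1 [E2 _]]. destruct (H0 (S s) ltac:(lia)) as [E3 [E4 _]].
    split; congruence. }
  assert (Kp : forall s, s0 <= s -> fst (snd (cnd s i)) <> 0 -> cnd (S s) i = cnd s i).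
  { intros s Ls Z. rewrite cnd_S by lia. unfold new_cond. rewrite acc_length by lia.
    assert (Lo : i < length (old s)).
    { rewrite old_length. destruct (Nat.eqb_spec (act s) 0) as [A|A]; [lia|].
      destruct (H0 s Ls) as [_ [_ A']]. specialize (A' A). lia. }
    replace (same_below (old s) (acc (S s) i)) with true.
    2:{ symmetry. apply same_below_spec; [lia|]. split; auto. }
    rewrite old_cond by auto.
    destruct (Nat.eqb_spec (act s) 0) as [A|A]; cbn [negb andb].
    - apply Nat.eqb_neq in Z. now rewrite Z.
    - destruct (Nat.eqb_spec i (act s)) as [->|N]; [destruct (act_idx_spec s A); contradiction|].
      apply Nat.eqb_neq in Z. now rewrite Z. }
  (* Level [i] acts at most once from [s0] on: an action marks its condition, and a marked condition
     is kept. *)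
  assert (C1 : exists s1, s0 <= s1 /\ (forall s, s1 <= s -> act s <> 0 -> i < act s) /\
     ((forall s, s1 <= s -> cnd s i = cnd s1 i) \/ (forall s, s1 <= s -> fst (snd (cnd s i)) = 0))).
  { destruct (classic (exists s1, s0 <= s1 /\ fst (snd (cnd s1 i)) <> 0)) as [[s1 [L1 Z]]|N].
    - exists s1. split; auto. assert (E : forall s, s1 <= s -> cnd s i = cnd s1 i).
      { induction 1 as [|s L IH]; auto. rewrite Kp, IH; auto; [lia|now rewrite IH]. }
      split; auto. intros s Ls A. destruct (H0 s ltac:(lia)) as [_ [_ A']]. specialize (A' A).
      destruct (Nat.eq_dec i (act s)) as [->|]; [|lia].
      destruct (act_idx_spec s A) as [Z' _]. rewrite E in Z' by auto. contradiction.
    - exists s0. split; auto.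
      assert (Z : forall s, s0 <= s -> fst (snd (cnd s i)) = 0).
      { intros s Ls. apply NNPP. intros Z. apply N. eauto. }
      split; auto. intros s Ls A. destruct (H0 s Ls) as [_ [_ A']]. specialize (A' A).
      destruct (Nat.eq_dec i (act s)) as [Ei|]; [|lia]. exfalso.
      assert (Z' := Z (S s) ltac:(lia)). rewrite cnd_S in Z' by lia. unfold new_cond in Z'.
      rewrite acc_length in Z' by lia.
      assert (Lo : i < length (old s)).
      { rewrite old_length. destruct (Nat.eqb_spec (act s) 0) as [A0|A0]; lia. }
      replace (same_below (old s) (acc (S s) i)) with true in Z'.
      2:{ symmetry. apply same_below_spec; [lia|]. split; auto. }
      rewrite old_cond in Z' by auto. apply Nat.eqb_neq in A. rewrite A, <- Ei, Nat.eqb_refl in Z'.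
      cbn in Z'. discriminate. }
  destruct C1 as [s1 [L1 [A1 C1]]].
  (* Only levels above [i] act now, so no further error has index [i - 1] or less. The length of the
     string of level [i - 1] is fixed, and the string settles. *)
  assert (C2 : exists s2, s1 <= s2 /\ forall s, s2 <= s -> acc s i = acc s2 i).
  { destruct i as [|j]; [exists s1; split; auto|].
    assert (Ej : forall s, s1 <= s -> acc s j = acc s1 j /\ cnd s j = cnd s1 j).
    { intros s Ls. destruct (H0 s ltac:(lia)) as [E1 [E2 _]]. destruct (H0 s1 ltac:(lia)) as [E3 [E4 _]].
      rewrite !lower_acc_S in * by lia. split; [congruence|].
      rewrite !acc_S, !map_app in * by lia. cbn [map] in *.
      assert (E5 := eq_trans E1 (eq_sym E3)). apply app_inj_tail in E5 as [_ E5]. exact E5. }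
    destruct (rho_stabilises j s1) as [s2 [L2 H2]]; [lia| |].
    - intros s Ls. destruct (Ej s Ls) as [E1 E2]. split; auto. split; auto.
      clear E1 E2. induction Ls as [|s Ls IH]; auto. rewrite rho_len_S; auto.
      destruct (Nat.eq_dec (act s) 0) as [|A]; auto. right. specialize (A1 s Ls A). lia.
    - exists s2. split; auto. intros s Ls. rewrite !acc_S by lia.
      destruct (Ej s ltac:(lia)) as [E1 E2]. destruct (Ej s2 ltac:(lia)) as [E3 E4].
      f_equal; [congruence|]. f_equal. rewrite (surjective_pairing (lev s j)), (surjective_pairing (lev s2 j)).
      f_equal; [|exact (H2 s Ls)]. change (cnd s j = cnd s2 j). congruence. }
  destruct C2 as [s2 [L2 C2]].
  (* If the level never acts, its stamp is now fixed and its index only grows; [index_bounded] stops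
     the growth. *)
  assert (C3 : exists s3, s2 <= s3 /\ forall s, s3 <= s -> cnd s i = cnd s3 i).
  { destruct C1 as [C1|C1].
    { exists s2. split; auto. intros s Ls. rewrite (C1 s), (C1 s2) by lia. reflexivity. }
    assert (F : forall s, s2 <= s -> cnd (S s) i = fresh_cond (S s) (errs (S s)) (acc (S s) i) (fst (cnd s i))).
    { intros s Ls. destruct (St s ltac:(lia)) as [E1 E2]. rewrite cnd_S by lia. unfold new_cond.
      rewrite acc_length by lia.
      assert (Lo : i < length (old s)).
      { rewrite old_length. destruct (Nat.eqb_spec (act s) 0) as [A|A]; [lia|].
        pose proof (A1 s ltac:(lia) A). lia. }
      replace (same_below (old s) (acc (S s) i)) with true.
      2:{ symmetry. apply same_below_spec; [lia|]. split; auto. }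
      rewrite old_cond, old_firstn by auto.
      replace (negb (act s =? 0) && (i =? act s)) with false.
      2:{ symmetry. apply andb_false_iff. destruct (Nat.eqb_spec (act s) 0) as [A|A]; auto. right.
          apply Nat.eqb_neq. pose proof (A1 s ltac:(lia) A). lia. }
      rewrite C1, Nat.eqb_refl by lia.
      replace (eqE (acc s i) (acc (S s) i)) with true; auto.
      symmetry. rewrite (C2 s), (C2 (S s)) by lia. apply eqE_refl. }
    assert (Q : forall s, s2 <= s -> fst (cnd s i) = fst (cnd s2 i)).
    { induction 1 as [|s Ls IH]; auto. rewrite F by auto. exact IH. }
    assert (M : forall s, S s2 <= s -> snd (snd (cnd s i)) <= snd (snd (cnd (S s) i))).
    { intros [|s] Ls; [lia|]. rewrite (F (S s)), (F s) by lia.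
      cbn [fresh_cond fst snd]. apply first_unrealised_mono; [lia|]. apply St. lia. }
    destruct (index_bounded i (S s2)) as [B HB]; [lia| |].
    { intros s Ls. split; [apply C1; lia|]. split; [now apply M|]. apply A1. lia. }
    destruct (mono_bounded_stabilises (fun s => snd (snd (cnd s i))) (S s2) B M HB) as [s3 [L3 H3]].
    exists s3. split; [lia|]. intros s Ls.
    apply cond_eq; [rewrite (Q s), (Q s3) by lia; reflexivity| |exact (H3 s Ls)].
    rewrite (C1 s), (C1 s3) by lia. reflexivity. }
  destruct C3 as [s3 [L3 C3]].
  exists (S s3). split; [lia|]. split; [lia|]. intros s Ls. rewrite !lower_acc_S by lia.
  rewrite (C2 s), (C2 (S s3)) by lia. split; [|split; auto].
  - rewrite !acc_S, !map_app by lia. rewrite (C2 s), (C2 (S s3)) by lia. f_equal. cbn [map]. f_equal.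
    change (cnd s i = cnd (S s3) i). rewrite (C3 s), (C3 (S s3)) by lia. reflexivity.
  - intros A. apply A1; auto. lia.
Qed.

Lemma stable_exists i : exists s0, stable i s0.
Proof.
  induction i as [|i [s0 H]].
  - exists 1. split; [lia|]. intros s Ls. repeat split. lia.
  - destruct (stable_S i s0 H) as [s1 [_ H1]]. eauto.
Qed.

(** * The limit of the construction: the two reals and the two sets *)

Lemma stable_cnd i s0 s : stable (S i) s0 -> s0 <= s -> cnd s i = cnd s0 i.
Proof.
  intros [L H] Ls. destruct (H s Ls) as [E _]. rewrite !acc_S, !map_app in E by lia.
  apply app_inj_tail in E as [_ E]. exact E.
Qed.

(** Two levels up, because stability at level [i + 1] leaves out the string of level [i]. *)
Lemma stable_rho i s0 s : stable (S (S i)) s0 -> s0 <= s -> rho s i = rho s0 i.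
Proof.
  intros [L H] Ls. destruct (H s Ls) as [_ [E _]]. rewrite !lower_acc_S, !acc_S in E by lia.
  apply app_inj_tail in E as [_ E]. change (snd (lev s i) = snd (lev s0 i)). now rewrite E.
Qed.

Lemma level_class s i : i < s -> exists X, length X = resolution s /\ prefixb (rho s i) X = true /\
  prefixb (parent_rho (acc s i)) X = true /\ univ_test X = false /\
  (forall e, In e (errs s) -> Nat.even (fst e + i) = true -> prefixb (snd e) X = false) /\
  (forall j, j <= i -> Nat.even (j + i) = true -> condok j (cnd s j) X = true).
Proof.
  intros L. destruct (Inv_all s) as [HE HL]. destruct (HL i L) as [_ [R _]].
  unfold rho_good, rho_ok in R. apply Nat.leb_le in R. pose proof (pow2_pos (resolution s)).
  match type of R with _ <= _ * cnt _ ?Q => destruct (cnt_pos (resolution s) Q) as [X [LX HX]] end.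
  { apply Nat.neq_0_lt_0. intros E. rewrite E in R. lia. }
  exists X. split; auto. apply andb_true_iff in HX as [H1 HX]. apply andb_true_iff in HX as [H2 H3].
  split; auto. fold (acc s i) in H2, H3. apply in_parent_class_spec in H2 as [H2 H4].
  rewrite acc_length in H3, H4 by lia. apply in_class_spec in H4 as [H4 [H5 H6]].
  repeat split; auto. intros j Lj P. destruct (Nat.eq_dec j i) as [->|N]; [exact H3|].
  assert (N' : j <> i - 1).
  { intros ->. replace (i - 1 + i) with (S (2 * (i - 1))) in P by lia.
    rewrite Nat.even_succ, Nat.odd_mul in P. discriminate. }
  specialize (H6 j). rewrite length_map, lower_length, nth_lower in H6 by lia. apply H6; auto. lia.
Qed.

Lemma rho_length s i : i < s -> length (rho s i) = rho_len (errs s) i.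
Proof. intros L. now apply Inv_all. Qed.

Lemma rho_length_ge s i : i < s -> i < length (rho s i).
Proof.
  intros L. rewrite rho_length by auto. unfold rho_len. match goal with |- context [to_nat (?a, i)] =>
    pose proof (le_to_nat a i) end. lia.
Qed.

Lemma rho_len_mono E i j : i <= j -> rho_len E i <= rho_len E j.
Proof.
  intros L. unfold rho_len. apply Nat.add_le_mono_l, to_nat_mono; auto.
  induction E as [|e E IH]; cbn [filter]; auto.
  destruct (Nat.leb_spec (fst e) i), (Nat.leb_spec (fst e) j); cbn [length]; lia.
Qed.

(** Two consecutive strings of one parity are prefixes of the witness of the upper level, and
    lengths do not decrease with the level. *)
Lemma rho_chain s i m : i + 2 * m < s -> prefixb (rho s i) (rho s (i + 2 * m)) = true.
Proof.
  induction m as [|m IH]; intros L.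
  - rewrite Nat.add_0_r. apply prefixb_spec. exists []. now rewrite app_nil_r.
  - apply (prefixb_trans _ (rho s (i + 2 * m))); [apply IH; lia|].
    replace (i + 2 * S m) with (S (S (i + 2 * m))) in * by lia. set (j := i + 2 * m) in *.
    destruct (level_class s (S (S j)) L) as [X [_ [H1 [H2 _]]]]. rewrite parent_rho_eq in H2 by lia.
    apply (prefixb_linear _ _ X); auto. rewrite !rho_length by lia. apply rho_len_mono. lia.
Qed.

(** Bit [x] is read from level [2 * x + b], whose string is longer than [x]. The value is a limit
    over stages, hence the classical decision. *)
Definition Yset (b x : nat) : bool :=
  if excluded_middle_informative (exists s0, forall s, s0 <= s -> nth x (rho s (2 * x + b)) false = true)
  then true else false.

(** The parities differ because a level of parity [1 - b] works against the other real by
    enumerating into this set. *)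
Definition Aset (b n : nat) : bool :=
  if excluded_middle_informative (exists s, In n (log s) /\ Nat.even (fst (of_nat n) + b) = false)
  then true else false.

Lemma Aset_spec b n : Aset b n = true <-> exists s, In n (log s) /\ Nat.even (fst (of_nat n) + b) = false.
Proof. unfold Aset. destruct (excluded_middle_informative _); split; auto; discriminate. Qed.

Lemma rho_limit i : exists s0, i < s0 /\ forall s, s0 <= s -> rho s i = rho s0 i.
Proof.
  destruct (stable_exists (S (S i))) as [s0 H]. exists s0.
  split; [destruct H; lia|]. intros s L. now apply (stable_rho i s0 s).
Qed.

Lemma rho_Yset b j : exists s0, 2 * j + b < s0 /\
  forall s, s0 <= s -> in_cyl (rho s (2 * j + b)) (Yset b).
Proof.
  destruct (rho_limit (2 * j + b)) as [s0 [L0 H0]]. exists s0. split; auto. intros s L x Lx.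
  destruct (rho_limit (2 * x + b)) as [s1 [L1 H1]].
  set (t := s + s1).
  rewrite (H0 s L) in *. rewrite <- (H0 t) in * by lia.
  (* At a stage beyond both limits the two strings are comparable, so they agree on bit [x]. *)
  assert (E : nth x (rho t (2 * j + b)) false = nth x (rho t (2 * x + b)) false).
  { pose proof (rho_length_ge t (2 * x + b) ltac:(lia)).
    destruct (le_lt_dec j x) as [Ljx|Ljx].
    - apply prefixb_nth; auto. replace (2 * x + b) with (2 * j + b + 2 * (x - j)) by lia.
      apply rho_chain. lia.
    - symmetry. apply prefixb_nth; [|lia]. replace (2 * j + b) with (2 * x + b + 2 * (j - x)) by lia.
      apply rho_chain. lia. }
  rewrite E, H1 by lia. unfold Yset. destruct (excluded_middle_informative _) as [[s2 H2]|N].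
  - rewrite <- (H1 (s1 + s2)) by lia. apply H2. lia.
  - apply not_true_iff_false. intros T. apply N. exists s1. intros s' L'. now rewrite H1.
Qed.

Lemma Yset_class b m s0 : exists s X, s0 <= s /\ m <= length X /\ firstn m X = restr (Yset b) m /\
  univ_test X = false /\
  (forall e, In e (errs s) -> Nat.even (fst e + b) = true -> prefixb (snd e) X = false) /\
  (forall j, j <= m -> Nat.even (j + b) = true -> condok j (cnd s j) X = true).
Proof.
  destruct (rho_Yset b m) as [s1 [L1 H1]]. set (i := 2 * m + b) in *. set (s := s0 + s1).
  destruct (level_class s i ltac:(lia)) as [X [LX [P1 [_ [P2 [P3 P4]]]]]].
  pose proof (rho_length_ge s i ltac:(lia)) as Lr.
  specialize (H1 s ltac:(lia)). apply cyl_restr in H1. apply prefixb_firstn in P1 as [P1 P1'].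
  exists s, X. split; [lia|]. split; [lia|]. split; [|split; [auto|split]].
  - rewrite H1 in P1. rewrite <- (firstn_restr (Yset b) m (length (rho s i))) by lia.
    rewrite restr_length in P1. rewrite P1, firstn_firstn. f_equal. lia.
  - intros e He P. apply P3; auto. unfold i. now rewrite even_add_double.
  - intros j Lj P. apply P4; [lia|]. unfold i. now rewrite even_add_double.
Qed.

Lemma Yset_random b : ML_random (Yset b).
Proof.
  apply ML_random_of_univ_test. intros m. destruct (Yset_class b m 0) as [s [X [_ [_ [H1 [H2 _]]]]]].
  rewrite <- H1. apply not_true_iff_false. intros H. apply univ_test_firstn in H. congruence.
Qed.

Lemma Yset_avoids_errors b s e : In e (errs s) -> Nat.even (fst e + b) = true -> ~ in_cyl (snd e) (Yset b).
Proof.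
  intros He P HC. apply cyl_restr in HC.
  destruct (Yset_class b (length (snd e)) s) as [t [X [Lt [LX [H1 [_ [H2 _]]]]]]].
  specialize (H2 e (errs_incl_le s t Lt e He) P). apply not_true_iff_false in H2. apply H2.
  apply prefixb_firstn. split; auto. congruence.
Qed.

Lemma Aset_ce b : ce (Aset b).
Proof.
  apply (ce_of_CF (fun p => memb (fst p) (log (snd p)) && negb (Nat.even (fst (of_nat (fst p)) + b)))).
  - unfold log. cf. apply CF_state_at. cf.
  - intros n. rewrite Aset_spec. cbn [fst snd]. setoid_rewrite andb_true_iff.
    setoid_rewrite memb_spec. setoid_rewrite negb_true_iff. reflexivity.
Qed.

(* A number enters only at a stage at which its third component enters [D]. *)
Lemma Aset_le_D b : turing_le (Aset b) D.
Proof.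
  assert (C : CF D (Aset b)); [|exact C].
  apply (CF_search D
    (fun p => negb (D (snd (of_nat (snd (of_nat (fst p)))))) || inD d (snd p) (snd (of_nat (snd (of_nat (fst p))))))
    (fun p => D (snd (of_nat (snd (of_nat (fst p))))) &&
      (memb (fst p) (log (snd p)) && negb (Nat.even (fst (of_nat (fst p)) + b))))).
  - cf. apply CF_oracle; cf.
  - unfold log. cf; [apply CF_oracle; cf|]. apply CF_state_at. cf.
  - intros n. cbn [fst snd]. destruct (D (snd (of_nat (snd (of_nat n))))) eqn:E; [|exists 0; reflexivity].
    apply HD in E as [s Hs]. exists s. now rewrite Hs.
  - intros n s. cbn [fst snd]. intros H. apply eq_true_iff_eq.
    rewrite Aset_spec, !andb_true_iff, memb_spec, negb_true_iff. split.
    + intros [_ [H1 H2]]. eauto.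
    + intros [t [H1 H2]]. destruct (log_in t n H1) as [i [q [k [-> [_ [Hk _]]]]]].
      rewrite snd_follower in *. assert (Dk : D k = true) by (apply HD; eauto).
      split; auto. split; auto. rewrite Dk in H. cbn [negb orb] in H.
      destruct (in_dec Nat.eq_dec (follower i q k) (log s)) as [I|I]; auto. exfalso.
      destruct (le_lt_dec s t) as [L|L]; [|apply I, (log_incl t s); [lia|auto]].
      destruct (log_enters s t _ L I H1) as [u [Lu [A E]]]. apply follower_inj in E as [_ [_ E]].
      destruct (act_idx_spec u A) as [_ [_ [_ F]]]. rewrite <- E in F.
      rewrite (inD_mono s u k) in F; [discriminate|lia|auto].
Qed.

(* If [n] enters after a stage [s >= n] then the string of the level just below that of [n] is the same at
   stage [s] and at the stage of entry, when it becomes an error string. *)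
Lemma Aset_le_Yset b : b <= 1 -> turing_le (Aset b) (Yset b).
Proof.
  intros Lb. assert (C : CF (Yset b) (Aset b)); [|exact C].
  (* Level [0] is excluded as well: it never acts, and there is no string below it to compare with
     the oracle. *)
  set (off := fun n => Nat.even (fst (of_nat n) + b) || (fst (of_nat n) =? 0)).
  apply (CF_search (Yset b)
    (fun p => off (fst p) || ((fst p <? snd p) &&
       eqE (rho (snd p) (fst (of_nat (fst p)) - 1))
           (restr (Yset b) (length (rho (snd p) (fst (of_nat (fst p)) - 1))))))
    (fun p => negb (off (fst p)) && memb (fst p) (log (snd p)))).
  - unfold off, restr, rho, lev, levels. cf; try apply CF_oracle; try apply CF_state_at; cf.
  - unfold off, log. cf. apply CF_state_at. cf.
  - intros n. cbn [fst snd]. destruct (off n) eqn:O; [exists 0; reflexivity|]. cbn [orb].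
    unfold off in O. apply orb_false_iff in O as [O1 O2]. apply Nat.eqb_neq in O2.
    set (i := fst (of_nat n)) in *.
    assert (P : Nat.even (i - 1 + b) = true).
    { replace (i + b) with (S (i - 1 + b)) in O1 by lia.
      now rewrite Nat.even_succ, <- Nat.negb_even, negb_false_iff in O1. }
    destruct (even_split _ _ Lb P) as [j Ej]. rewrite Ej. destruct (rho_Yset b j) as [s0 [_ H0]].
    exists (s0 + S n). apply andb_true_iff. split; [apply Nat.ltb_lt; lia|].
    apply eqE_spec. apply cyl_restr. apply H0. lia.
  - intros n s. cbn [fst snd]. intros H. apply eq_true_iff_eq.
    rewrite Aset_spec, andb_true_iff, memb_spec, negb_true_iff. split.
    + intros [O I]. apply orb_false_iff in O as [O _]. eauto.
    + intros [t [H1 H2]]. destruct (log_in t n H1) as [i [q [k [En [Li _]]]]].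
      assert (O : off n = false).
      { unfold off. rewrite H2. rewrite En, fst_follower. apply Nat.eqb_neq. lia. }
      split; auto. rewrite O in H. cbn [orb] in H. apply andb_true_iff in H as [Ls H].
      apply Nat.ltb_lt in Ls. apply eqE_eq in H. rewrite En, fst_follower in H, H2.
      destruct (in_dec Nat.eq_dec n (log s)) as [I|I]; auto. exfalso.
      destruct (le_lt_dec s t) as [L|L]; [|apply I, (log_incl t s); [lia|auto]].
      destruct (log_enters s t _ L I H1) as [u [Lu [A E]]]. rewrite En in E.
      pose proof (follower_bounds i q k) as NB. apply follower_inj in E as [Ei [Eq _]].
      destruct (act_idx_spec u A) as [Z _]. destruct (act_spec u A) as [La _].
      rewrite <- Ei in *.
      (* The search requires [n < s], and the stamp satisfies [q <= n]; so [s] lies between the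
         stamp and the stage of entry. *)
      assert (Ea : acc s i = acc u i) by (apply stamp_acc; auto; lia).
      assert (Er : rho s (i - 1) = rho u (i - 1)).
      { assert (G : forall v, lev v (i - 1) = nth (i - 1) (acc v i) dlevel).
        { intros v. unfold acc. rewrite nth_firstn_lt by lia. reflexivity. }
        unfold rho. now rewrite !G, Ea. }
      apply (Yset_avoids_errors b (S u) (i - 1, rho u (i - 1))).
      * rewrite errs_S, <- Ei. apply Nat.eqb_neq in A. rewrite A. now left.
      * cbn [fst]. replace (i + b) with (S (i - 1 + b)) in H2 by lia.
        now rewrite Nat.even_succ, <- Nat.negb_even, negb_false_iff in H2.
      * cbn [snd]. apply cyl_restr. now rewrite <- Er.
Qed.

(** The limit condition of the level for the given functional decides. If it never acted, the
    follower stays out and output zero is avoided; if it acted, the follower is in although the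
    output is zero. *)
Lemma Yset_not_ge b b' : b <= 1 -> b' = 1 - b -> ~ turing_le (Aset b') (Yset b).
Proof.
  intros Lb Eb [e He].
  (* The level of parity [b] devoted to index [code e]: [2 * code e + 2] for [b = 0] and
     [2 * code e + 1] for [b = 1]. *)
  assert (Ei : exists i, 1 <= i /\ Nat.div2 (i - 1) = code e /\ Nat.even (i + b) = true).
  { assert (b = 0 \/ b = 1) as [->| ->] by lia; [exists (2 * code e + 2)|exists (2 * code e + 1)];
      (split; [lia|split]).
    - replace (2 * code e + 2 - 1) with (S (2 * code e)) by lia. apply Nat.div2_succ_double.
    - replace (2 * code e + 2 + 0) with (0 + 2 * (code e + 1)) by lia. apply Nat.even_add_mul_2.
    - replace (2 * code e + 1 - 1) with (2 * code e) by lia. apply Nat.div2_double.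
    - replace (2 * code e + 1 + 1) with (0 + 2 * (code e + 1)) by lia. apply Nat.even_add_mul_2. }
  destruct Ei as [i [i1 [Hi Pi]]].
  assert (Pi' : Nat.even (i + b') = false).
  { rewrite <- negb_true_iff, Nat.negb_even, <- Nat.even_succ.
    destruct (even_split _ _ Lb Pi) as [j ->]. subst b'.
    replace (S (2 * j + b + (1 - b))) with (0 + 2 * (j + 1)) by lia. apply Nat.even_add_mul_2. }
  destruct (stable_exists (S i)) as [s0 St].
  assert (Ls0 : S i < s0) by apply St.
  set (c := cnd s0 i). assert (Sc : forall s, s0 <= s -> cnd s i = c) by (intros; now apply stable_cnd).
  set (n := follower i (fst c) (snd (snd c))). specialize (He n).
  destruct (Nat.eq_dec (fst (snd c)) 0) as [Z|Z].
  - assert (A0 : Aset b' n = false).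
    { apply not_true_iff_false. rewrite Aset_spec. intros [t [Ht _]].
      apply (log_incl t (s0 + t)) in Ht; [|lia].
      destruct (log_in _ _ Ht) as [i' [q [k [En [_ [_ Hq]]]]]]. apply follower_inj in En as [<- [<- <-]].
      rewrite Sc in Hq by lia. lia. }
    rewrite A0 in He. apply evalb_complete in He as [t0 Ht].
    (* Long enough for the computation to be seen, for the condition of level [i] to be included,
       and for [n] to be below the length of [X]. *)
    destruct (Yset_class b (t0 + i + S n) s0) as [s [X [Ls [LX [H1 [_ [_ H2]]]]]]].
    specialize (H2 i ltac:(lia) Pi). rewrite Sc in H2 by auto. unfold condok in H2.
    rewrite Z, Nat.eqb_refl in H2. apply negb_true_iff, not_true_iff_false in H2. apply H2.
    fold n. unfold outputs_zero. rewrite Hi. apply andb_true_iff. split.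
    + apply andb_true_iff. split; apply Nat.ltb_lt; lia.
    + rewrite <- (firstn_skipn (t0 + i + S n) X), H1. apply evalb_mono. apply Ht; [apply restr_cyl|].
      rewrite restr_length. lia.
  - assert (A1 : Aset b' n = true).
    { apply Aset_spec. exists s0. split; [apply acted_in_log; auto; lia|].
      unfold n. now rewrite fst_follower. }
    rewrite A1 in He. set (m := resolution (fst (snd c) - 1)).
    destruct (Yset_class b (m + i) s0) as [s [X [Ls [LX [H1 [_ [_ H2]]]]]]].
    specialize (H2 i ltac:(lia) Pi). rewrite Sc in H2 by auto. unfold condok in H2.
    apply Nat.eqb_neq in Z. rewrite Z in H2. fold n m in H2. unfold outputs_zero in H2.
    apply andb_true_iff in H2 as [_ H2]. rewrite Hi in H2.
    assert (E : firstn m X = restr (Yset b) m).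
    { rewrite <- (firstn_restr (Yset b) m (m + i)), <- H1, firstn_firstn by lia. f_equal. lia. }
    rewrite E in H2. apply (evalb_sound (Yset b)) in H2; [|apply restr_cyl].
    pose proof (eval_det _ _ _ _ _ He H2) as F. discriminate.
Qed.

End Dynamics.

Theorem theorem5p15 :
  forall D : set_nat, ce D -> ~ computable D ->
  exists A B : set_nat,
    ce A /\ ce B /\ turing_le A D /\ turing_le B D /\
    ~ ML_le A B /\ ~ ML_le B A.
Proof.
  intros D [e He] NC. set (d := code e).
  assert (HD : forall k, D k = true <-> exists s, inD d s k = true).
  { intros k. rewrite He. unfold inD. split.
    (* [S k] is added because [inD] also asks for [k < s]. *)
    - intros [v Hv]. apply evalb_complete in Hv as [t Ht]. exists (t + S k).
      apply andb_true_iff. split; [apply Nat.ltb_lt; lia|]. apply haltb_spec. exists v.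
      apply Ht; [apply zeros_cyl|]. rewrite zeros_length. lia.
    - intros [s Hs]. apply andb_true_iff in Hs as [_ Hs]. apply haltb_spec in Hs as [v Hv].
      exists v. apply (evalb_sound _ _ _ _ _ (zeros_cyl s) Hv). }
  exists (Aset d 0), (Aset d 1). repeat split; try apply Aset_ce; try (now apply Aset_le_D).
  (* [Y_1] is random and computes the second set but not the first; the other case uses [Y_0]. *)
  - intros H. apply (Yset_not_ge d D HD NC 1 0); auto.
    apply H; [now apply (Yset_random d D)|now apply (Aset_le_Yset d D)].
  - intros H. apply (Yset_not_ge d D HD NC 0 1); auto.
    apply H; [now apply (Yset_random d D)|apply (Aset_le_Yset d D); auto].
Qed.
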